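(* Let $(M^n,J,g)$ be a balanced BTP Hermitian manifold of complex dimension $n\ge2$ with $H^c\equiv 0$. Fix $p\in M$ and let $\mathfrak g_p=(T^{1,0}_pM,T_p)$ be its torsion Lie algebra. Put $\mathfrak r_p=\operatorname{Rad}(\mathfrak g_p)$ and $U_p=\mathfrak r_p^{\perp}$. Then: (1) $[U_p,\mathfrak r_p]=0$ and $[U_p,U_p]\subset U_p$. Consequently, $\mathfrak g_p=\mathfrak r_p\oplus U_p$ is an orthogonal direct sum of commuting ideals, and $U_p$ is semisimple. (2) $Z(\mathfrak g_p)\perp[\mathfrak g_p,\mathfrak g_p]$. (3) If $\mathfrak g_p$ is nilpotent, then it is abelian.
   Context: The metric $g$ is extended complex bilinearly to $TM\otimes_{\mathbb R}\mathbb C$, and $\|X\|^2=g(X,\overline X)$ for $X\in T^{1,0}M$; orthogonality in $T^{1,0}_pM$ is with respect to the Hermitian inner product $(x,y)\mapsto g(x,\overline y)$. $R^c$ is the curvature of the Chern connection (with $R(X,Y)=\nabla_X\nabla_Y-\nabla_Y\nabla_X-\nabla_{[X,Y]}$ and $R^c(X,\overline Y,Z,\overline W)=g(R^c(X,\overline Y)Z,\overline W)$), and $T$ is the torsion of the Chern connection, a section of $\Lambda^2(T^{1,0}M)^*\otimes T^{1,0}M$. $H^c\equiv0$ means $H^c(X)=R^c(X,\overline X,X,\overline X)/\|X\|^4=0$ for all nonzero $X\in T^{1,0}M$. The Bismut connection $\nabla^b$ is the unique Hermitian connection ($\nabla^b g=0$, $\nabla^b J=0$) with totally skew-symmetric torsion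 $T^b$; $g$ is BTP if $\nabla^bT^b=0$, equivalently $\nabla^bT=0$. $g$ is balanced if $d\omega^{n-1}=0$ for its Hermitian form $\omega$; equivalently $\sum_iT^i_{ik}=0$ for all $k$ in any local unitary frame $e_1,\dots,e_n$, where $T(e_i,e_k)=\sum_jT^j_{ik}e_j$. For a BTP metric, $[x,y]:=T_p(x,y)$ is a complex Lie bracket on $T^{1,0}_pM$, and $\mathfrak g_p=(T^{1,0}_pM,T_p)$ is called the torsion Lie algebra at $p$. $\operatorname{Rad}$ denotes the solvable radical and $Z$ the center; the zero algebra is regarded as semisimple. *)

(* Defs.v *)
From HB Require Import structures.
From mathcomp Require Import all_boot all_order all_algebra all_fingroup.
From mathcomp Require Import complex.
From mathcomp Require Import all_classical all_reals all_analysis.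

Set Implicit Arguments.
Unset Strict Implicit.
Unset Printing Implicit Defensive.

Import Order.TTheory GRing.Theory Num.Theory numFieldNormedType.Exports.
Local Open Scope classical_set_scope.
Local Open Scope ring_scope.

(** * Lie algebras: subspaces of a finite-dimensional space under a bracket *)

Section LieAlgebra.
Variables (F : fieldType) (V : vectType F) (br : V -> V -> V).
Implicit Types A B I g r : {vspace V}.

(* For a bilinear bracket this is the span of all [a, b], a in A, b in B. *)
Definition lie_span A B : {vspace V} :=
  <<[seq br a b | a <- vbasis A, b <- vbasis B]>>%VS.

Definition lie_ideal g I : Prop := (I <= g)%VS /\ (lie_span g I <= I)%VS.

Definition lie_abelian g : Prop := lie_span g g = 0%VS.

Definition lie_solvable g : Prop :=
  exists k, iter k (fun A => lie_span A A) g = 0%VS.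

Definition lie_nilpotent g : Prop :=
  exists k, iter k (fun A => lie_span g A) g = 0%VS.

Definition is_lie_radical g r : Prop :=
  [/\ lie_ideal g r, lie_solvable r &
      forall I, lie_ideal g I -> lie_solvable I -> (I <= r)%VS].

(* The largest solvable ideal; it exists for every antisymmetric bilinear
   bracket, see [lie_radicalP] below. *)
Definition lie_radical g : {vspace V} := xget 0%VS [set r | is_lie_radical g r].

Definition lie_semisimple g : Prop := lie_radical g = 0%VS.

Definition lie_center g : set V :=
  [set z | z \in g /\ forall y, y \in g -> br z y = 0].

Hypothesis br_linl : forall y, linear (br^~ y).
Hypothesis br_linr : forall x, linear (br x).

Let brl y := linfun (br^~ y).
Let brr x := linfun (br x).

Let brlE y x : brl y x = br x y.
Proof.
pose L := GRing.isLinear.Build F V V _ (br^~ y) (br_linl y).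
pose f : {linear V -> V} := HB.pack (br^~ y) L.
exact: (lfunE f).
Qed.

Let brrE x y : brr x y = br x y.
Proof.
pose L := GRing.isLinear.Build F V V _ (br x) (br_linr x).
pose f : {linear V -> V} := HB.pack (br x) L.
exact: (lfunE f).
Qed.

Lemma mem_lie_span A B a b : a \in A -> b \in B -> br a b \in lie_span A B.
Proof.
move=> aA bB; rewrite -brlE (coord_vbasis aA) linear_sum memv_suml// => i _.
rewrite linearZ memvZ//= brlE -brrE (coord_vbasis bB) linear_sum.
rewrite memv_suml// => j _; rewrite linearZ memvZ//= brrE memv_span//.
apply/allpairsP; exists ((vbasis A)`_i, (vbasis B)`_j).
by rewrite !mem_nth// size_tuple.
Qed.

Lemma lie_span_sub A B (C : {vspace V}) :
  (forall a b, a \in A -> b \in B -> br a b \in C) -> (lie_span A B <= C)%VS.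
Proof.
move=> H; apply/span_subvP => _ /allpairsP[[a b] [/= aA bB ->]].
by apply: H; apply: vbasis_mem.
Qed.

Lemma lie_spanS A A' B B' : (A <= A')%VS -> (B <= B')%VS ->
  (lie_span A B <= lie_span A' B')%VS.
Proof.
move=> /subvP sA /subvP sB; apply: lie_span_sub => a b /sA aA /sB bB.
exact: mem_lie_span.
Qed.

Let brDl x x' y : br (x + x') y = br x y + br x' y.
Proof. by rewrite -!brlE linearD. Qed.

Let brDr x y y' : br x (y + y') = br x y + br x y'.
Proof. by rewrite -!brrE linearD. Qed.

Let der k A := iter k (fun A => lie_span A A) A.

Let derS k A B : (A <= B)%VS -> (der k A <= der k B)%VS.
Proof. by move=> sAB; elim: k => //= k IH; apply: lie_spanS. Qed.

(* Sums of solvable ideals are solvable, so a solvable ideal of maximal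
   dimension contains all the others. The Jacobi identity is not needed. *)
Lemma lie_radicalP g : (forall x y, br x y = - br y x) ->
  is_lie_radical g (lie_radical g).
Proof.
move=> brN.
have sumP I J : lie_ideal g I -> lie_solvable I -> lie_ideal g J ->
    lie_solvable J -> lie_ideal g (I + J)%VS /\ lie_solvable (I + J)%VS.
  move=> [Ig II] [k solI] [Jg JJ] [l solJ]; split.
    split; first by rewrite subv_add Ig Jg.
    apply: lie_span_sub => a y ag /memv_addP[b bI [c cJ ->]].
    rewrite brDr memv_add//.
      by apply: (subvP II); apply: mem_lie_span.
    by apply: (subvP JJ); apply: mem_lie_span.
  have dI m : (der m I <= g)%VS.
    apply: (subv_trans _ Ig); elim: m => //= m IH; apply: (subv_trans _ II).
    exact: lie_spanS (subv_trans IH Ig) IH.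
  have dIJ m : (der m (I + J) <= der m I + J)%VS.
    elim: m => //= m IH; apply: subv_trans (lie_spanS IH IH) _.
    apply: lie_span_sub => x y /memv_addP[a aI [b bJ ->]].
    move=> /memv_addP[c cI [d dJ ->]]; rewrite brDl 2!brDr -addrA.
    have ag := subvP (dI m) _ aI; have cg := subvP (dI m) _ cI.
    have bg := subvP Jg _ bJ.
    rewrite memv_add ?mem_lie_span//.
    rewrite !memvD// ?(brN b c) ?memvN; apply: (subvP JJ); exact: mem_lie_span.
  exists (l + k)%N; rewrite iterD; apply/eqP; rewrite -subv0.
  have := dIJ k; rewrite /der solI add0v => /(@derS l).
  by rewrite /der solJ.
pose P d := `[< exists I, [/\ lie_ideal g I, lie_solvable I & \dim I = d] >].
have exP : exists d, P d.
  exists 0%N; apply/asboolP; exists 0%VS; split; [|by exists 0%N|exact: dimv0].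
  split; first exact: sub0v.
  apply: lie_span_sub => a b _; rewrite memv0 => /eqP ->.
  by rewrite -brrE linear0 mem0v.
have leP d : P d -> (d <= \dim g)%N.
  by move=> /asboolP[I [[Ig _] _ <-]]; apply: dimvS.
have [d /asboolP[r [rI rs rd]] dmax] := ex_maxnP exP leP.
rewrite /lie_radical; case: xgetP => [s _ //|/(_ r)[]]; split=> // I II Is.
have [sI ss] := sumP _ _ rI rs II Is.
have : (\dim (r + I) <= \dim r)%N.
  by rewrite rd; apply: dmax; apply/asboolP; exists (r + I)%VS.
rewrite (geq_leqif (dimv_leqif_sup (addvSl r I))).
exact: subv_trans (addvSr _ _).
Qed.

End LieAlgebra.

(** * Calculus on open subsets of C^n

   C^n is the real vector space 'rV[R]_(n + n), the point (x, y) having complex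
   coordinates z_k = x_k + i y_k. *)

Section Calculus.
Variables (R : realType) (n : nat).
Local Notation E := 'rV[R]_(n + n).
Implicit Types (D : set E) (X Y Z : E -> E).

(* Multiplication by i on row vectors: (x, y) *m Jmx = (- y, x). *)
Definition Jmx : 'M[R]_(n + n) := block_mx 0 1%:M (- 1%:M) 0.

(* All iterated directional derivatives exist and are differentiable on D
   (D open), i.e. f is C^oo on D. *)
Definition smooth_on (W : normedModType R) D (f : E -> W) : Prop :=
  forall (s : seq E) x, D x ->
    differentiable (foldr (fun v (h : E -> W) => 'D_v h) f s) x.

Definition holomorphic_on D (f : E -> E) : Prop :=
  forall x, D x -> differentiable f x /\
    forall v, 'D_(v *m Jmx) f x = 'D_v f x *m Jmx.

Definition lie_bracket X Y : E -> E := fun x => 'D_(X x) Y x - 'D_(Y x) X x.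

Definition metric_val (G : E -> 'M[R]_(n + n)) (x u v : E) : R :=
  (u *m G x *m v^T) 0 0.

(* A connection on TD is given by the vector-valued Christoffel symbols
   Gam x i j = (nabla_{e_i} e_j)(x) of the coordinate frame. *)
Definition christoffel := E -> 'I_(n + n) -> 'I_(n + n) -> E.
Implicit Type Gam : christoffel.

Definition cov Gam X Y : E -> E := fun x =>
  'D_(X x) Y x + \sum_i \sum_j (X x 0 i * Y x 0 j) *: Gam x i j.

Definition torsion Gam X Y : E -> E := fun x =>
  cov Gam X Y x - cov Gam Y X x - lie_bracket X Y x.

Definition curvature Gam X Y Z : E -> E := fun x =>
  cov Gam X (cov Gam Y Z) x - cov Gam Y (cov Gam X Z) x
  - cov Gam (lie_bracket X Y) Z x.

(* Torsion and curvature are tensors: their values on vectors at a point are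
   computed with the constant extensions of these vectors. *)
Definition torsion_at Gam (x u v : E) : E :=
  torsion Gam (fun=> u) (fun=> v) x.

Definition curvature_at Gam (x u v w : E) : E :=
  curvature Gam (fun=> u) (fun=> v) (fun=> w) x.

Definition metric_parallel D (G : E -> 'M[R]_(n + n)) Gam : Prop :=
  forall X Y Z, smooth_on D X -> smooth_on D Y -> smooth_on D Z ->
  forall x, D x ->
    'D_(X x) (fun y => metric_val G y (Y y) (Z y) : R^o) x
    = metric_val G x (cov Gam X Y x) (Z x)
      + metric_val G x (Y x) (cov Gam X Z x).

Definition complex_parallel D Gam : Prop :=
  forall X Y, smooth_on D X -> smooth_on D Y ->
  forall x, D x -> cov Gam X (fun y => Y y *m Jmx) x = cov Gam X Y x *m Jmx.

Definition torsion_parallel_on D Gam : Prop :=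
  forall X Y Z, smooth_on D X -> smooth_on D Y -> smooth_on D Z ->
  forall x, D x ->
    cov Gam X (torsion Gam Y Z) x
    = torsion Gam (cov Gam X Y) Z x + torsion Gam Y (cov Gam X Z) x.

(** Differential forms, as functions of a point and of tangent vectors *)

Definition form (k : nat) := E -> ('I_k -> E) -> R.

Definition wedge p q (a : form p) (b : form q) : form (p + q) := fun x v =>
  (p`! * q`!)%:R^-1 *
  \sum_(s : 'S_(p + q)) (-1) ^+ s *
    (a x (fun i => v (s (lshift q i))) * b x (fun j => v (s (rshift p j)))).

Fixpoint wedge_pow (w : form 2) (k : nat) : form (k * 2) :=
  match k with
  | 0 => fun _ _ => 1
  | k'.+1 => wedge w (@wedge_pow w k')
  end.

(* The v i being constant vector fields, no bracket term occurs. *)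
Definition ext_d k (a : form k) : form k.+1 := fun x v =>
  \sum_(i < k.+1) (-1) ^+ i *
    'D_(v i) (fun y => a y (fun j => v (lift i j)) : R^o) x.

(* omega(X, Y) = g(J X, Y) *)
Definition hermitian_form (G : E -> 'M[R]_(n + n)) : form 2 := fun x v =>
  metric_val G x (v ord0 *m Jmx) (v ord_max).

(** Complexification *)

Local Notation EC := 'rV[R[i]]_(n + n).

Definition conj_vec (z : EC) : EC := map_mx conjc z.

(* The complex linear extension of a real linear map *)
Definition cext (W : lmodType R[i]) (f : E -> W) (z : EC) : W :=
  f (map_mx (@complex.Re R) z) + 'i%C *: f (map_mx (@complex.Im R) z).

Definition T10 : {vspace EC} :=
  passmx.leigenspace
    (linfun (mulmxr (map_mx (real_complex R) Jmx) : EC -> EC)) 'i%C.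

Definition metricC (G : E -> 'M[R]_(n + n)) (x : E) (u v : EC) : R[i] :=
  (u *m map_mx (real_complex R) (G x) *m v^T) 0 0.

Definition herm_prod (G : E -> 'M[R]_(n + n)) (x : E) (u v : EC) : R[i] :=
  metricC G x u (conj_vec v).

Definition torsionC Gam (x : E) (u v : EC) : EC :=
  cext (fun a => cext (fun b =>
    map_mx (real_complex R) (torsion_at Gam x a b)) v) u.

Definition curvatureC Gam (x : E) (u v w : EC) : EC :=
  cext (fun a => cext (fun b => cext (fun c =>
    map_mx (real_complex R) (curvature_at Gam x a b c)) w) v) u.

(* Orthogonal complement of r in T10 for the Hermitian product at x *)
Definition orth10 (G : E -> 'M[R]_(n + n)) (x : E) (r : {vspace EC}) :
    {vspace EC} :=
  (T10 :&: \bigcap_(a <- vbasis r)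
             lker (linfun (fun u : EC => herm_prod G x u a : R[i]^o)))%VS.

End Calculus.

Arguments Jmx {R n}.
Arguments T10 {R n}.
Arguments wedge_pow {R n} w k _ _.

(** * Complex manifolds *)

Record chart (R : realType) (n : nat) (M : topologicalType) := Chart {
  chart_dom : set M;
  chart_coord : M -> 'rV[R]_(n + n);
  chart_inv : 'rV[R]_(n + n) -> M;
  chart_dom_open : open chart_dom;
  chart_img_open : open (chart_coord @` chart_dom);
  chart_coordK : forall p, chart_dom p -> chart_inv (chart_coord p) = p;
  chart_coord_cts : {within chart_dom, continuous chart_coord};
  chart_inv_cts : {within chart_coord @` chart_dom, continuous chart_inv} }.

Definition overlap R n M (c c' : chart R n M) : set 'rV[R]_(n + n) :=
  chart_coord c @` (chart_dom c `&` chart_dom c').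

Definition transition R n M (c c' : chart R n M) :
  'rV[R]_(n + n) -> 'rV[R]_(n + n) := fun x => chart_coord c' (chart_inv c x).

Record complexManifold (R : realType) (n : nat) := ComplexManifold {
  carrier :> topologicalType;
  hausdorff_carrier : hausdorff_space carrier;
  second_countable_carrier : @second_countable carrier;
  chart_index : Type;
  charts : chart_index -> chart R n carrier;
  charts_cover : forall p, exists i, chart_dom (charts i) p;
  charts_holomorphic : forall i j,
    holomorphic_on (overlap (charts i) (charts j))
                   (transition (charts i) (charts j)) }.

Section HermitianManifold.
Variables (R : realType) (n : nat) (M : complexManifold R n).
Local Notation E := 'rV[R]_(n + n).

Definition chart_codom (i : chart_index M) : set E :=
  chart_coord (charts i) @` chart_dom (charts i).

Definition trans (i j : chart_index M) : E -> E :=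
  transition (charts i) (charts j).

Definition pushforward (i j : chart_index M) (X : E -> E) : E -> E :=
  fun y => 'D_(X (trans j i y)) (trans i j) (trans j i y).

(* In every chart the matrix of a J-invariant Riemannian metric *)
Record hermitianMetric := HermitianMetric {
  gmx : chart_index M -> E -> 'M[R]_(n + n);
  gmx_smooth : forall i, smooth_on (chart_codom i) (gmx i);
  gmx_sym : forall i x, chart_codom i x -> (gmx i x)^T = gmx i x;
  gmx_pos : forall i x u, chart_codom i x -> u != 0 ->
    0 < metric_val (gmx i) x u u;
  gmx_J : forall i x u v, chart_codom i x ->
    metric_val (gmx i) x (u *m Jmx) (v *m Jmx) = metric_val (gmx i) x u v;
  gmx_compat : forall i j x u v, overlap (charts i) (charts j) x ->
    metric_val (gmx j) (trans i j x)
      ('D_u (trans i j) x) ('D_v (trans i j) x)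
    = metric_val (gmx i) x u v }.

(* A smooth affine connection on the real tangent bundle TM *)
Record connection := Connection {
  symb : chart_index M -> christoffel R n;
  symb_smooth : forall i a b,
    smooth_on (chart_codom i) (fun x => symb i x a b);
  symb_compat : forall i j X Y,
    smooth_on (overlap (charts i) (charts j)) X ->
    smooth_on (overlap (charts i) (charts j)) Y ->
    forall x, overlap (charts i) (charts j) x ->
      cov (symb j) (pushforward i j X) (pushforward i j Y) (trans i j x)
      = 'D_(cov (symb i) X Y x) (trans i j) x }.

Variable g : hermitianMetric.

Definition is_hermitian (D : connection) : Prop :=
  forall i, metric_parallel (chart_codom i) (gmx g i) (symb D i)
         /\ complex_parallel (chart_codom i) (symb D i).

(* The Chern connection is the Hermitian connection whose torsion has no
   (1,1)-part. *)
Definition is_chern (D : connection) : Prop :=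
  is_hermitian D /\
  forall i x u v, chart_codom i x -> u \in T10 -> v \in T10 ->
    torsionC (symb D i) x u (conj_vec v) = 0.

(* Skew-symmetry in the first two arguments is automatic. *)
Definition is_bismut (D : connection) : Prop :=
  is_hermitian D /\
  forall i x u v w, chart_codom i x ->
    metric_val (gmx g i) x (torsion_at (symb D i) x u v) w
    = - metric_val (gmx g i) x (torsion_at (symb D i) x u w) v.

Definition torsion_parallel (D : connection) : Prop :=
  forall i, torsion_parallel_on (chart_codom i) (symb D i).

Definition is_BTP : Prop := exists2 D, is_bismut D & torsion_parallel D.

Definition is_balanced : Prop :=
  forall i x v, chart_codom i x ->
    ext_d (wedge_pow (hermitian_form (gmx g i)) n.-1) x v = 0.

(* D being the Chern connection, H^c(u) = R^c(u, ubar, u, ubar) / |u|^4 *)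
Definition holo_sect_curv (D : connection) i (x : E) (u : 'rV[R[i]]_(n + n)) :
    R[i] :=
  metricC (gmx g i) x (curvatureC (symb D i) x u (conj_vec u) u) (conj_vec u)
  / (metricC (gmx g i) x u (conj_vec u)) ^+ 2.

Definition zero_holo_sect_curv (D : connection) : Prop :=
  forall i x u, chart_codom i x -> u \in T10 -> u != 0 ->
    holo_sect_curv D i x u = 0.

End HermitianManifold.

(* Main.v *)
Require Import Defs.
From HB Require Import structures.
From mathcomp Require Import all_boot all_order all_algebra all_fingroup.
From mathcomp Require Import complex.
From mathcomp Require Import all_classical all_reals all_analysis.
From mathcomp Require Import ring lra zify.

(** Let nabla be the Bismut connection, T its torsion and R its curvature, all
    extended complex linearly. The Chern connection is nabla - A, where A u is
    the J-linear part of T u ([chern_eq_bismut]), and the torsion bracket on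
    T^{1,0} is [x, y] = - T (x, y). In a unitary frame put
    c_ijk = g ([e_i, e_j], conj e_k) and
    F_ijkl = g (R (e_i, conj e_j) e_k, conj e_l). Three facts about these
    arrays carry the proof.

    - sum_i c_iki = 0, because the metric is balanced ([balanced_trace]).
      Indeed d (omega^{n-1}) evaluated on z followed by pairs f, J f from a
      unitary frame is a multiple of a sum of d omega (z, f, J f), and
      d omega (z, f, J f) = g (J T (f, J f), z).
    - 4 F_ijkl is a quadratic expression in c ([rarr_formula]): the Bianchi
      identity for parallel torsion controls F_ijkl - F_kjil, and H^c = 0,
      polarised, controls the sum of the Chern curvature over the exchanges
      of i with k and of j with l.
    - R acts on T as a derivation with value zero ([curv_tor]).

    The trace sum_i F_iikl is then (Q - P)_kl / 4, where
    Q_kl = sum c_abl conj c_abk and P_kl = sum c_kab conj c_lab. Choose the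
    frame so that it is diagonal with eigenvalues d. The derivation property
    gives d_k = d_i + d_j whenever c_ijk <> 0. As the matrices
    F_ij = (F_ijkl)_kl commute with Q and P, F_ijkl = 0 when d_k <> d_l. Summing
    the equations F_ijji = 0 over the pairs with d_i <> d_j expresses a
    nonnegative combination of the |c_ijk|^2 as minus a square, so that
    c_ijk = 0 unless d_i = d_j = 0, and then all d_k vanish ([array_weight0]).
    Hence P = Q in every unitary frame.

    This equality splits off ideals ([ideal_split]). In a unitary frame adapted
    to an ideal I and its orthogonal complement, sum over k outside I of
    Q_kk - P_kk = 0 only involves, up to cancellation, the c_ijk with i outside
    I and j or k inside. Hence [I^perp, I] = 0 and [I^perp, I^perp] is
    orthogonal to I. Taking for I the radical gives (1), the line of a central
    element gives (2). With I = [r, r] one finds [I, I] = I, so that the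
    solvable ideal r is abelian, and a nilpotent algebra is its own radical;
    this is (3). *)

Set Implicit Arguments.
Unset Strict Implicit.
Unset Printing Implicit Defensive.

Import Order.TTheory GRing.Theory Num.Theory numFieldNormedType.Exports.
Local Open Scope classical_set_scope.
Local Open Scope ring_scope.

(** * Linear maps given as functions *)

Section LinearRules.
Variables (K : nzRingType) (U V : lmodType K) (f : U -> V).
Hypothesis fl : linear f.
Lemma linfD u v : f (u + v) = f u + f v.
Proof. by have := fl 1 u v; rewrite !scale1r. Qed.
Lemma linf0 : f 0 = 0.
Proof. by have := fl (-1) 0 0; rewrite scaler0 addr0 scaleN1r addNr. Qed.
Lemma linfZ a u : f (a *: u) = a *: f u.
Proof. by have := fl a u 0; rewrite !addr0 linf0 addr0. Qed.
Lemma linfN u : f (- u) = - f u.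
Proof. by rewrite -scaleN1r linfZ scaleN1r. Qed.
End LinearRules.

(** * Arrays of torsion and curvature components *)

Section TorsionArray.
Variables (C : numClosedFieldType) (n : nat).
Variable c : 'I_n -> 'I_n -> 'I_n -> C.

(** The components g (T (T (e_i, conj e_j), e_k), conj e_l) and g (T (T (e_i,
    e_k), conj e_j), conj e_l) are combinations of these two contractions of
    c with its conjugate. *)
Definition xarr i j k l := \sum_m (c j m i)^* * c k m l.
Definition yarr i k j l := \sum_m c i k m * (c j l m)^*.
(** Gram matrices of the bracket read through its values (first) and through
    the adjoint maps [e_k, .] (second); both are nonnegative, and the Ricci
    form is a quarter of their difference. *)
Definition image_gram k l := \sum_a \sum_b c a b l * (c a b k)^*.
Definition adjoint_gram k l := \sum_a \sum_b c k a b * (c l a b)^*.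

Variable F : 'I_n -> 'I_n -> 'I_n -> 'I_n -> C.

Hypothesis cN : forall i j k, c i j k = - c j i k.
Hypothesis ctr : forall k, \sum_i c i k i = 0.
Hypothesis F4 : forall i j k l, 4 * F i j k l =
  xarr k j i l + xarr i l k j - 3 * xarr i j k l - 3 * xarr k l i j
  - 2 * yarr i k j l.
Hypothesis Fder : forall i j k l p,
  \sum_m c k l m * F i j m p =
  \sum_m (F i j k m * c m l p + F i j l m * c k m p).

Let four_neq0 : (4 : C) != 0. Proof. by rewrite pnatr_eq0. Qed.

Lemma xarrJ i j k l : (xarr i j k l)^* = xarr l k j i.
Proof.
rewrite rmorph_sum; apply: eq_bigr => m _.
by rewrite rmorphM /= conjCK mulrC.
Qed.

Lemma yarrJ i k j l : (yarr i k j l)^* = yarr j l i k.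
Proof.
rewrite rmorph_sum; apply: eq_bigr => m _.
by rewrite rmorphM /= conjCK mulrC.
Qed.

Lemma yarrC i k j l : yarr k i l j = yarr i k j l.
Proof.
by apply: eq_bigr => m _; rewrite cN [c l j m]cN rmorphN mulrNN.
Qed.

Lemma array_pair i j k l : F i j k l = F k l i j.
Proof.
apply: (mulfI four_neq0); rewrite !F4 -[yarr k i l j]yarrC; ring.
Qed.

Lemma array_conj i j k l : (F i j k l)^* = F j i l k.
Proof.
apply: (mulfI four_neq0).
have -> : 4 * (F i j k l)^* = (4 * F i j k l)^* by rewrite rmorphM rmorph_nat.
rewrite !F4 !rmorphB !rmorphD /= !rmorphM /= !rmorph_nat !xarrJ yarrJ.
ring.
Qed.

(** Every trace of c vanishes, which kills the two contractions that pair the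
    traced indices inside one factor. *)
Lemma array_ricci k l :
  4 * \sum_i F i i k l = image_gram k l - 2 * adjoint_gram k l + adjoint_gram k l.
Proof.
rewrite mulr_sumr.
have X0 : \sum_i xarr i i k l = 0.
  rewrite /xarr exchange_big /= big1 // => m _.
  by rewrite -mulr_suml -rmorph_sum /= ctr rmorph0 mul0r.
have X0' : \sum_i xarr k l i i = 0.
  rewrite /xarr exchange_big /= big1 // => m _.
  by rewrite -mulr_sumr /= ctr mulr0.
under eq_bigr do rewrite F4.
rewrite !sumrB big_split /= -!mulr_sumr X0 X0' !mulr0 !subr0.
have -> : \sum_i xarr k i i l = image_gram k l.
  by apply: eq_bigr => a _; apply: eq_bigr => b _; rewrite mulrC.
have -> : \sum_i xarr i l k i = adjoint_gram k l.
  rewrite /xarr /adjoint_gram exchange_big; apply: eq_bigr => a _.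
  by apply: eq_bigr => b _; rewrite mulrC.
have -> : \sum_i yarr i k i l = adjoint_gram k l.
  apply: eq_bigr => a _; apply: eq_bigr => b _.
  by rewrite cN [c a l b]cN rmorphN mulrNN.
ring.
Qed.

Lemma fder_conj i j k l p :
  \sum_m (c k l m)^* * F i j p m =
  \sum_m (F i j m k * (c m l p)^* + F i j m l * (c k m p)^*).
Proof.
transitivity ((\sum_m c k l m * F j i m p)^*).
  by rewrite rmorph_sum; apply: eq_bigr => m _; rewrite rmorphM /= array_conj.
rewrite Fder rmorph_sum; apply: eq_bigr => m _.
by rewrite rmorphD /= !rmorphM /= !array_conj.
Qed.

(** The Gram matrix of the bracket is invariant under the derivations F_ij,
    whose adjoints are the F_ji. *)
Lemma qarr_comm i j k l :
  \sum_m F i j k m * image_gram m l = \sum_m image_gram k m * F i j m l.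
Proof.
transitivity (\sum_a \sum_b c a b l * \sum_m (c a b m)^* * F i j k m).
  under eq_bigr do rewrite mulr_sumr.
  rewrite exchange_big; apply: eq_bigr => a _.
  under eq_bigr do rewrite mulr_sumr.
  rewrite exchange_big; apply: eq_bigr => b _; rewrite mulr_sumr.
  by apply: eq_bigr => m _; ring.
transitivity (\sum_a \sum_b (c a b k)^* * \sum_m c a b m * F i j m l); last first.
  symmetry; under eq_bigr do rewrite mulr_suml.
  rewrite exchange_big; apply: eq_bigr => a _.
  under eq_bigr do rewrite mulr_suml.
  rewrite exchange_big; apply: eq_bigr => b _; rewrite mulr_sumr.
  by apply: eq_bigr => m _; ring.
under eq_bigr do under eq_bigr do rewrite fder_conj big_split mulrDr !mulr_sumr /=.
under [RHS]eq_bigr do under eq_bigr do rewrite Fder big_split mulrDr !mulr_sumr /=.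
under eq_bigr do rewrite big_split.
under [RHS]eq_bigr do rewrite big_split.
rewrite !big_split /=; congr (_ + _).
  under eq_bigr do rewrite exchange_big.
  rewrite exchange_big /=; apply: eq_bigr => m _.
  rewrite exchange_big /=; apply: eq_bigr => a _.
  by apply: eq_bigr => b _; ring.
apply: eq_bigr => a _; rewrite exchange_big /=.
by apply: eq_bigr => b _; apply: eq_bigr => m _; ring.
Qed.

Lemma parr_comm i j k l :
  \sum_m F i j k m * adjoint_gram m l = \sum_m adjoint_gram k m * F i j m l.
Proof.
transitivity (\sum_a \sum_b (c l a b)^* * \sum_m F i j k m * c m a b).
  under eq_bigr do rewrite mulr_sumr.
  rewrite exchange_big; apply: eq_bigr => a _.
  under eq_bigr do rewrite mulr_sumr.
  rewrite exchange_big; apply: eq_bigr => b _; rewrite mulr_sumr.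
  by apply: eq_bigr => m _; ring.
transitivity (\sum_a \sum_b c k a b * \sum_m F i j m l * (c m a b)^*); last first.
  symmetry; under eq_bigr do rewrite mulr_suml.
  rewrite exchange_big; apply: eq_bigr => a _.
  under eq_bigr do rewrite mulr_suml.
  rewrite exchange_big; apply: eq_bigr => b _; rewrite mulr_sumr.
  by apply: eq_bigr => m _; ring.
have H1 a b : \sum_m F i j k m * c m a b =
    \sum_m c k a m * F i j m b - \sum_m F i j a m * c k m b.
  by rewrite Fder big_split /= addrK.
have H2 a b : \sum_m F i j m l * (c m a b)^* =
    \sum_m (c l a m)^* * F i j b m - \sum_m F i j m a * (c l m b)^*.
  by rewrite fder_conj big_split /= addrK.
under eq_bigr do under eq_bigr do rewrite H1 mulrBr !mulr_sumr.
under [RHS]eq_bigr do under eq_bigr do rewrite H2 mulrBr !mulr_sumr.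
under eq_bigr do rewrite sumrB.
under [RHS]eq_bigr do rewrite sumrB.
rewrite !sumrB; congr (_ - _).
  apply: eq_bigr => a _; rewrite exchange_big /=.
  by apply: eq_bigr => b _; apply: eq_bigr => m _; ring.
under eq_bigr do rewrite exchange_big.
rewrite exchange_big /=; apply: eq_bigr => m _.
rewrite exchange_big /=; apply: eq_bigr => a _.
by apply: eq_bigr => b _; ring.
Qed.

Section Diagonal.
Variable d : 'I_n -> C.
Hypothesis Fd : forall k l, \sum_i F i i k l = d k *+ (k == l).

(** The trace of the derivations F_ii is a derivation, acting diagonally with
    eigenvalues d. *)
Lemma weight_add i j k : c i j k != 0 -> d k = d i + d j.
Proof.
move=> cN0; have : c i j k * d k = c i j k * (d i + d j); last by move/(mulfI cN0).
transitivity (\sum_m c i j m * \sum_a F a a m k).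
  rewrite (bigD1 k) //= Fd eqxx mulr1n big1 ?addr0// => m /negPf mk.
  by rewrite Fd mk mulr0.
transitivity (\sum_a \sum_m c i j m * F a a m k).
  by rewrite exchange_big; apply: eq_bigr => m _; rewrite mulr_sumr.
under eq_bigr do rewrite Fder.
rewrite exchange_big /=.
under eq_bigr do rewrite big_split -!mulr_suml !Fd.
rewrite big_split /= (bigD1 i) //= big1 ?addr0; last first.
  by move=> m; rewrite eq_sym => /negPf ->; rewrite mul0r.
rewrite (bigD1 j) //= big1 ?addr0; last first.
  by move=> m; rewrite eq_sym => /negPf ->; rewrite mul0r.
by rewrite !eqxx !mulr1n; ring.
Qed.

(** F_ij commutes with the difference of the two Gram matrices, that is with
    the diagonal matrix of d. *)
Lemma array_diag i j k l : d k != d l -> F i j k l = 0.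
Proof.
move=> dkl; have dE : 4 * (d k *+ (k == l)) = image_gram k l - adjoint_gram k l.
  by rewrite -Fd array_ricci; ring.
have : (d k - d l) * F i j k l = 0; last first.
  by move/eqP; rewrite mulf_eq0 subr_eq0 (negPf dkl) => /eqP.
apply: (mulfI four_neq0); rewrite mulr0.
have E : \sum_m F i j k m * (image_gram m l - adjoint_gram m l) =
    \sum_m (image_gram k m - adjoint_gram k m) * F i j m l.
  under eq_bigr do rewrite mulrBr.
  under [RHS]eq_bigr do rewrite mulrBl.
  by rewrite !sumrB qarr_comm parr_comm.
have dE' a b : image_gram a b - adjoint_gram a b = 4 * (d a *+ (a == b)).
  by rewrite -Fd array_ricci; ring.
move: E; under eq_bigr do rewrite dE'.
under [RHS]eq_bigr do rewrite dE'.
rewrite (bigD1 l) //= [in LHS]big1 ?addr0; last first.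
  by move=> m /negPf ->; rewrite !mulr0.
rewrite (bigD1 k) //= [in RHS]big1 ?addr0; last first.
  by move=> m; rewrite eq_sym => /negPf ->; rewrite mulr0 mul0r.
rewrite !eqxx !mulr1n => /eqP; rewrite -subr_eq0 => /eqP E.
by apply/eqP; rewrite -oppr_eq0; apply/eqP; rewrite -E; ring.
Qed.

Let s i j k := `|c i j k| ^+ 2.
Let t i m := c i m i.

(** F_ijji = 0, because pair symmetry turns it into a component with distinct
    weights in the last two places. *)
Lemma array_offdiag i j : d i != d j ->
  2 * \sum_m s i j m - 3 * \sum_m s j m i - 3 * \sum_m s i m j
  + \sum_m (t i m * (t j m)^* + t j m * (t i m)^*) = 0.
Proof.
move=> dij; have : 4 * F i j j i = 0.
  by rewrite array_pair [F j i i j]array_pair array_diag ?mulr0// eq_sym.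
have e1 : xarr i j j i = \sum_m s j m i.
  by apply: eq_bigr => m _; rewrite /s normCK mulrC.
have e2 : xarr j i i j = \sum_m s i m j.
  by apply: eq_bigr => m _; rewrite /s normCK mulrC.
have e3 : yarr i j j i = - \sum_m s i j m.
  rewrite -sumrN; apply: eq_bigr => m _; rewrite /s normCK.
  by rewrite [c j i m]cN rmorphN mulrN.
rewrite F4 e1 e2 e3 => E; rewrite -[RHS]E {E}.
rewrite big_split /=.
have -> : xarr j j i i = \sum_m t i m * (t j m)^*.
  by apply: eq_bigr => m _; rewrite mulrC.
have -> : xarr i i j j = \sum_m t j m * (t i m)^*.
  by apply: eq_bigr => m _; rewrite mulrC.
ring.
Qed.

(** A sum of squares |sum of x over one class|^2, one for each value of d. *)
Lemma class_sum_ge0 (x : 'I_n -> C) :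
  0 <= \sum_i \sum_(j | d i == d j) x i * (x j)^*.
Proof.
(* one representative index for each value of d *)
pose r i := odflt i [pick j | d j == d i].
have dr i : d (r i) = d i.
  by rewrite /r; case: pickP => [a /eqP //|/(_ i)]; rewrite eqxx.
have rE i j : (d i == d j) = (r i == r j).
  apply/eqP/eqP=> [dij|rij]; last by rewrite -dr rij dr.
  rewrite /r (@eq_pick _ [pred a | d a == d j] [pred a | d a == d i]); last first.
    by move=> a /=; rewrite dij.
  by case: pickP => [//|/(_ i)]; rewrite /= eqxx.
have -> : \sum_i \sum_(j | d i == d j) x i * (x j)^* =
    \sum_a `|\sum_(i | r i == a) x i| ^+ 2.
  under [RHS]eq_bigr do rewrite normCK rmorph_sum mulr_suml.
  rewrite [LHS](partition_big r xpredT) //=; apply: eq_bigr => a _.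
  apply: eq_bigr => i /eqP ia; rewrite mulr_sumr.
  by apply: eq_bigl => j; rewrite rE ia eq_sym.
by apply: sumr_ge0 => a _; rewrite exprn_ge0.
Qed.

Let w i j : C := (3 * (d i != 0) + 3 * (d j != 0))%:R - 2 * (d i != d j)%:R.

(** This is the sum of [array_offdiag] over all pairs of distinct weights.
    The trace terms restricted to distinct weights are, as all traces of c
    vanish, minus those restricted to equal weights, hence minus a square. In
    the two middle sums additivity of the weights replaces the condition of
    distinct weights by a condition that a single weight is nonzero. *)
Lemma weighted_sum_le0 : \sum_i \sum_j \sum_m s i j m * w i j <= 0.
Proof.
have sC i j m : s i j m = s j i m by rewrite /s cN normrN.
have s0 i j m : d m != d i + d j -> s i j m = 0.
  move=> dm; rewrite /s; have [->|/weight_add e] := eqVneq (c i j m) 0.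
    by rewrite normr0 expr0n.
  by rewrite e eqxx in dm.
pose b (x : bool) : C := x%:R.
have offdiag : \sum_i \sum_j b (d i != d j) *
  (2 * \sum_m s i j m - 3 * \sum_m s j m i - 3 * \sum_m s i m j
  + \sum_m (t i m * (t j m)^* + t j m * (t i m)^*)) = 0.
  rewrite big1 // => i _; rewrite big1 // => j _; rewrite /b.
  have [_|dij] := boolP (d i == d j); first by rewrite mul0r.
  by rewrite array_offdiag // mulr0.
pose V := \sum_m \sum_i \sum_(j | d i == d j) t i m * (t j m)^*.
have V0 : 0 <= V by apply: sumr_ge0 => m _; exact: class_sum_ge0.
have e1 : \sum_i \sum_j b (d i != d j) * \sum_m (t i m * (t j m)^*) = - V.
  have tot : \sum_i \sum_j \sum_m (t i m * (t j m)^*) = 0.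
    under eq_bigr do rewrite exchange_big; rewrite exchange_big big1 //= => m _.
    under eq_bigr do rewrite -mulr_sumr.
    by rewrite -mulr_suml ctr mul0r.
  apply/eqP; rewrite -subr_eq0 opprK; apply/eqP; rewrite -[RHS]tot /V.
  rewrite [X in _ + X]exchange_big -big_split; apply: eq_bigr => i _ /=.
  under [X in _ + X]eq_bigr do rewrite big_mkcond.
  rewrite [X in _ + X]exchange_big -big_split; apply: eq_bigr => j _ /=.
  rewrite /b; case: eqVneq => _ /=; first by rewrite mul0r add0r.
  by rewrite mul1r [X in _ + X]big1 ?addr0.
have e2 : \sum_i \sum_j b (d i != d j) * \sum_m (t j m * (t i m)^*) = - V.
  rewrite -e1 exchange_big; apply: eq_bigr => j _; apply: eq_bigr => i _.
  by rewrite eq_sym.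
have e3 : \sum_i \sum_j b (d i != d j) * \sum_m s j m i =
    \sum_i \sum_j \sum_m s i j m * b (d j != 0).
  rewrite exchange_big; apply: eq_bigr => j _ /=.
  under eq_bigr do rewrite mulr_sumr.
  rewrite exchange_big; apply: eq_bigr => m _ /=; apply: eq_bigr => i _.
  have [e|/s0 ->] := eqVneq (d i) (d j + d m); last by rewrite mulr0 mul0r.
  by rewrite mulrC e -subr_eq0 addrAC subrr add0r.
have e4 : \sum_i \sum_j b (d i != d j) * \sum_m s i m j =
    \sum_i \sum_j \sum_m s i j m * b (d j != 0).
  rewrite -e3 exchange_big; apply: eq_bigr => j _; apply: eq_bigr => i _.
  by rewrite eq_sym.
have e5 : \sum_i \sum_j \sum_m s i j m * b (d j != 0) =
    \sum_i \sum_j \sum_m s i j m * b (d i != 0).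
  rewrite exchange_big; apply: eq_bigr => j _; apply: eq_bigr => i _.
  by apply: eq_bigr => m _; rewrite sC.
suff -> : \sum_i \sum_j \sum_m s i j m * w i j = - (2 * V).
  by rewrite oppr_le0 mulr_ge0.
have -> : \sum_i \sum_j \sum_m s i j m * w i j =
  3 * (\sum_i \sum_j \sum_m s i j m * b (d i != 0))
  + 3 * (\sum_i \sum_j \sum_m s i j m * b (d j != 0))
  - 2 * \sum_i \sum_j b (d i != d j) * \sum_m s i j m.
  rewrite !mulr_sumr -big_split -sumrB; apply: eq_bigr => i _ /=.
  rewrite !mulr_sumr -big_split -sumrB; apply: eq_bigr => j _ /=.
  rewrite !mulr_sumr -big_split -sumrB; apply: eq_bigr => m _ /=.
  by rewrite /w /b natrD !natrM; ring.
move: offdiag; under eq_bigr do under eq_bigr do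
  rewrite big_split !mulrDr !mulrN ![b _ * (_ * _)]mulrCA.
under eq_bigr do rewrite !big_split -!mulr_sumr /= !sumrN -!mulr_sumr.
rewrite !big_split /= -!mulr_sumr !sumrN -!mulr_sumr e1 e2 e3 e4 e5.
set X := \sum_i \sum_j b (d i != d j) * _ => E.
apply/eqP; rewrite -subr_eq0; apply/eqP.
by apply: (etrans _ (etrans (congr1 -%R E) (oppr0 _))); ring.
Qed.

(** The coefficients w_ij are nonnegative, and positive unless d_i = d_j = 0,
    so c_ijk can only be nonzero when d_i = d_j = 0; then d_k = d_i + d_j = 0
    as well. If d_k <> 0, all terms of the formula for d_k = sum_i F_iikk
    vanish. *)
Lemma array_weight0 k : d k = 0.
Proof.
have s_ge0 i j m : 0 <= s i j m by rewrite exprn_ge0.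
have wE i j :
    w i j = (3 * (d i != 0)%R + 3 * (d j != 0)%R - 2 * (d i != d j))%N%:R.
  rewrite /w -[2 * _%:R]natrM natrB //.
  have [di|di] := eqVneq (d i) 0; have [dj|dj] := eqVneq (d j) 0;
    rewrite ?di ?dj ?eqxx //; by case: (_ != _).
have w_ge0 i j : 0 <= w i j by rewrite wE.
have z : \sum_i \sum_j \sum_m s i j m * w i j == 0.
  rewrite eq_le weighted_sum_le0 !sumr_ge0 // => i _.
  by rewrite sumr_ge0 // => j _; rewrite sumr_ge0 // => m _; rewrite mulr_ge0.
have sw i j m : s i j m * w i j = 0.
  have p i' j' m' : 0 <= s i' j' m' * w i' j' by rewrite mulr_ge0.
  move: z; rewrite psumr_eq0 => [/allP/(_ i (mem_index_enum _))|i' _]; last first.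
    by apply: sumr_ge0 => j' _; apply: sumr_ge0.
  rewrite psumr_eq0 => [/allP/(_ j (mem_index_enum _))|j' _]; last exact: sumr_ge0.
  by rewrite psumr_eq0 => [/allP/(_ m (mem_index_enum _))/eqP|//].
have c0 i j m : (d i != 0) || (d j != 0) -> c i j m = 0.
  move=> dij; have /eqP := sw i j m; rewrite mulf_eq0 sqrf_eq0 normr_eq0.
  case/orP => [/eqP //|]; rewrite wE pnatr_eq0; move: dij.
  by case: (d i == 0); case: (d j == 0) => //=; case: (d i == d j).
apply/eqP; apply: contraT => dk.
have : 4 * d k = 0; last by move/eqP; rewrite mulf_eq0 (negPf four_neq0) (negPf dk).
have -> : d k = \sum_i F i i k k by rewrite Fd eqxx.
rewrite array_ricci /image_gram /adjoint_gram.
rewrite [X in 2 * X]big1 => [|a _]; last first.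
  by rewrite big1 // => b _; rewrite c0 ?dk// mul0r.
rewrite [X in _ + X]big1 => [|a _]; last first.
  by rewrite big1 // => b _; rewrite c0 ?dk// mul0r.
rewrite big1 ?mulr0 ?subrr ?addr0// => a _; rewrite big1 // => b _.
have [->|cN0] := eqVneq (c a b k) 0; first by rewrite mul0r.
have := weight_add cN0; have [da|da] := eqVneq (d a) 0; last first.
  by rewrite c0 ?da ?eqxx// in cN0.
have [db|db] := eqVneq (d b) 0; last by rewrite c0 ?db ?orbT ?eqxx// in cN0.
by rewrite da db addr0 => /eqP; rewrite (negPf dk).
Qed.

End Diagonal.
End TorsionArray.

(** * Unitary frames *)

Section Pencil.
Variable C : numClosedFieldType.
Local Notation "M ^h" := (map_mx (@Num.conj C) M^T) (at level 8, format "M ^h").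

Lemma hmxM m n p (A : 'M[C]_(m, n)) (B : 'M[C]_(n, p)) :
  (A *m B)^h = B^h *m A^h.
Proof. by rewrite trmx_mul map_mxM. Qed.

Lemma hmxK m n (A : 'M[C]_(m, n)) : (A^h)^h = A.
Proof. by apply/matrixP => i j; rewrite !mxE conjCK. Qed.

Lemma hermitian_diag n (A : 'M[C]_n) : A^h = A ->
  exists (P : 'M[C]_n) (d : 'rV[C]_n), P *m P^h = 1%:M /\ P *m A *m P^h = diag_mx d.
Proof.
move=> Ah; have /orthomx_spectralP E : A \is normalmx.
  by apply/normalmxP; rewrite Ah.
have /unitarymxP PU := spectral_unitarymx A.
exists (spectralmx A), (spectral_diag A); split=> //.
rewrite [X in _ *m X *m _]E -invmx_unitary ?spectral_unitarymx//.
by rewrite !mulmxA mulmxV ?spectral_unit// mul1mx -mulmxA mulmxV ?spectral_unit// mulmx1.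
Qed.

(** Diagonalise H first, rescale to make it the identity, and diagonalise the
    transformed K by a unitary matrix, which does not destroy the identity. *)
Lemma hermitian_pencil n (H K : 'M[C]_n) : H^h = H -> K^h = K ->
  (forall v : 'rV[C]_n, v != 0 -> 0 < (v *m H *m v^h) 0 0) ->
  exists (B : 'M[C]_n) (d : 'rV[C]_n), B *m H *m B^h = 1%:M /\ B *m K *m B^h = diag_mx d.
Proof.
move=> Hh Kh Hpos; have [P [d [PU PH]]] := hermitian_diag Hh.
have d_gt0 i : 0 < d 0 i.
  have : 0 < (row i P *m H *m (row i P)^h) 0 0.
    apply: Hpos; apply: contra_eq_neq (congr1 (fun M : 'M[C]_n => M i i) PU) => ri0.
    rewrite mxE big1 ?mxE ?eqxx ?(eq_sym 0) ?oner_neq0// => j _.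
    by have := congr1 (fun v : 'rV[C]_n => v 0 j) ri0; rewrite !mxE => ->; rewrite mul0r.
  suff -> : (row i P *m H *m (row i P)^h) 0 0 = (P *m H *m P^h) i i.
    by rewrite PH mxE eqxx mulr1n.
  rewrite -row_mul [LHS]mxE [RHS]mxE; apply: eq_bigr => k _.
  by rewrite !mxE.
pose S := diag_mx (\row_i (sqrtC (d 0 i))^-1) : 'M[C]_n.
have Sh : S^h = S.
  rewrite /S tr_diag_mx map_diag_mx; congr diag_mx; apply/rowP => i; rewrite !mxE.
  by apply: geC0_conj; rewrite invr_ge0 sqrtC_ge0 ltW.
have S1 : S *m diag_mx d *m S = 1%:M.
  rewrite /S !mulmx_diag -diag_const_mx; congr diag_mx.
  apply/rowP => i; rewrite !mxE mulrAC -expr2 exprVn sqrtCK mulVf//.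
  by rewrite gt_eqF.
have [|Q [d' [QU QK]]] := @hermitian_diag _ (S *m P *m K *m (S *m P)^h).
  by rewrite !hmxM !hmxK Kh !mulmxA.
exists (Q *m (S *m P)), d'; split; last by move: QK; rewrite [(Q *m _)^h]hmxM !mulmxA.
rewrite hmxM [(S *m P)^h]hmxM Sh.
transitivity (Q *m (S *m (P *m H *m P^h) *m S) *m Q^h); first by rewrite !mulmxA.
by rewrite PH S1 mulmx1 QU.
Qed.
End Pencil.

Section LinSum.
Variables (F : nzRingType) (U V : lmodType F) (f : U -> V).
Hypothesis fl : linear f.
Lemma lin_sum (I : Type) (r : seq I) (P : pred I) (a : I -> F) (u : I -> U) :
  f (\sum_(i <- r | P i) a i *: u i) = \sum_(i <- r | P i) a i *: f (u i).
Proof.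
pose L := GRing.isLinear.Build F U V _ f fl.
pose g : {linear U -> V} := HB.pack f L.
by rewrite -[f]/(g : U -> V) linear_sum; apply: eq_bigr => i _; rewrite linearZ.
Qed.
End LinSum.

Section Frames.
Variables (C : numClosedFieldType) (W : vectType C).
Implicit Types (V : {vspace W}).

Definition hermitian_fun (h : W -> W -> C) : Prop :=
  (forall y, linear (fun x => h x y : C^o)) /\
  (forall x y, h y x = (h x y)^*).

Definition orthoframe (h : W -> W -> C) V n (e : 'I_n -> W) : Prop :=
  [/\ forall i, e i \in V, forall i j, h (e i) (e j) = (i == j)%:R &
      forall u, u \in V -> u = \sum_i h u (e i) *: e i].

Lemma herm_suml h : hermitian_fun h -> forall n (a : 'I_n -> C) (u : 'I_n -> W) y,
  h (\sum_i a i *: u i) y = \sum_i a i * h (u i) y.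
Proof. by move=> [hl _] n a u y; rewrite (lin_sum (hl y)). Qed.

Lemma herm_sumr h : hermitian_fun h -> forall n (a : 'I_n -> C) (u : 'I_n -> W) y,
  h y (\sum_i a i *: u i) = \sum_i (a i)^* * h y (u i).
Proof.
move=> hh n a u y; have [_ hC] := hh; rewrite hC herm_suml// rmorph_sum.
by apply: eq_bigr => i _; rewrite rmorphM /= -hC.
Qed.

Lemma orthoframe_diag h q V n : \dim V = n ->
  hermitian_fun h -> hermitian_fun q ->
  (forall u, u \in V -> u != 0 -> 0 < h u u) ->
  exists (e : 'I_n -> W) (d : 'I_n -> C), orthoframe h V e /\
    forall i j, q (e i) (e j) = d i *+ (i == j).
Proof.
move=> dimV hh hq hpos; subst n.
pose b := vbasis V; pose H := \matrix_(i, j) h b`_i b`_j : 'M[C]_(\dim V).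
pose K := \matrix_(i, j) q b`_i b`_j : 'M[C]_(\dim V).
have formE (k : W -> W -> C) (hk : hermitian_fun k) (M : 'M[C]_(\dim V)) i j :
    k (\sum_l M i l *: b`_l) (\sum_l M j l *: b`_l) =
    (M *m (\matrix_(i, j) k b`_i b`_j) *m map_mx Num.conj M^T) i j.
  rewrite herm_sumr// !mxE; apply: eq_bigr => l _; rewrite !mxE mulrC.
  by rewrite herm_suml//; congr (_ * _); apply: eq_bigr => m _; rewrite !mxE.
have [|||B [d [BH BK]]] := @hermitian_pencil _ _ H K.
- by apply/matrixP => i j; rewrite !mxE -hh.2.
- by apply/matrixP => i j; rewrite !mxE -hq.2.
- move=> v v0; pose u := \sum_l v 0 l *: b`_l.
  have -> : (v *m H *m map_mx Num.conj v^T) 0 0 = h u u.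
    rewrite herm_sumr// !mxE; apply: eq_bigr => l _; rewrite !mxE mulrC.
    by rewrite herm_suml//; congr (_ * _); apply: eq_bigr => m _; rewrite !mxE.
  apply: hpos.
    by apply: memv_suml => l _; rewrite memvZ// vbasis_mem// mem_nth// size_tuple.
  apply: contraNneq v0 => u0; apply/eqP/rowP => l; rewrite mxE.
  have /freeP := basis_free (vbasisP V); apply.
  by rewrite -[RHS]u0; apply: eq_bigr => m _.
pose e i := \sum_l B i l *: b`_l.
have eO i j : h (e i) (e j) = (i == j)%:R by rewrite formE// BH mxE.
have eV i : e i \in V.
  by apply: memv_suml => l _; rewrite memvZ// vbasis_mem// mem_nth// size_tuple.
exists e, (fun i => d 0 i); split; last by move=> i j; rewrite formE// BK mxE.
split=> // u uV.
have Bu : B \in unitmx by move: BH; rewrite -mulmxA => /mulmx1_unit[].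
have bE (l : 'I_(\dim V)) : b`_l = \sum_i invmx B l i *: e i.
  under eq_bigr do rewrite scaler_sumr; rewrite exchange_big /=.
  under eq_bigr => m _.
    under eq_bigr do rewrite scalerA; rewrite -scaler_suml.
    have -> : \sum_i invmx B l i * B i m = (l == m)%:R.
      by have := congr1 (fun M : 'M[C]_(\dim V) => M l m) (mulVmx Bu); rewrite !mxE.
    over.
  rewrite (bigD1 l) //= eqxx scale1r big1 ?addr0// => m; rewrite eq_sym.
  by move=> /negPf ->; rewrite scale0r.
have [a ->] : exists a : 'I_(\dim V) -> C, u = \sum_i a i *: e i.
  exists (fun i => \sum_l coord b l u * invmx B l i).
  rewrite {1}(coord_vbasis uV); under eq_bigr do rewrite bE scaler_sumr.
  rewrite exchange_big; apply: eq_bigr => i _ /=.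
  by rewrite scaler_suml; apply: eq_bigr => l _; rewrite scalerA.
apply: eq_bigr => i _; congr (_ *: _); rewrite herm_suml//.
rewrite (bigD1 i) //= eO eqxx mulr1 big1 ?addr0// => j /negPf ji.
by rewrite eO ji mulr0.
Qed.

Lemma orthoframe_parseval h V n (e : 'I_n -> W) : hermitian_fun h ->
  orthoframe h V e -> forall u v, u \in V -> h u v = \sum_i h u (e i) * h (e i) v.
Proof. by move=> hh [_ _ eE] u v /eE {1}->; rewrite herm_suml. Qed.

(** Diagonalise the sum of h (x, b) h (b, y) over a basis of I: frame vectors
    with nonzero eigenvalue lie in I, the others are orthogonal to I. *)
Lemma orthoframe_adapted h V I n : \dim V = n -> hermitian_fun h ->
  (forall u, u \in V -> u != 0 -> 0 < h u u) -> (I <= V)%VS ->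
  exists (e : 'I_n -> W) (S : pred 'I_n), [/\ orthoframe h V e,
    forall i, S i -> e i \in I &
    forall i, ~~ S i -> forall a, a \in I -> h (e i) a = 0].
Proof.
move=> dimV hh hpos IV; have [hl hC] := hh.
(* q only sees the component in I and is positive there *)
pose q x y := \sum_(k < \dim I) h x (vbasis I)`_k * h (vbasis I)`_k y.
have hq : hermitian_fun q.
  split=> [y a x x'|x y].
    rewrite /q scaler_sumr -big_split; apply: eq_bigr => k _ /=.
    by rewrite hl /= mulrDl; congr (_ + _); exact: esym (mulrA _ _ _).
  rewrite rmorph_sum; apply: eq_bigr => k _ /=.
  by rewrite rmorphM /= -!hC mulrC.
have [e [d [eF qd]]] := orthoframe_diag dimV hh hq hpos.
have [eV eO eE] := eF.
have bI k : (k < \dim I)%N -> (vbasis I)`_k \in I.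
  by move=> kI; rewrite vbasis_mem// mem_nth// size_tuple.
exists e, (fun i => d i != 0); split=> // i.
- move=> di.
  have : d i *: e i \in I; last by rewrite rpredZeq (negPf di).
  have -> : d i *: e i = \sum_(k < \dim I) h (e i) (vbasis I)`_k *: (vbasis I)`_k.
    set v := RHS; have vV : v \in V.
      by apply: memv_suml => k _; rewrite memvZ// (subvP IV)// bI.
    rewrite (eE _ vV) (bigD1 i) //= big1 ?addr0.
      by have := qd i i; rewrite eqxx mulr1n => <-; rewrite /v herm_suml.
    move=> j ji; rewrite /v herm_suml//.
    by have := qd i j; rewrite eq_sym (negPf ji) mulr0n /q => ->; rewrite scale0r.
  by apply: memv_suml => k _; rewrite memvZ// bI.
move=> /negPn/eqP di a aI.
have : q (e i) (e i) == 0 by rewrite qd di mul0rn.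
have q_ge0 (k : 'I_(\dim I)) : true ->
    0 <= h (e i) (vbasis I)`_k * h (vbasis I)`_k (e i).
  by move=> _; rewrite [h (vbasis I)`_k _]hC mul_conjC_ge0.
rewrite /q psumr_eq0// => /allP z.
rewrite (coord_vbasis aI) herm_sumr// big1// => k _.
have /eqP := z k (mem_index_enum _).
by rewrite [h (vbasis I)`_k _]hC => /eqP; rewrite mul_conjC_eq0 => /eqP ->; rewrite mulr0.
Qed.

End Frames.

(** * Vanishing of the Ricci form and splitting of ideals *)

Section TorsionAlgebra.
Variables (C : numClosedFieldType) (W : vectType C) (V : {vspace W}) (n : nat).
Variables (h : W -> W -> C) (br : W -> W -> W) (Rop : W -> W -> W -> W).
Hypothesis dimV : \dim V = n.
Hypothesis hh : hermitian_fun h.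
Hypothesis hpos : forall u, u \in V -> u != 0 -> 0 < h u u.
Hypothesis br_linl : forall y, linear (br^~ y).
Hypothesis br_linr : forall x, linear (br x).
Hypothesis brN : forall x y, br x y = - br y x.
Hypothesis brV : forall x y, x \in V -> y \in V -> br x y \in V.
Hypothesis RlinV : forall x y, linear (Rop x y).
Hypothesis Rlin1 : forall y z, linear (fun x => Rop x y z).
Hypothesis RV : forall x y z, x \in V -> y \in V -> z \in V -> Rop x y z \in V.
Hypothesis Rconj : forall x y z w, (h (Rop x y z) w)^* = h (Rop y x w) z.
Hypothesis Rder : forall x y z w, x \in V -> y \in V -> z \in V -> w \in V ->
  Rop x y (br z w) = br (Rop x y z) w + br z (Rop x y w).

Let carr (e : 'I_n -> W) i j k := h (br (e i) (e j)) (e k).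
Let Farr (e : 'I_n -> W) i j k l := h (Rop (e i) (e j) (e k)) (e l).

Hypothesis carr_tr : forall e, orthoframe h V e -> forall k, \sum_i carr e i k i = 0.
Hypothesis Farr4 : forall e, orthoframe h V e -> forall i j k l, 4 * Farr e i j k l =
  xarr (carr e) k j i l + xarr (carr e) i l k j - 3 * xarr (carr e) i j k l
  - 3 * xarr (carr e) k l i j - 2 * yarr (carr e) i k j l.

Let hlinl y : linear (fun x => h x y : C^o). Proof. exact: hh.1. Qed.
Let hC x y : h y x = (h x y)^*. Proof. exact: hh.2. Qed.

Let hDl x x' y : h (x + x') y = h x y + h x' y. Proof. exact: linfD (hlinl y) _ _. Qed.

Let hNl x y : h (- x) y = - h x y.
Proof. exact: linfN (hlinl y) _. Qed.

Let carrN e i j k : carr e i j k = - carr e j i k.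
Proof. by rewrite /carr brN hNl. Qed.

Let br_frame e i j : orthoframe h V e ->
  br (e i) (e j) = \sum_k carr e i j k *: e k.
Proof. by move=> [eV _ eE]; rewrite [LHS]eE ?brV. Qed.

Let Rop_frame e i j k : orthoframe h V e ->
  Rop (e i) (e j) (e k) = \sum_l Farr e i j k l *: e l.
Proof. by move=> [eV _ eE]; rewrite [LHS]eE ?RV. Qed.

Lemma Farr_der e : orthoframe h V e -> forall i j k l p,
  \sum_m carr e k l m * Farr e i j m p =
  \sum_m (Farr e i j k m * carr e m l p + Farr e i j l m * carr e k m p).
Proof.
move=> eF i j k l p; have [eV _ _] := eF.
transitivity (h (Rop (e i) (e j) (br (e k) (e l))) (e p)).
  by rewrite br_frame// (lin_sum (RlinV _ _)) herm_suml.
rewrite Rder// hDl big_split; congr (_ + _).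
  by rewrite Rop_frame// (lin_sum (br_linl _)) herm_suml.
by rewrite Rop_frame// (lin_sum (br_linr _)) herm_suml.
Qed.

(** The Ricci form of R, the trace over its first two arguments. *)
Let ricci (e : 'I_n -> W) z w := \sum_i h (Rop (e i) (e i) z) w.

Lemma ricci_herm e : hermitian_fun (ricci e).
Proof.
split=> [y a x x'|x y].
  rewrite /ricci scaler_sumr -big_split; apply: eq_bigr => i _ /=.
  by rewrite RlinV hlinl.
by rewrite /ricci rmorph_sum; apply: eq_bigr => i _ /=; rewrite Rconj.
Qed.

(** Traces do not depend on the unitary frame, so that the form can be
    diagonalised. *)
Lemma ricci_frame e f : orthoframe h V e -> orthoframe h V f ->
  forall z w, ricci e z w = ricci f z w.
Proof.
move=> eF fF z w; have [eV eO eE] := eF; have [fV fO fE] := fF.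
have Phi_r x (a : 'I_n -> C) (u : 'I_n -> W) : h (Rop x (\sum_b a b *: u b) z) w =
    \sum_b (a b)^* * h (Rop x (u b) z) w.
  rewrite -[LHS]conjCK Rconj (lin_sum (Rlin1 _ _)) herm_suml// rmorph_sum.
  by apply: eq_bigr => b _; rewrite rmorphM /= Rconj.
transitivity (\sum_i \sum_a \sum_b
    (h (f b) (e i) * h (e i) (f a)) * h (Rop (f a) (f b) z) w).
  apply: eq_bigr => i _; rewrite {1}(fE _ (eV i)) (lin_sum (Rlin1 _ _)).
  rewrite herm_suml//; apply: eq_bigr => a _.
  rewrite {2}(fE _ (eV i)) Phi_r mulr_sumr; apply: eq_bigr => b _.
  by rewrite -hC mulrA [h (f b) _ * _]mulrC.
rewrite exchange_big; apply: eq_bigr => a _ /=.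
rewrite exchange_big (bigD1 a) //= -mulr_suml -(orthoframe_parseval hh eF)//.
rewrite fO eqxx mul1r big1 ?addr0// => b /negPf ba.
by rewrite -mulr_suml -(orthoframe_parseval hh eF)// fO ba mul0r.
Qed.

Lemma ricci_flat e : orthoframe h V e ->
  forall z w, z \in V -> w \in V -> ricci e z w = 0.
Proof.
move=> eF z w zV wV.
have [f [d [fF fd]]] := orthoframe_diag dimV hh (ricci_herm e) hpos.
have [fV _ fE] := fF.
have Fd k l : \sum_i Farr f i i k l = d k *+ (k == l).
  by rewrite -fd (ricci_frame eF fF).
have d0 := array_weight0 (carrN f) (carr_tr fF) (Farr4 fF) (Farr_der fF) Fd.
rewrite (fE _ zV) (herm_suml (ricci_herm e)) big1// => i _.
rewrite (fE _ wV) (herm_sumr (ricci_herm e)) big1 ?mulr0// => j _.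
by rewrite fd d0 mul0rn mulr0.
Qed.

Lemma torsion_balance e : orthoframe h V e ->
  forall k, image_gram (carr e) k k = adjoint_gram (carr e) k k.
Proof.
move=> eF k; have [eV _ _] := eF.
have := array_ricci (carrN e) (carr_tr eF) (Farr4 eF) k k.
have -> : \sum_i Farr e i i k k = 0 by exact: ricci_flat.
rewrite mulr0 => E; apply/eqP; rewrite -subr_eq0; apply/eqP.
by rewrite [RHS]E; ring.
Qed.

Section Ideal.
Variable I : {vspace W}.
Hypothesis IV : (I <= V)%VS.
Hypothesis Iid : forall u a, u \in V -> a \in I -> br u a \in I.

(** In a frame adapted to I, put b_i = 1 if e_i is orthogonal to I and 0
    otherwise. As I is an ideal, c_ijk b_k = b_i b_j b_k c_ijk. Summing the
    diagonal entries of the equality of Gram matrices against b gives sum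
    (b_i - b_i b_j b_k) |c_ijk|^2 = 0 with nonnegative terms. *)
Lemma ideal_split u : u \in V -> (forall a, a \in I -> h u a = 0) ->
  (forall a, a \in I -> br u a = 0) /\
  (forall v, v \in V -> (forall a, a \in I -> h v a = 0) ->
   forall a, a \in I -> h (br u v) a = 0).
Proof.
have [e [S [eF SI SN]]] := orthoframe_adapted dimV hh hpos IV.
have [eV eO eE] := eF.
pose s i j k := `|carr e i j k| ^+ 2.
pose b i : C := (~~ S i)%:R.
have s_ge0 i j k : 0 <= s i j k by rewrite exprn_ge0.
have c0 i j k : ~~ S k -> S i || S j -> carr e i j k = 0.
  move=> Sk; wlog Sj : i j / S j.
    by move=> H /orP[Si|Sj]; [rewrite carrN H ?Si ?orbT ?oppr0|rewrite H ?Sj ?orbT].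
  by move=> _; rewrite /carr hC SN ?conjC0// Iid ?SI.
have bs i j k : b k * s i j k = b i * b j * b k * s i j k.
  rewrite /b; have [_|/= Sk] := boolP (S k); first by rewrite /= !(mulr0, mul0r).
  rewrite /s; have [ij|] := boolP (S i || S j).
    by rewrite c0// normr0 expr0n /= !mulr0.
  by rewrite negb_or => /andP[/= -> ->]; rewrite !mul1r.
have tot : \sum_i \sum_j \sum_k (b i - b i * b j * b k) * s i j k = 0.
  have bal : \sum_i \sum_j \sum_k b k * s i j k = \sum_i \sum_j \sum_k b i * s i j k.
    transitivity (\sum_k b k * image_gram (carr e) k k).
      under eq_bigr do rewrite exchange_big; rewrite exchange_big /=.
      apply: eq_bigr => k _; rewrite /image_gram !mulr_sumr; apply: eq_bigr => i _.
      by rewrite mulr_sumr; apply: eq_bigr => j _; rewrite /s normCK.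
    apply: eq_bigr => k _; rewrite torsion_balance// /adjoint_gram !mulr_sumr.
    apply: eq_bigr => i _; rewrite mulr_sumr; apply: eq_bigr => j _.
    by rewrite /s normCK.
  transitivity (\sum_i \sum_j \sum_k b i * s i j k - \sum_i \sum_j \sum_k b k * s i j k);
    last by rewrite bal subrr.
  rewrite -sumrB; apply: eq_bigr => i _.
  rewrite -sumrB; apply: eq_bigr => j _.
  by rewrite -sumrB; apply: eq_bigr => k _; rewrite bs mulrBl.
have cz i j k : ~~ S i -> S j || S k -> carr e i j k = 0.
  move=> Si Sjk.
  have p_ge0 i' j' k' : 0 <= (b i' - b i' * b j' * b k') * s i' j' k'.
    rewrite mulr_ge0// subr_ge0 /b; case: (S i'); rewrite ?mul0r//= mul1r.
    by case: (S j'); rewrite ?mul0r// mul1r; case: (S k').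
  move/eqP: tot; rewrite psumr_eq0 => [/allP/(_ i (mem_index_enum _))|i' _]; last first.
    by apply: sumr_ge0 => j' _; apply: sumr_ge0.
  rewrite psumr_eq0 => [/allP/(_ j (mem_index_enum _))|j' _]; last exact: sumr_ge0.
  rewrite psumr_eq0 => [/allP/(_ k (mem_index_enum _))|//].
  have -> : b i - b i * b j * b k = 1.
    by rewrite /b Si mul1r; case/orP: Sjk => ->; rewrite /= ?mulr0 ?mul0r subr0.
  by rewrite /= mul1r /s sqrf_eq0 normr_eq0 => /eqP.
have brz i j : ~~ S i -> S j -> br (e i) (e j) = 0.
  move=> Si Sj; rewrite br_frame// big1// => k _.
  by rewrite cz ?Sj// scale0r.
have exI a : a \in I -> forall i, ~~ S i -> h a (e i) = 0.
  by move=> aI i Si; rewrite hC SN// conjC0.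
move=> uV uI; split=> [a aI|v vV vI a aI].
  have aV := subvP IV _ aI.
  rewrite (eE _ uV) (lin_sum (br_linl _)) big1// => i _.
  have [Si|Si] := boolP (S i); first by rewrite uI ?SI// scale0r.
  rewrite (eE _ aV) (lin_sum (br_linr _)) big1 ?scaler0// => j _.
  have [Sj|Sj] := boolP (S j); first by rewrite brz// scaler0.
  by rewrite exI// scale0r.
have aV := subvP IV _ aI.
rewrite (eE _ uV) (lin_sum (br_linl _)) herm_suml// big1// => i _.
have [Si|Si] := boolP (S i); first by rewrite uI ?SI// mul0r.
rewrite (eE _ vV) (lin_sum (br_linr _)) herm_suml// big1 ?mulr0// => j _.
have [Sj|Sj] := boolP (S j); first by rewrite vI ?SI// mul0r.
rewrite (eE _ aV) herm_sumr// big1 ?mulr0// => k _.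
have [Sk|Sk] := boolP (S k); last by rewrite exI// conjC0 mul0r.
by rewrite -/(carr e i j k) cz ?Sk ?orbT// mulr0.
Qed.

End Ideal.
End TorsionAlgebra.

(** * Lie-theoretic consequences of the splitting *)

Section LieSplitting.

Variables (C : numClosedFieldType) (W : vectType C) (V : {vspace W}) (n : nat).
Variables (h : W -> W -> C) (br : W -> W -> W).
Implicit Types I A B : {vspace W}.
Hypothesis dimV : \dim V = n.
Hypothesis hh : hermitian_fun h.
Hypothesis hpos : forall u, u \in V -> u != 0 -> 0 < h u u.
Hypothesis br_linl : forall y, linear (br^~ y).
Hypothesis br_linr : forall x, linear (br x).
Hypothesis brN : forall x y, br x y = - br y x.
Hypothesis brV : forall x y, x \in V -> y \in V -> br x y \in V.
Variable orth : {vspace W} -> {vspace W}.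
Hypothesis orthP : forall I u, reflect
  (u \in V /\ forall a, a \in I -> h u a = 0) (u \in orth I).
Hypothesis split : forall I, (I <= V)%VS ->
  (forall u a, u \in V -> a \in I -> br u a \in I) ->
  forall u, u \in V -> (forall a, a \in I -> h u a = 0) ->
  (forall a, a \in I -> br u a = 0) /\
  (forall v, v \in V -> (forall a, a \in I -> h v a = 0) ->
   forall a, a \in I -> h (br u v) a = 0).

Let brDl x x' y : br (x + x') y = br x y + br x' y.
Proof. exact: linfD (br_linl y) _ _. Qed.

Let brDr x y y' : br x (y + y') = br x y + br x y'.
Proof. exact: linfD (br_linr x) _ _. Qed.

Let span_mem A B a b : a \in A -> b \in B -> br a b \in lie_span br A B.
Proof. exact: mem_lie_span. Qed.

Lemma orth_cap I : (I <= V)%VS -> (I :&: orth I)%VS = 0%VS.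
Proof.
move=> IV; apply/eqP; rewrite -subv0; apply/subvP => u /memv_capP[uI /orthP[uV uh]].
rewrite memv0; apply: contraT => u0.
by have := hpos uV u0; rewrite uh// ltxx.
Qed.

Lemma orth_add I : (I <= V)%VS -> (I + orth I)%VS = V.
Proof.
move=> IV; have [e [S [[eV eO eE] SI SN]]] := orthoframe_adapted dimV hh hpos IV.
apply: subv_anti; rewrite subv_add IV /=; apply/andP; split.
  by apply/subvP => u /orthP[].
apply/subvP => u uV; rewrite (eE _ uV) (bigID S) /= memv_add//.
  by apply: memv_suml => i Si; rewrite memvZ// SI.
apply: memv_suml => i Si; rewrite memvZ//; apply/orthP; split=> // a.
exact: SN.
Qed.

Lemma ideal_mem I : lie_ideal br V I -> forall u a, u \in V -> a \in I -> br u a \in I.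
Proof. by move=> [_ /subvP H] u a uV aI; apply: H; apply: span_mem. Qed.

Lemma orth_comm I : lie_ideal br V I ->
  forall a u, a \in I -> u \in orth I -> br u a = 0.
Proof.
move=> idI a u aI /orthP[uV uh].
by have [H _] := split idI.1 (ideal_mem idI) uV uh; apply: H.
Qed.

Lemma orth_sub I : lie_ideal br V I ->
  forall u v, u \in orth I -> v \in orth I -> br u v \in orth I.
Proof.
move=> idI u v /orthP[uV uh] /orthP[vV vh]; apply/orthP; split; first exact: brV.
by have [_ H] := split idI.1 (ideal_mem idI) uV uh; apply: H.
Qed.

Lemma orth_ideal I : lie_ideal br V I -> lie_ideal br V (orth I).
Proof.
move=> idI; split; first by apply/subvP => u /orthP[].
apply: lie_span_sub => v w; rewrite -{1}(orth_add idI.1).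
move=> /memv_addP[a aI [u uU ->]] wU; rewrite brDl brN (orth_comm idI aI wU).
by rewrite oppr0 add0r (orth_sub idI).
Qed.

Let r := lie_radical br V.

Lemma radical_spec : is_lie_radical br V r.
Proof. exact: lie_radicalP. Qed.

(** An ideal of the orthogonal complement U of the radical is an ideal of the
    whole algebra, because the radical commutes with U. A solvable one
    therefore lies in the radical. *)
Lemma orth_radical_semisimple : lie_semisimple br (orth r).
Proof.
have [rid rsol rmax] := radical_spec.
have [[JU JJ] Jsol _] : is_lie_radical br (orth r) (lie_radical br (orth r)).
  exact: lie_radicalP.
rewrite /lie_semisimple; set J := lie_radical br _ in JU JJ Jsol *.
have Jid : lie_ideal br V J.
  split; first by apply: subv_trans JU _; apply/subvP => u /orthP[].
  apply: lie_span_sub => v w; rewrite -{1}(orth_add rid.1).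
  move=> /memv_addP[a ar [u uU ->]] wJ.
  rewrite brDl brN (orth_comm rid ar (subvP JU _ wJ)) oppr0 add0r.
  by apply: (subvP JJ); apply: span_mem.
apply/eqP; rewrite -subv0 -(orth_cap rid.1) subv_cap JU andbT.
exact: rmax.
Qed.

(** Apply the splitting to I = [r, r]. Components outside I do not contribute
    to brackets of elements of r, so [I, I] = I; since r is solvable, I = 0. *)
Lemma radical_abelian : lie_abelian br r.
Proof.
have [rid [k rk] _] := radical_spec; pose I := lie_span br r r.
have Ir : (I <= r)%VS.
  apply: lie_span_sub => a b ar br'; apply: (ideal_mem rid) => //.
  exact: (subvP rid.1).
have Iid : lie_ideal br V I.
  split; first exact: subv_trans Ir rid.1.
  apply: lie_span_sub => v w; rewrite -{1}(orth_add rid.1).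
  move=> /memv_addP[a ar [u uU ->]] wI.
  rewrite brDl (orth_comm rid (subvP Ir _ wI) uU) addr0.
  by apply: span_mem => //; apply: (subvP Ir).
have dec b : b \in r -> exists i u, [/\ i \in I, u \in orth I & b = i + u].
  move=> bR; have : b \in (I + orth I)%VS by rewrite (orth_add Iid.1) (subvP rid.1).
  by move=> /memv_addP[i iI [u uU ->]]; exists i, u.
have II : lie_span br I I = I.
  apply: subv_anti; rewrite lie_spanS//=; apply: lie_span_sub => a b aR bR.
  have abI : br a b \in I by apply: span_mem.
  have [i [u [iI uU aE]]] := dec _ aR; have [j [v [jI vU bE]]] := dec _ bR.
  (* the bracket of the components orthogonal to I lies in I and is
     orthogonal to it *)
  have uvI : br u v \in I.
    have -> : u = a - i by rewrite aE addrC addKr.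
    have -> : v = b - j by rewrite bE addrC addKr.
    by apply: span_mem; rewrite memvB// (subvP Ir).
  have uv0 : br u v = 0.
    apply/eqP; rewrite -memv0 -(orth_cap Iid.1) memv_cap uvI.
    exact: (orth_sub Iid).
  rewrite aE bE brDl !brDr uv0 (orth_comm Iid jI uU) [br i v]brN.
  by rewrite (orth_comm Iid iI vU) oppr0 !addr0 span_mem.
have der m : iter m.+1 (fun A => lie_span br A A) r = I.
  by elim: m => //= m ->.
rewrite /lie_abelian -/I -(der k) /= rk; apply/eqP; rewrite -subv0.
apply: lie_span_sub => a b; rewrite memv0 => /eqP -> _.
by rewrite (linf0 (br_linl b)) mem0v.
Qed.

(** The line of a central element z is an ideal, and brackets only see the
    components orthogonal to it. *)
Lemma center_orth z w : lie_center br V z -> w \in lie_span br V V -> h z w = 0.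
Proof.
move=> [zV zc] wVV; pose I := <[z]>%VS.
have zy y : y \in V -> br y z = 0 by move=> yV; rewrite brN zc ?oppr0.
have IV : (I <= V)%VS by rewrite -memvE.
have Iid : lie_ideal br V I.
  split=> //; apply: lie_span_sub => v _ vV /vlineP[k ->].
  by rewrite (linfZ (br_linr v)) zy// scaler0 mem0v.
have : w \in orth I.
  apply: subvP wVV; apply: lie_span_sub => a b; rewrite -{1 2}(orth_add IV).
  move=> /memv_addP[i iI [u uU ->]] /memv_addP[j jI [v vU ->]].
  rewrite brDl !brDr (orth_comm Iid jI uU) [br i v]brN (orth_comm Iid iI vU).
  rewrite oppr0 addr0 add0r; have -> : br i j = 0.
    have jV := subvP IV _ jI; move/vlineP: iI => [k ->].
    by rewrite (linfZ (br_linl j)) zc// scaler0.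
  by rewrite add0r (orth_sub Iid).
by move=> /orthP[_ /(_ z (memv_line z))]; rewrite (hh.2 w z) => ->; rewrite conjC0.
Qed.

(** The derived series lies below the descending central series, so a
    nilpotent algebra is its own radical. *)
Lemma nilpotent_abelian : lie_nilpotent br V -> lie_abelian br V.
Proof.
move=> [k Vk]; have [rid _ rmax] := radical_spec.
have VV : (lie_span br V V <= V)%VS by apply: lie_span_sub => a b; exact: brV.
have sub m : (iter m (fun A => lie_span br A A) V <=
              iter m (fun A => lie_span br V A) V)%VS.
  elim: m => //= m IH; apply: lie_spanS => //.
  elim: m {IH} => //= m IH; apply: subv_trans VV; exact: lie_spanS.
have /rmax Vr : lie_ideal br V V by [].
have <- : r = V.
  apply: subv_anti; rewrite rid.1 /= Vr//.
  by exists k; apply/eqP; rewrite -subv0 -Vk.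
exact: radical_abelian.
Qed.

End LieSplitting.

(** * Symmetry of second derivatives *)

Section Schwarz.
Variables (R : realType) (V : normedModType R).
Implicit Types (f g : V -> R) (a x u v : V).

Lemma is_derive_line f a u (s d : R) : is_derive (a + s *: u) u f d ->
  is_derive s 1 (fun s => f (a + s *: u)) d.
Proof.
move=> [df <-].
have E : (fun h : R => h^-1 *: (((fun s => f (a + s *: u)) \o shift s) (h *: (1 : R))
    - f (a + s *: u))) =
  (fun h : R => h^-1 *: ((f \o shift (a + s *: u)) (h *: u) - f (a + s *: u))).
  apply/funext => h /=; congr (_ *: (f _ - _)).
  by rewrite [h *: _]mulr1 scalerDl addrCA.
by split; [rewrite /derivable E|rewrite /derive E].
Qed.

(** The mean value theorem, applied to s |-> f (x + tv + su) - f (x + su),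
    reduces the second difference to a difference of values of the derivative
    g, which is estimated by differentiability of g at the single point x. *)
Lemma second_difference f g (D : set V) x u v : open D -> D x ->
  (forall y, D y -> is_derive y u f (g y)) -> differentiable g x ->
  forall e : R, 0 < e -> \forall t \near 0^'+,
  `|f (x + t *: u + t *: v) - f (x + t *: u) - f (x + t *: v) + f x
    - t ^+ 2 * 'D_v g x| <= e * t ^+ 2.
Proof.
move=> oD Dx df dg e e0.
pose M := `|u| + `|v| + 1.
have M0 : 0 < M by rewrite ltr_wpDl ?addr_ge0 ?normr_ge0.
have e'0 : 0 < e / (2 * M) by rewrite divr_gt0// mulr_gt0.
have /eqaddoP /(_ _ e'0) /nbhs_ballP[r /= r0 gr] := diff_locally dg.
have /nbhs_ballP[r' /= r'0 Dr] : nbhs x D by exact: open_nbhs_nbhs.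
near=> t.
have t0 : 0 < t by near: t; exact: nbhs_right_gt.
have tr : t * M < Num.min r r'.
  rewrite -ltr_pdivlMr//; near: t; apply: nbhs_right_lt.
  by rewrite divr_gt0// lt_min r0.
have small (s1 s2 : R) : 0 <= s1 <= t -> 0 <= s2 <= t ->
    `|s1 *: u + s2 *: v| <= t * M.
  move=> /andP[s10 s1t] /andP[s20 s2t].
  rewrite (le_trans (ler_normD _ _))// !normrZ !ger0_norm// /M !mulrDr mulr1.
  apply: (@le_trans _ _ (t * `|u| + t * `|v|)); last by rewrite lerDl ltW.
  by apply: lerD; rewrite ler_wpM2r.
have inD s1 s2 : 0 <= s1 <= t -> 0 <= s2 <= t -> D (x + (s1 *: u + s2 *: v)).
  move=> h1 h2; apply: Dr; rewrite -ball_normE /ball_ /= opprD addrA subrr sub0r normrN.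
  by rewrite (le_lt_trans (small _ _ h1 h2))// (lt_le_trans tr)// ge_min lexx orbT.
have gE s1 s2 : 0 <= s1 <= t -> 0 <= s2 <= t ->
    `|g (x + (s1 *: u + s2 *: v)) - (g x + (s1 * 'd g x u + s2 * 'd g x v))|
    <= e / 2 * t.
  move=> h1 h2.
  have <- : 'd g x (s1 *: u + s2 *: v) = s1 * 'd g x u + s2 * 'd g x v.
    by rewrite linearD !linearZ.
  have := gr (s1 *: u + s2 *: v).
  rewrite -ball_normE /ball_ /= sub0r normrN => H.
  have {H} := H (le_lt_trans (small _ _ h1 h2) (lt_le_trans tr _)).
  rewrite ge_min lexx => /(_ isT).
  rewrite /= !fctE /= [_ + x]addrC => /le_trans; apply.
  have -> : e / 2 * t = e / (2 * M) * (t * M).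
    by field; rewrite gt_eqF.
  by rewrite ler_wpM2l ?small// ltW.
pose phi (s : R) := f (x + t *: v + s *: u) - f (x + s *: u).
have st s : s \in `[0, t] -> 0 <= s <= t by rewrite in_itv.
have tt : 0 <= t <= t by rewrite lexx ltW.
have z0 : 0 <= (0 : R) <= t by rewrite lexx ltW.
have phi' s : s \in `[0, t] ->
    is_derive s 1 phi (g (x + t *: v + s *: u) - g (x + s *: u)).
  move=> /st s0t; apply: is_deriveB; apply: is_derive_line; apply: df.
    by rewrite -addrA [t *: v + _]addrC; exact: inD.
  by have := inD s 0 s0t z0; rewrite scale0r addr0.
pose dphi (s : R) := g (x + t *: v + s *: u) - g (x + s *: u).
have dphiP (s : R) : s \in `]0, t[ -> is_derive s 1 phi (dphi s).
  by rewrite in_itv /= => /andP[s0 s1]; apply: phi'; rewrite in_itv /= !ltW.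
have cphi : {within `[0, t], continuous phi}.
  by apply: derivable_within_continuous => s /phi' H; exact: ex_derive.
have [s s0t E] := MVT_segment (ltW t0) dphiP cphi.
move: E; rewrite /dphi subr0 {dphiP} => E.
have := gE s t (st _ s0t) tt; have := gE s 0 (st _ s0t) z0.
rewrite scale0r mul0r !addr0 deriveE//.
move: E.
have -> : x + t *: v + s *: u = x + (s *: u + t *: v) by rewrite -addrA [t *: v + _]addrC.
set g1 := g (x + s *: u); set g2 := g (x + _); set du := 'd g x u; set dv := 'd g x v.
rewrite /phi !scale0r !addr0 => E r1 r2.
have -> : f (x + t *: u + t *: v) - f (x + t *: u) - f (x + t *: v) + f x
    - t ^+ 2 * dv = t * ((g2 - (g x + (s * du + t * dv))) - (g1 - (g x + s * du))).
  rewrite [x + t *: u + _]addrAC.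
  transitivity ((g2 - g1) * t - t ^+ 2 * dv); first by rewrite -E; ring.
  ring.
rewrite normrM [ `|t| ]gtr0_norm// expr2 mulrCA; apply: ler_wpM2l; first exact: ltW.
apply: le_trans (ler_normB _ _) _; apply: le_trans (lerD r2 r1) _.
by rewrite -mulrDl -splitr.
Unshelve. all: by end_near. Qed.

(** The second difference is symmetric in u and v and approximates both mixed
    derivatives. *)
Lemma derive_swap f gu gv (D : set V) x u v : open D -> D x ->
  (forall y, D y -> is_derive y u f (gu y)) -> differentiable gu x ->
  (forall y, D y -> is_derive y v f (gv y)) -> differentiable gv x ->
  'D_v gu x = 'D_u gv x.
Proof.
move=> oD Dx fu du fv dv; apply/eqP; rewrite -subr_eq0 -normr_le0.
apply/ler_addgt0Pl => e e0; rewrite addr0.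
have e20 : 0 < e / 2 by rewrite divr_gt0.
have Hu := second_difference v oD Dx fu du e20.
have Hv := second_difference u oD Dx fv dv e20.
have H0 := @nbhs_right_gt R 0.
have [t [[Hut Hvt] t0]] := filter_ex (filterI (filterI Hu Hv) H0).
have t20 : 0 < t ^+ 2 by rewrite exprn_gt0.
rewrite -(ler_pM2l t20) -[X in X * `|_|]gtr0_norm// -normrM.
have -> : t ^+ 2 * e = e / 2 * t ^+ 2 + e / 2 * t ^+ 2 by field.
apply: le_trans (lerD Hvt Hut); apply: le_trans (ler_normB _ _).
rewrite [x + t *: v + _]addrAC le_eqVlt; apply/orP; left; apply/eqP; congr `|_|.
ring.
Qed.

End Schwarz.

Section DeriveRules.
Variables (R : realType) (V : normedModType R).
Implicit Types (x v : V).

Lemma is_derive_mulf (f g : V -> R) x v a b : is_derive x v f a -> is_derive x v g b ->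
  is_derive x v (fun y => f y * g y) (a * g x + f x * b).
Proof.
move=> fa gb; have := is_deriveM fa gb.
by rewrite addrC [g x *: a]mulrC.
Qed.

Lemma is_derive_sumf (W : normedModType R) m (h : 'I_m -> V -> W) x v (dh : 'I_m -> W) :
  (forall i, is_derive x v (h i) (dh i)) ->
  is_derive x v (fun y => \sum_i h i y) (\sum_i dh i).
Proof. by move=> H; have := is_derive_sum H; rewrite fct_sumE. Qed.

Lemma is_derive_coord m p (f : V -> 'M[R]_(m, p)) x v (d : 'M[R]_(m, p)) i j : is_derive x v f d ->
  is_derive x v (fun y => f y i j : R) (d i j).
Proof.
move=> [df <-]; have dc := (derivable_mxP f x v).1 df.
by split; [exact: dc | rewrite derive_mx// mxE].
Qed.

Lemma is_derive_mx m p (f : V -> 'M[R]_(m, p)) x v (d : 'M[R]_(m, p)) :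
  (forall i j, is_derive x v (fun y => f y i j : R) (d i j)) -> is_derive x v f d.
Proof.
move=> H; have df : derivable f x v by apply/derivable_mxP => i j; exact: ex_derive.
split=> //; rewrite derive_mx//; apply/matrixP => i j; rewrite mxE.
exact: derive_val.
Qed.

Lemma is_derive_scalef m p (f : V -> R) (g : V -> 'M[R]_(m, p)) x v a (b : 'M[R]_(m, p)) :
  is_derive x v f a -> is_derive x v g b ->
  is_derive x v (fun y => f y *: g y) (a *: g x + f x *: b).
Proof.
move=> fa gb; apply: is_derive_mx => i j; rewrite !mxE.
under eq_fun do rewrite mxE.
exact: is_derive_mulf fa (is_derive_coord i j gb).
Qed.

Lemma is_derive_open (W : normedModType R) (f g : V -> W) (D : set V) x v d :
  open D -> D x -> (forall y, D y -> f y = g y) ->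
  is_derive x v f d -> is_derive x v g d.
Proof.
move=> oD Dx fg; apply: near_eq_is_derive.
by near=> y; apply: fg; near: y; exact: open_nbhs_nbhs.
Unshelve. all: by end_near. Qed.

(** A matrix-valued function is treated entry by entry. *)
Lemma derive_swap_mx m p (f : V -> 'M[R]_(m, p)) (D : set V) x u v : open D -> D x ->
  (forall y, D y -> differentiable f y) ->
  (forall w y, D y -> differentiable ('D_w f) y) ->
  'D_v ('D_u f) x = 'D_u ('D_v f) x.
Proof.
move=> oD Dx df d2f.
have fD w i j y : D y -> is_derive y w (fun z => f z i j : R) ('D_w f y i j).
  by move=> Dy; apply/is_derive_coord/derivableP/diff_derivable/df.
have dD w i j : differentiable (fun z => 'D_w f z i j : R) x.
  apply: (@differentiable_comp _ _ _ _ ('D_w f) (fun N : 'M[R]_(m, p) => N i j : R)).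
    exact: d2f.
  exact: differentiable_coord.
have D2 w w' i j : 'D_w ('D_w' f) x i j = 'D_w (fun z => 'D_w' f z i j : R) x.
  have dw : derivable ('D_w' f) x w by exact/diff_derivable/d2f.
  by rewrite (@derive_val _ _ _ _ _ _ _ (is_derive_coord i j (derivableP dw))).
apply/matrixP => i j.
apply: (etrans (D2 v u i j)); apply: (etrans _ (esym (D2 u v i j))).
exact: (derive_swap oD Dx (fD u i j) (dD u i j) (fD v i j) (dD v i j)).
Qed.

End DeriveRules.

(** * Curvature of a connection with parallel torsion *)

Lemma addr3_sub (V : zmodType) (a b p q r s : V) :
  (a + p + r) - (b + s + q) = (a - b) + (p - q) + (r - s).
Proof. by rewrite [a - b + _]addrACA -opprD addrACA -opprD [b + s + q]addrAC. Qed.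

(** Pointwise algebra: c u v stands for nabla_u v of constant fields and c1 a
    u v for the derivative of c u v in direction a. In the lemmas H a b
    stands for a second derivative in directions a and b, so that the
    assumption H u v = H v u is the symmetry of second derivatives. *)
Section CurvatureAlgebra.
Variables (R : realType) (m : nat).
Local Notation E := 'rV[R]_m.
Variables (c : E -> E -> E) (c1 : E -> E -> E -> E) (g : E -> E -> R).
Hypothesis cDl : forall u v w, c (u + v) w = c u w + c v w.
Hypothesis cDr : forall u v w, c u (v + w) = c u v + c u w.
Hypothesis cNl : forall u v, c (- u) v = - c u v.
Hypothesis cNr : forall u v, c u (- v) = - c u v.
Hypothesis gDl : forall u v w, g (u + v) w = g u w + g v w.
Hypothesis gDr : forall u v w, g u (v + w) = g u v + g u w.
Hypothesis gNl : forall u v, g (- u) v = - g u v.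
Hypothesis gNr : forall u v, g u (- v) = - g u v.

Definition curv_alg u v w := c1 u v w - c1 v u w + c u (c v w) - c v (c u w).
Definition tor_alg u v := c u v - c v u.

Let at_ij (u v : E) : u = v -> forall k, u 0 k = v 0 k. Proof. by move->. Qed.

(** Differentiate b.g (w, z) = g (nabla_b w, z) + g (w, nabla_b z) in
    direction a and antisymmetrise. *)
Lemma skew_alg u v w z (H : E -> E -> R) : H u v = H v u ->
  (forall a b, H a b =
    g (c a (c b w)) z + g (c b w) (c a z) + g (c1 a b w) z
    + (g (c a w) (c b z) + g w (c a (c b z)) + g w (c1 a b z))) ->
  g (curv_alg u v w) z + g w (curv_alg u v z) = 0.
Proof.
move=> e Hab; move: e; rewrite !Hab /curv_alg !(gDl, gDr, gNl, gNr); lra.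
Qed.

(** The hypothesis is nabla T = 0 for constant fields. *)
Lemma bianchi_alg u v w :
  (forall a b q, c1 a b q - c1 a q b =
     tor_alg (c a b) q + tor_alg b (c a q) - c a (tor_alg b q)) ->
  curv_alg u v w + curv_alg v w u + curv_alg w u v =
  tor_alg (tor_alg u v) w + tor_alg (tor_alg v w) u + tor_alg (tor_alg w u) v.
Proof.
move=> P; have /at_ij H1 := P u v w; have /at_ij H2 := P v w u; have /at_ij H3 := P w u v.
apply/rowP => k; have := H1 k; have := H2 k; have := H3 k.
rewrite /curv_alg /tor_alg !(cDl, cDr, cNl, cNr) !mxE; lra.
Qed.

(** Ricci identity: the second covariant derivatives of T vanish, and their
    antisymmetric part is the action of the curvature on T. *)
Lemma curv_tor_alg u v w z (H : E -> E -> E) : H u v = H v u ->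
  (forall a b q, c1 a b q - c1 a q b =
     tor_alg (c a b) q + tor_alg b (c a q) - c a (tor_alg b q)) ->
  (forall a b, H a b = c1 a (c b w) z - c1 a z (c b w) + tor_alg (c1 a b w) z
     + (c1 a w (c b z) - c1 a (c b z) w) + tor_alg w (c1 a b z)
     - c1 a b (tor_alg w z) - c b (c1 a w z - c1 a z w)) ->
  curv_alg u v (tor_alg w z) =
  tor_alg (curv_alg u v w) z + tor_alg w (curv_alg u v z).
Proof.
move=> e P Hab; move: e; rewrite !Hab !P => /at_ij e.
apply/rowP => k; have := e k.
rewrite /curv_alg /tor_alg !(cDl, cDr, cNl, cNr) !mxE; lra.
Qed.

End CurvatureAlgebra.

Section Bilinear.
Variables (R : realType) (n : nat).
Local Notation E := 'rV[R]_(n + n).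
Local Notation symbols := ('I_(n + n) -> 'I_(n + n) -> E).
Implicit Types (c d : symbols) (u v w : E).

(** The covariant derivative of the constant field v in direction u. *)
Definition gam c u v : E := \sum_i \sum_j (u 0 i * v 0 j) *: c i j.
Definition tor c u v : E := gam c u v - gam c v u.

Lemma gam_linl c v : linear (gam c ^~ v).
Proof.
move=> a u u'; rewrite /gam scaler_sumr -big_split; apply: eq_bigr => i _ /=.
rewrite scaler_sumr -big_split; apply: eq_bigr => j _ /=.
by rewrite !mxE scalerA -scalerDl; congr (_ *: _); ring.
Qed.

Lemma gam_linr c u : linear (gam c u).
Proof.
move=> a v v'; rewrite /gam scaler_sumr -big_split; apply: eq_bigr => i _ /=.
rewrite scaler_sumr -big_split; apply: eq_bigr => j _ /=.
by rewrite !mxE scalerA -scalerDl; congr (_ *: _); ring.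
Qed.

Lemma gamDl c u u' v : gam c (u + u') v = gam c u v + gam c u' v.
Proof. exact: linfD (gam_linl c v) _ _. Qed.
Lemma gamDr c u v v' : gam c u (v + v') = gam c u v + gam c u v'.
Proof. exact: linfD (gam_linr c u) _ _. Qed.
Lemma gam0l c v : gam c 0 v = 0.
Proof. exact: linf0 (gam_linl c v). Qed.
Lemma gam0r c u : gam c u 0 = 0.
Proof. exact: linf0 (gam_linr c u). Qed.
Lemma gamNl c u v : gam c (- u) v = - gam c u v.
Proof. exact: linfN (gam_linl c v) _. Qed.
Lemma gamNr c u v : gam c u (- v) = - gam c u v.
Proof. exact: linfN (gam_linr c u) _. Qed.

Lemma tor0l c u : tor c 0 u = 0. Proof. by rewrite /tor gam0l gam0r subrr. Qed.
Lemma tor0r c u : tor c u 0 = 0. Proof. by rewrite /tor gam0l gam0r subrr. Qed.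

Lemma is_derive_gam (V : normedModType R) (c : V -> symbols) (X Y : V -> E)
    (x v : V) (dc : symbols) (dX dY : E) :
  (forall i j, is_derive x v (fun y => c y i j) (dc i j)) ->
  is_derive x v X dX -> is_derive x v Y dY ->
  is_derive x v (fun y => gam (c y) (X y) (Y y))
    (gam dc (X x) (Y x) + gam (c x) dX (Y x) + gam (c x) (X x) dY).
Proof.
move=> Hc HX HY.
have -> : gam dc (X x) (Y x) + gam (c x) dX (Y x) + gam (c x) (X x) dY =
    \sum_i \sum_j ((dX 0 i * Y x 0 j + X x 0 i * dY 0 j) *: c x i j +
                   (X x 0 i * Y x 0 j) *: dc i j).
  rewrite /gam -!big_split; apply: eq_bigr => i _ /=.
  rewrite -!big_split; apply: eq_bigr => j _ /=.
  by rewrite scalerDl -[LHS]addrA [LHS]addrC.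
apply: is_derive_sumf => i; apply: is_derive_sumf => j.
apply: is_derive_scalef (Hc i j).
by apply: is_derive_mulf; apply: is_derive_coord.
Qed.

Lemma is_derive_metric (V : normedModType R) (G : V -> 'M[R]_(n + n)) (X Y : V -> E)
    (x v : V) (dG : 'M[R]_(n + n)) (dX dY : E) :
  is_derive x v G dG -> is_derive x v X dX -> is_derive x v Y dY ->
  is_derive x v (fun y => (X y *m G y *m (Y y)^T) 0 0 : R)
    ((X x *m dG *m (Y x)^T) 0 0 + (dX *m G x *m (Y x)^T) 0 0
     + (X x *m G x *m dY^T) 0 0).
Proof.
move=> HG HX HY.
have E3 (a b : E) (M : 'M[R]_(n + n)) :
    (a *m M *m b^T) 0 0 = \sum_j \sum_i a 0 i * M i j * b 0 j.
  by rewrite mxE; apply: eq_bigr => j _; rewrite !mxE mulr_suml.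
under eq_fun do rewrite E3.
have -> : (X x *m dG *m (Y x)^T) 0 0 + (dX *m G x *m (Y x)^T) 0 0
     + (X x *m G x *m dY^T) 0 0 =
    \sum_j \sum_i ((dX 0 i * G x i j + X x 0 i * dG i j) * Y x 0 j
       + X x 0 i * G x i j * dY 0 j).
  rewrite !E3 -!big_split; apply: eq_bigr => j _ /=.
  by rewrite -!big_split; apply: eq_bigr => i _ /=; ring.
apply: is_derive_sumf => j; apply: is_derive_sumf => i.
apply: is_derive_mulf (is_derive_coord _ _ HY).
by apply: is_derive_mulf; apply: is_derive_coord.
Qed.

Lemma is_derive_metricl (V : normedModType R) (G : V -> 'M[R]_(n + n)) (X : V -> E)
    (x v : V) (dG : 'M[R]_(n + n)) (dX w : E) :
  is_derive x v G dG -> is_derive x v X dX ->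
  is_derive x v (fun y => (X y *m G y *m w^T) 0 0 : R)
    ((X x *m dG *m w^T) 0 0 + (dX *m G x *m w^T) 0 0).
Proof.
move=> HG HX; have := is_derive_metric HG HX (is_derive_cst w x v).
by rewrite trmx0 mulmx0 [X in _ + X]mxE addr0.
Qed.

Lemma is_derive_metricr (V : normedModType R) (G : V -> 'M[R]_(n + n)) (Y : V -> E)
    (x v : V) (dG : 'M[R]_(n + n)) (dY w : E) :
  is_derive x v G dG -> is_derive x v Y dY ->
  is_derive x v (fun y => (w *m G y *m (Y y)^T) 0 0 : R)
    ((w *m dG *m (Y x)^T) 0 0 + (w *m G x *m dY^T) 0 0).
Proof.
move=> HG HY; have := is_derive_metric HG (is_derive_cst w x v) HY.
by rewrite !mul0mx [X in _ + X + _]mxE addr0.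
Qed.

Lemma is_derive_metricc (V : normedModType R) (G : V -> 'M[R]_(n + n))
    (x v : V) (dG : 'M[R]_(n + n)) (u w : E) : is_derive x v G dG ->
  is_derive x v (fun y => (u *m G y *m w^T) 0 0 : R) ((u *m dG *m w^T) 0 0).
Proof.
move=> HG; have := is_derive_metricl w HG (is_derive_cst u x v).
by rewrite !mul0mx [X in _ + X]mxE addr0.
Qed.

End Bilinear.

Section Chart.
Variables (R : realType) (n : nat).
Local Notation E := 'rV[R]_(n + n).
Variables (D : set E) (G : E -> 'M[R]_(n + n)) (Gam : christoffel R n).
Hypothesis oD : open D.
Hypothesis smG : smooth_on D G.
Hypothesis smGam : forall a b, smooth_on D (fun x => Gam x a b).
Implicit Types (x y u v w : E).

Lemma smooth_cst (W : normedModType R) (w : W) : smooth_on D (cst w : E -> W).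
Proof.
suff H s : exists w' : W, foldr (fun v (h : E -> W) => 'D_v h) (cst w : E -> W) s = cst w'.
  by move=> s x _; have [w' ->] := H s; exact: differentiable_cst.
elim: s => [|v s [w' IH]] /=; first by exists w.
by exists 0; rewrite IH; apply/funext => x; rewrite derive_cst.
Qed.

Definition dgam u y : 'I_(n + n) -> 'I_(n + n) -> E := fun i j => 'D_u (fun z => Gam z i j) y.

Lemma is_derive_symb y u i j : D y -> is_derive y u (fun z => Gam z i j) (dgam u y i j).
Proof. by move=> Dy; apply/derivableP/diff_derivable/(smGam i j [::]). Qed.

Lemma is_derive_dsymb y u v i j : D y ->
  is_derive y u (fun z => dgam v z i j) ('D_u (fun z => dgam v z i j) y).
Proof. by move=> Dy; apply/derivableP/diff_derivable/(smGam i j [:: v]). Qed.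

Lemma dsymb_swap x u v i j : D x ->
  'D_u (fun z => dgam v z i j) x = 'D_v (fun z => dgam u z i j) x.
Proof.
move=> Dx; apply: (@derive_swap_mx R E 1 _ (fun z => Gam z i j) D x v u oD Dx).
  by move=> y Dy; apply: (smGam i j [::]).
by move=> w y Dy; apply: (smGam i j [:: w]).
Qed.

Lemma cov_cst x u v : cov Gam (cst u) (cst v) x = gam (Gam x) u v.
Proof. by rewrite /cov derive_cst add0r. Qed.

Lemma torsionE x (X Y : E -> E) : torsion Gam X Y x = tor (Gam x) (X x) (Y x).
Proof.
rewrite /torsion /lie_bracket /cov /tor /gam.
move: ('D_(X x) Y x) ('D_(Y x) X x) => a b; move: (\sum_i _) (\sum_i _) => c d.
by apply/rowP => k; rewrite !mxE; ring.
Qed.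

Lemma torsion_atE x u v : torsion_at Gam x u v = tor (Gam x) u v.
Proof. exact: torsionE. Qed.

(** The curvature on constant fields, whose brackets vanish. *)
Definition curv x u v w := gam (dgam u x) v w - gam (dgam v x) u w
  + gam (Gam x) u (gam (Gam x) v w) - gam (Gam x) v (gam (Gam x) u w).

Lemma is_derive_gamc x u v w : D x ->
  is_derive x u (fun y => gam (Gam y) v w) (gam (dgam u x) v w).
Proof.
move=> Dx.
have := is_derive_gam (fun i j => is_derive_symb u i j Dx)
  (is_derive_cst v x u) (is_derive_cst w x u).
by rewrite gam0l gam0r !addr0.
Qed.

Lemma curvature_atE x u v w : D x -> curvature_at Gam x u v w = curv x u v w.
Proof.
move=> Dx; rewrite /curvature_at /curvature.
have covE a b : cov Gam (cst a) (cov Gam (cst b) (cst w)) x =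
    gam (dgam a x) b w + gam (Gam x) a (gam (Gam x) b w).
  rewrite {1}/cov cov_cst; congr (_ + _).
  have -> : cov Gam (cst b) (cst w) = (fun y => gam (Gam y) b w).
    by apply/funext => y; rewrite cov_cst.
  by rewrite (@derive_val _ _ _ _ _ _ _ (is_derive_gamc a b w Dx)).
have -> : cov Gam (lie_bracket (cst u) (cst v)) (cst w) x = 0.
  have lb y : lie_bracket (cst u) (cst v) y = 0 by rewrite /lie_bracket !derive_cst subrr.
  by rewrite /cov !lb derive0 add0r; exact: gam0l.
rewrite !covE subr0 /curv opprD addrACA.
by rewrite addrA.
Qed.

Section Parallel.
Hypothesis Gpar : metric_parallel D G Gam.

Definition dG u y := 'D_u G y.

Lemma is_derive_G y u : D y -> is_derive y u G (dG u y).
Proof. by move=> Dy; apply/derivableP/diff_derivable/(smG [::]). Qed.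

Lemma is_derive_dG y u v : D y -> is_derive y u (dG v) ('D_u (dG v) y).
Proof. by move=> Dy; apply/derivableP/diff_derivable/(smG [:: v]). Qed.

Lemma dG_swap x u v : D x -> 'D_u (dG v) x = 'D_v (dG u) x.
Proof.
move=> Dx; apply: (@derive_swap_mx R E _ _ G D x v u oD Dx).
  by move=> y Dy; apply: (smG [::]).
by move=> w y Dy; apply: (smG [:: w]).
Qed.

Lemma metric_par x u v w : D x -> (v *m dG u x *m w^T) 0 0 =
  metric_val G x (gam (Gam x) u v) w + metric_val G x v (gam (Gam x) u w).
Proof.
move=> Dx; rewrite -!cov_cst.
rewrite -(Gpar (smooth_cst u) (smooth_cst v) (smooth_cst w) Dx).
by rewrite (@derive_val _ _ _ _ _ _ _ (is_derive_metricc v w (is_derive_G u Dx))).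
Qed.

Lemma curv_skew x u v w z : D x ->
  metric_val G x (curv x u v w) z + metric_val G x w (curv x u v z) = 0.
Proof.
move=> Dx.
pose g a b := metric_val G x a b; pose c := gam (Gam x).
have H (a b p q : E) : (p *m 'D_a (dG b) x *m q^T) 0 0 =
  g (c a (c b p)) q + g (c b p) (c a q) + g (gam (dgam a x) b p) q
  + (g (c a p) (c b q) + g p (c a (c b q)) + g p (gam (dgam a x) b q)).
  have L := is_derive_metricc p q (is_derive_dG a b Dx).
  have M1 := is_derive_metricl q (is_derive_G a Dx) (is_derive_gamc a b p Dx).
  have M2 := is_derive_metricr p (is_derive_G a Dx) (is_derive_gamc a b q Dx).
  have M := is_derive_open oD Dx _ (is_deriveD M1 M2).
  have {}M := M _ (fun y Dy => esym (metric_par b p q Dy)).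
  rewrite -(@derive_val _ _ _ _ _ _ _ L) (@derive_val _ _ _ _ _ _ _ M).
  congr (_ + _ + (_ + _)); exact: metric_par.
have gD (a b q : E) : g (a + b) q = g a q + g b q.
  by rewrite /g /metric_val !mulmxDl mxE.
have gN (a q : E) : g (- a) q = - g a q.
  by rewrite /g /metric_val !mulNmx mxE.
have gD' (q a b : E) : g q (a + b) = g q a + g q b.
  by rewrite /g /metric_val linearD mulmxDr mxE.
have gN' (q a : E) : g q (- a) = - g q a.
  by rewrite /g /metric_val linearN mulmxN mxE.
have K := @skew_alg R _ c (fun a b => gam (dgam a x) b) g gD gD' gN gN' u v w z
  (fun a b => (w *m 'D_a (dG b) x *m z^T) 0 0).
apply: K; first by rewrite dG_swap.
by move=> a b; exact: H.
Qed.

End Parallel.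

Section TorsionParallel.
Hypothesis Tpar : torsion_parallel_on D Gam.

Lemma is_derive_tor x u v w : D x ->
  is_derive x u (fun y => tor (Gam y) v w) (tor (dgam u x) v w).
Proof. by move=> Dx; apply: is_deriveB; exact: is_derive_gamc. Qed.

Lemma tor_par x u v w : D x ->
  tor (dgam u x) v w = tor (Gam x) (gam (Gam x) u v) w
    + tor (Gam x) v (gam (Gam x) u w) - gam (Gam x) u (tor (Gam x) v w).
Proof.
move=> Dx; have := Tpar (smooth_cst u) (smooth_cst v) (smooth_cst w) Dx.
rewrite !torsionE !cov_cst => <-.
have -> : torsion Gam (cst v) (cst w) = (fun y => tor (Gam y) v w).
  by apply/funext => y; rewrite torsionE.
rewrite /cov (@derive_val _ _ _ _ _ _ _ (is_derive_tor u v w Dx)).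
by rewrite addrK.
Qed.

Let tor_par_alg x (a b q : E) : D x ->
  gam (dgam a x) b q - gam (dgam a x) q b =
    tor_alg (gam (Gam x)) (gam (Gam x) a b) q
    + tor_alg (gam (Gam x)) b (gam (Gam x) a q)
    - gam (Gam x) a (tor_alg (gam (Gam x)) b q).
Proof. exact: tor_par. Qed.

Lemma curv_bianchi x u v w : D x ->
  curv x u v w + curv x v w u + curv x w u v =
  tor (Gam x) (tor (Gam x) u v) w + tor (Gam x) (tor (Gam x) v w) u
  + tor (Gam x) (tor (Gam x) w u) v.
Proof.
move=> Dx.
exact: (@bianchi_alg R _ (gam (Gam x)) (fun a b => gam (dgam a x) b)
  (gamDl _) (gamDr _) (gamNl _) (gamNr _) u v w (fun a b q => tor_par_alg a b q Dx)).
Qed.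

Lemma curv_tor x u v w z : D x ->
  curv x u v (tor (Gam x) w z) =
  tor (Gam x) (curv x u v w) z + tor (Gam x) w (curv x u v z).
Proof.
move=> Dx.
pose d2 a b : 'I_(n + n) -> 'I_(n + n) -> E := fun i j => 'D_a (fun y => dgam b y i j) x.
have H (a b p q : E) : tor (d2 a b) p q =
    tor (dgam a x) (gam (Gam x) b p) q + tor (Gam x) (gam (dgam a x) b p) q
  + tor (dgam a x) p (gam (Gam x) b q) + tor (Gam x) p (gam (dgam a x) b q)
  - gam (dgam a x) b (tor (Gam x) p q) - gam (Gam x) b (tor (dgam a x) p q).
  (* Leibniz rule for T (X, Y) in direction a *)
  have dg (X Y : E -> E) (dX dY : E) : is_derive x a X dX -> is_derive x a Y dY ->
      is_derive x a (fun y => tor (Gam y) (X y) (Y y))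
       (tor (dgam a x) (X x) (Y x) + tor (Gam x) dX (Y x) + tor (Gam x) (X x) dY).
    move=> HX HY.
    have h1 := is_derive_gam (fun i j => is_derive_symb a i j Dx) HX HY.
    have h2 := is_derive_gam (fun i j => is_derive_symb a i j Dx) HY HX.
    have := is_deriveB h1 h2; congr (is_derive _ _ _ _).
    exact: addr3_sub.
  have L : is_derive x a (fun y => tor (dgam b y) p q) (tor (d2 a b) p q).
    have h p q := is_derive_gam (fun i j => is_derive_dsymb a b i j Dx)
      (is_derive_cst p x a) (is_derive_cst q x a).
    have := is_deriveB (h p q) (h q p).
    by rewrite !gam0l !gam0r !addr0.
  have m1 := dg _ _ _ _ (is_derive_gamc a b p Dx) (is_derive_cst q x a).
  have m2 := dg _ _ _ _ (is_derive_cst p x a) (is_derive_gamc a b q Dx).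
  have m3 := is_derive_gam (fun i j => is_derive_symb a i j Dx)
    (is_derive_cst b x a) (is_derive_tor a p q Dx).
  have M := is_deriveB (is_deriveD m1 m2) m3.
  have {}M := is_derive_open oD Dx _ M.
  have {}M := M _ (fun y Dy => esym (tor_par b p q Dy)).
  have := @derive_val _ _ _ _ _ _ _ M; rewrite (@derive_val _ _ _ _ _ _ _ L) => ->.
  by rewrite tor0l tor0r gam0l !addr0 opprD !addrA.
have d2C : d2 u v = d2 v u.
  by apply/funext => i; apply/funext => j; exact: dsymb_swap.
apply: (@curv_tor_alg R _ (gam (Gam x)) (fun a b => gam (dgam a x) b)
  (gamDl _) (gamDr _) (gamNl _) (gamNr _) u v w z (fun a b => tor (d2 a b) w z)).
- by rewrite d2C.
- by move=> a b q; exact: tor_par_alg.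
- by move=> a b; rewrite H.
Qed.

End TorsionParallel.
End Chart.

(** * Complexification *)

Section ComplexExtension.
Variables (R : realType) (n : nat).
Local Notation C := (R[i]).
Local Notation E := 'rV[R]_(n + n).
Local Notation EC := 'rV[R[i]]_(n + n).
Local Notation emb := (map_mx (real_complex R)).
Local Notation re := (map_mx (@complex.Re R)).
Local Notation im := (map_mx (@complex.Im R)).
Local Notation conjv := (map_mx (@conjc R)).

Definition rlin (W : lmodType C) (f : E -> W) : Prop :=
  forall a u v, f (a *: u + v) = (real_complex R a) *: f u + f v.

Lemma emb_rlin (f : E -> E) : linear f -> rlin (fun u => emb (f u) : EC).
Proof. by move=> fl a u v; rewrite fl map_mxD map_mxZ. Qed.

Lemma vec_reim (z : EC) : z = emb (re z) + 'i%C *: emb (im z).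
Proof. by apply/matrixP => i j; rewrite !mxE -complexE. Qed.

Lemma re_lin (a : C) (u v : EC) : re (a *: u + v) =
  complex.Re a *: re u - complex.Im a *: im u + re v.
Proof.
by apply/matrixP => i j; rewrite !mxE; case: a (u i j) (v i j) => [a b] [c d] [e f].
Qed.

Lemma im_lin (a : C) (u v : EC) : im (a *: u + v) =
  complex.Re a *: im u + complex.Im a *: re u + im v.
Proof.
by apply/matrixP => i j; rewrite !mxE; case: a (u i j) (v i j) => [a b] [c d] [e f].
Qed.

Lemma rlin0 (W : lmodType C) (f : E -> W) : rlin f -> f 0 = 0.
Proof.
move=> fl; have := fl (-1) 0 0; rewrite scaler0 addr0 rmorphN rmorph1 scaleN1r.
by rewrite addNr.
Qed.

Lemma cext_lin (W : lmodType C) (f : E -> W) : rlin f -> linear (cext f).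
Proof.
move=> fl a u v; rewrite /cext re_lin im_lin -scaleNr -!addrA !fl.
rewrite !scalerDr !scalerA.
have e1 : a = real_complex R (complex.Re a) + 'i%C * real_complex R (complex.Im a).
  exact: complexE.
have e2 : a * 'i%C = real_complex R (- complex.Im a) + 'i%C * real_complex R (complex.Re a).
  by rewrite {1}e1 rmorphN mulrDl mulrAC -expr2 sqr_i mulN1r addrC [_ * 'i%C]mulrC.
rewrite {1}[in RHS]e1 e2 !scalerDl !addrA.
by rewrite (ACl ((1*5)*(2*4)*(3*6))%AC) /= !addrA.
Qed.

Lemma re_emb (u : E) : re (emb u) = u.
Proof. by apply/matrixP => i j; rewrite !mxE. Qed.

Lemma im_emb (u : E) : im (emb u) = 0.
Proof. by apply/matrixP => i j; rewrite !mxE. Qed.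

Lemma cext_emb (W : lmodType C) (f : E -> W) u : rlin f -> cext f (emb u) = f u.
Proof. by move=> fl; rewrite /cext re_emb im_emb (rlin0 fl) scaler0 addr0. Qed.

Lemma cext_rlin (W : lmodType C) (F : E -> E -> W) (z : EC) :
  (forall v, rlin (F^~ v)) -> rlin (fun u => cext (F u) z).
Proof.
by move=> Fl a u v; rewrite /cext !Fl !scalerDr !scalerA ['i%C * _]mulrC addrACA.
Qed.

Lemma lin_ext (W : lmodType C) (f g : EC -> W) : linear f -> linear g ->
  (forall a, f (emb a) = g (emb a)) -> forall z, f z = g z.
Proof.
move=> fl gl fg z; rewrite (vec_reim z) addrC.
by rewrite fl gl !fg.
Qed.

Lemma lin_comb (W : lmodType C) (f g : EC -> W) (k : C) : linear f -> linear g ->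
  linear (fun z => f z + k *: g z).
Proof.
by move=> fl gl a u v; rewrite fl gl !scalerDr !scalerA [k * a]mulrC addrACA.
Qed.

(** For torsion and curvature tensors these are the complex extensions
    [torsionC] and [curvatureC]. *)
Definition bil_ext (B : E -> E -> E) (u v : EC) : EC :=
  cext (fun a => cext (fun b => emb (B a b)) v) u.

Definition tril_ext (B : E -> E -> E -> E) (u v w : EC) : EC :=
  cext (fun a => cext (fun b => cext (fun c => emb (B a b c)) w) v) u.

Section Bilin.
Variable B : E -> E -> E.
Hypothesis Bl : forall v, linear (B^~ v).
Hypothesis Br : forall u, linear (B u).

Lemma bil_extl v : linear (bil_ext B ^~ v).
Proof.
by apply: cext_lin; apply: cext_rlin => b a u u'; rewrite Bl map_mxD map_mxZ.
Qed.

Lemma bil_extr u : linear (bil_ext B u).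
Proof.
have L a : linear (cext (fun b => emb (B a b) : EC)) by apply/cext_lin/emb_rlin.
exact: lin_comb (L (re u)) (L (im u)).
Qed.

Lemma bil_ext_emb a b : bil_ext B (emb a) (emb b) = emb (B a b).
Proof.
rewrite /bil_ext cext_emb; last first.
  by apply: cext_rlin => v u x y; rewrite Bl map_mxD map_mxZ.
by rewrite cext_emb//; exact: emb_rlin.
Qed.

End Bilin.

Section Trilin.
Variable B : E -> E -> E -> E.
Hypothesis B1 : forall v w, linear (fun u => B u v w).
Hypothesis B2 : forall u w, linear (fun v => B u v w).
Hypothesis B3 : forall u v, linear (B u v).

Let F2 (a : E) (v w : EC) : EC := cext (fun b => cext (fun c => emb (B a b c)) w) v.

Let F2l a w : linear (F2 a ^~ w).
Proof. exact: (bil_extl (fun w => B2 a w) w). Qed.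
Let F2r a v : linear (F2 a v).
Proof. exact: (bil_extr (B := B a) (fun v => B3 a v) v). Qed.

Let F1 v w : rlin (fun a => F2 a v w).
Proof.
apply: cext_rlin => b; apply: cext_rlin => c a u u'.
by rewrite B1 map_mxD map_mxZ.
Qed.

Lemma tril_ext1 v w : linear (fun u => tril_ext B u v w).
Proof. exact: cext_lin (F1 v w). Qed.

Lemma tril_ext2 u w : linear (fun v => tril_ext B u v w).
Proof. exact: lin_comb (F2l (re u) w) (F2l (im u) w). Qed.

Lemma tril_ext3 u v : linear (tril_ext B u v).
Proof. exact: lin_comb (F2r (re u) v) (F2r (im u) v). Qed.

Lemma tril_ext_emb a b c : tril_ext B (emb a) (emb b) (emb c) = emb (B a b c).
Proof.
have -> : tril_ext B (emb a) (emb b) (emb c) = F2 a (emb b) (emb c).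
  exact: cext_emb (F1 _ _).
exact: (bil_ext_emb (B := B a) (fun w => B2 a w) (fun v => B3 a v)).
Qed.

End Trilin.

Lemma bil_ext_eq (W : lmodType C) (f g : EC -> EC -> W) :
  (forall v, linear (f ^~ v)) -> (forall u, linear (f u)) ->
  (forall v, linear (g ^~ v)) -> (forall u, linear (g u)) ->
  (forall a b, f (emb a) (emb b) = g (emb a) (emb b)) -> forall u v, f u v = g u v.
Proof.
move=> fl fr gl gr fg u v; apply: (lin_ext (fl v) (gl v)) => a.
by apply: (lin_ext (fr _) (gr _)) => b.
Qed.

Lemma tril_ext_eq (W : lmodType C) (f g : EC -> EC -> EC -> W) :
  (forall v w, linear (fun u => f u v w)) -> (forall u w, linear (fun v => f u v w)) ->
  (forall u v, linear (f u v)) ->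
  (forall v w, linear (fun u => g u v w)) -> (forall u w, linear (fun v => g u v w)) ->
  (forall u v, linear (g u v)) ->
  (forall a b c, f (emb a) (emb b) (emb c) = g (emb a) (emb b) (emb c)) ->
  forall u v w, f u v w = g u v w.
Proof.
move=> f1 f2 f3 g1 g2 g3 fg u v w; apply: (lin_ext (f1 v w) (g1 v w)) => a.
by apply: (bil_ext_eq (f2 _) (f3 _) (g2 _) (g3 _)) => b c.
Qed.

Lemma conjv_lin a (u v : EC) : conjv (a *: u + v) = (conjc a) *: conjv u + conjv v.
Proof. by rewrite map_mxD map_mxZ. Qed.

Lemma conjv_emb (u : E) : conjv (emb u) = emb u.
Proof. by apply/matrixP => i j; rewrite !mxE /= oppr0. Qed.

Lemma conjvK (u : EC) : conjv (conjv u) = u.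
Proof. by apply/matrixP => i j; rewrite !mxE conjcK. Qed.

Lemma conj_lin_lin (f : EC -> EC) : linear f -> linear (fun u => conjv (f (conjv u))).
Proof. by move=> fl a u v; rewrite conjv_lin fl conjv_lin conjcK. Qed.

Lemma bil_ext_conj (B : E -> E -> E) :
  (forall v, linear (B^~ v)) -> (forall u, linear (B u)) ->
  forall u v, conjv (bil_ext B u v) = bil_ext B (conjv u) (conjv v).
Proof.
move=> Bl Br u v.
rewrite -{1}[u]conjvK -{1}[v]conjvK; move: (conjv u) (conjv v) => {}u {}v.
apply: (bil_ext_eq (f := fun u v => conjv (bil_ext B (conjv u) (conjv v)))) => [w|w|||a b].
- exact: (conj_lin_lin (bil_extl Bl (conjv w))).
- exact: (conj_lin_lin (bil_extr Br (conjv w))).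
- exact: bil_extl.
- exact: bil_extr.
by rewrite !conjv_emb bil_ext_emb// conjv_emb.
Qed.

Lemma tril_ext_conj (B : E -> E -> E -> E) :
  (forall v w, linear (fun u => B u v w)) -> (forall u w, linear (fun v => B u v w)) ->
  (forall u v, linear (B u v)) ->
  forall u v w, conjv (tril_ext B u v w) = tril_ext B (conjv u) (conjv v) (conjv w).
Proof.
move=> B1 B2 B3 u v w.
rewrite -{1}[u]conjvK -{1}[v]conjvK -{1}[w]conjvK.
move: (conjv u) (conjv v) (conjv w) => {}u {}v {}w.
apply: (tril_ext_eq
  (f := fun u v w => conjv (tril_ext B (conjv u) (conjv v) (conjv w)))) => [y z|y z|y z||||a b c].
- exact: (conj_lin_lin (tril_ext1 B1 (conjv y) (conjv z))).
- exact: (conj_lin_lin (tril_ext2 B2 (conjv y) (conjv z))).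
- exact: (conj_lin_lin (tril_ext3 B3 (conjv y) (conjv z))).
- exact: tril_ext1.
- exact: tril_ext2.
- exact: tril_ext3.
by rewrite !conjv_emb tril_ext_emb// conjv_emb.
Qed.

End ComplexExtension.

Section ComplexStructure.
Variables (R : realType) (n : nat).
Local Notation E := 'rV[R]_(n + n).
Local Notation EC := 'rV[R[i]]_(n + n).
Local Notation emb := (map_mx (real_complex R)).
Local Notation J := (@Jmx R n).

Lemma JmxK (u : E) : u *m J *m J = - u.
Proof.
rewrite -mulmxA /Jmx mulmx_block !mul0mx !mulmx0 !mul1mx !mulmx1 !addr0 !add0r.
rewrite -[u in RHS]mulmx1 -mulmxN; congr (_ *m _).
by rewrite (scalar_mx_block _ _ 1) opp_block_mx !oppr0.
Qed.

(** Complex linear extension of the complex structure; T10 is its eigenspace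
    for i. *)
Definition JC (z : EC) : EC := z *m emb J.

Lemma JC_lin : linear JC. Proof. by move=> a u v; rewrite /JC mulmxDl scalemxAl. Qed.

Lemma JC_emb u : JC (emb u) = emb (u *m J).
Proof. by rewrite /JC map_mxM. Qed.

Lemma JC_conj (z : EC) : JC (@conj_vec R n z) = @conj_vec R n (JC z).
Proof.
rewrite /conj_vec /JC map_mxM -map_mx_comp; congr (_ *m _).
by apply: eq_map_mx => a /=; rewrite oppr0.
Qed.

Lemma mem_T10 (z : EC) : (z \in T10) = (JC z == 'i%C *: z).
Proof.
rewrite /T10 /passmx.leigenspace memv_ker !lfunE /= !lfunE /= lfunE /= lfunE /=.
by rewrite subr_eq0.
Qed.

End ComplexStructure.

(** * The Chern connection in terms of the Bismut connection *)

(** The part of the endomorphism t u that commutes with J. *)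
Definition jpart (K : fieldType) (V : lmodType K) (J : V -> V) (t : V -> V -> V) u v :=
  2^-1 *: (t u v - J (t u (J v))).

(** Here c and cc are the covariant derivatives of constant fields for the
    Bismut and for the Chern connection, and c1, cc1 their first derivatives.
    The difference B = c - cc - A of the two candidates is shown to vanish. *)
Section ChernBismutAlgebra.
Variables (R : realType) (m : nat).
Local Notation E := 'rV[R]_m.
Variables (c cc : E -> E -> E) (c1 cc1 : E -> E -> E -> E) (J : E -> E) (g : E -> E -> R).
Hypothesis cl : forall v, linear (c^~ v).
Hypothesis cr : forall u, linear (c u).
Hypothesis ccl : forall v, linear (cc^~ v).
Hypothesis Jl : linear J.
Hypothesis JJ : forall u, J (J u) = - u.
Hypothesis cJ : forall u v, c u (J v) = J (c u v).
Hypothesis ccJ : forall u v, cc u (J v) = J (cc u v).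

Let cDl u v w : c (u + v) w = c u w + c v w. Proof. exact: linfD (cl w) _ _. Qed.
Let cDr w u v : c w (u + v) = c w u + c w v. Proof. exact: linfD (cr w) _ _. Qed.
Let cNl u w : c (- u) w = - c u w. Proof. exact: linfN (cl w) _. Qed.
Let cNr w u : c w (- u) = - c w u. Proof. exact: linfN (cr w) _. Qed.
Let cZr a w u : c w (a *: u) = a *: c w u. Proof. exact: linfZ (cr w) _ _. Qed.
Let ccNl u w : cc (- u) w = - cc u w. Proof. exact: linfN (ccl w) _. Qed.
Let JD u v : J (u + v) = J u + J v. Proof. exact: linfD Jl _ _. Qed.
Let JN u : J (- u) = - J u. Proof. exact: linfN Jl _. Qed.
Let JZ a u : J (a *: u) = a *: J u. Proof. exact: linfZ Jl _ _. Qed.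
Let at_ij (u v : E) : u = v -> forall k, u 0 k = v 0 k. Proof. by move->. Qed.

Let T := tor_alg c.

Let A := jpart J T.

Section Difference.
Hypothesis gl : forall w, linear (fun u => g u w : R^o).
Hypothesis gC : forall u v, g u v = g v u.
Hypothesis gJ : forall u v, g (J u) (J v) = g u v.
Hypothesis g0 : forall u, g u u = 0 -> u = 0.
Hypothesis dskew : forall u v w,
  g (c u v) w + g v (c u w) = g (cc u v) w + g v (cc u w).
Hypothesis Tskew : forall u v w, g (T u v) w = - g (T u w) v.
Hypothesis ccJJ : forall u v, tor_alg cc u v + tor_alg cc (J u) (J v) = 0.

Let gD u v w : g (u + v) w = g u w + g v w. Proof. exact: linfD (gl w) _ _. Qed.
Let gN u w : g (- u) w = - g u w. Proof. exact: linfN (gl w) _. Qed.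
Let gZ a u w : g (a *: u) w = a * g u w. Proof. exact: linfZ (gl w) _ _. Qed.

Let B u v := c u v - cc u v - A u v.

Let BE u v : B u v = 2^-1 *: c v u - 2^-1 *: J (c (J v) u) - cc u v.
Proof.
rewrite /B /A /jpart /T /tor_alg cJ !(JD, JN, JJ).
by apply/rowP => k; rewrite !mxE; field.
Qed.

Let BJ u v : B u (J v) = J (B u v).
Proof.
rewrite !BE !(JJ, cNl, ccJ, JD, JN, JZ).
by apply/rowP => k; rewrite !mxE; ring.
Qed.

(* the part of B that is antilinear in u: the torsion of cc having no
   (1,1)-part makes it symmetric, and antilinearity in one argument together
   with linearity in the other makes it zero *)
Let C u v := B u v + J (B (J u) v).

Let Csym u v : C u v = C v u.
Proof.
have /at_ij H := ccJJ u v.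
apply/rowP => k; have := H k; rewrite /C !BE /tor_alg.
by rewrite !(JJ, cNl, ccJ, cJ, JD, JN, JZ) !mxE; lra.
Qed.

Let C0 u v : C u v = 0.
Proof.
have CJr a b : C a (J b) = J (C a b) by rewrite /C !BJ JD.
have CJl a b : C (J a) b = - J (C a b).
  rewrite /C JJ JD JJ opprD opprK; have -> : B (- a) b = - B a b.
    by rewrite !BE ccNl cNr cNr JN; apply/rowP => k; rewrite !mxE; ring.
  by rewrite JN addrC.
have E1 : J (C u v) = - J (C u v) by rewrite -CJl [RHS]Csym CJr [C v u]Csym.
have /at_ij E2 : J (C u v) = 0.
  by apply/rowP => k; have := at_ij E1 k; rewrite !mxE; lra.
have : J (J (C u v)) = 0.
  have -> : J (C u v) = 0 by apply/rowP => k; rewrite E2.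
  by have := JZ 0 0; rewrite !scale0r.
by rewrite JJ => /eqP; rewrite oppr_eq0 => /eqP.
Qed.

Let BJl u v : B (J u) v = J (B u v).
Proof.
have := congr1 J (C0 u v); rewrite /C JD JJ; have -> : J 0 = 0.
  by have := JZ 0 0; rewrite !scale0r.
by move/eqP; rewrite subr_eq0 => /eqP.
Qed.

Let gJs a b : g (J a) b = - g a (J b).
Proof. by rewrite -[g a _]gJ JJ [g _ (- b)]gC gN [g b _]gC opprK. Qed.

Let Bskew u v w : g (B u v) w = - g v (B u w).
Proof.
have gDr a b d : g d (a + b) = g d a + g d b by rewrite gC gD ![g _ d]gC.
have gNr a d : g d (- a) = - g d a by rewrite gC gN [g _ d]gC.
have gZr k a d : g d (k *: a) = k * g d a by rewrite gC gZ [g _ d]gC.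
have H (t : E -> E -> E) : (forall p q r, g (t p q) r = - g (t p r) q) ->
    g (c u v - cc u v - jpart J t u v) w = - g v (c u w - cc u w - jpart J t u w).
  move=> ts; rewrite /jpart !(gD, gDr, gN, gNr, gZ, gZr) !gJs.
  have := dskew u v w; have := ts u v w; have := ts u (J v) (J w).
  rewrite [g v (t u w)]gC [g v (J (t _ _))]gC gJs; lra.
exact: H Tskew.
Qed.

(** Both connections are Hermitian, so B u is skew and commutes with J; by
    vanishing of C it is also J-linear in u. Moving J around with these rules
    shows that g (B (J a) b, w) is its own negative. *)
Lemma chern_eq_bismut u v : cc u v = c u v - A u v.
Proof.
have z a b : B (J a) b = 0.
  have E1 w : g (B (J a) b) w = - g (B (J a) b) w.
    rewrite {1}BJl gJs Bskew opprK -[J w]opprK.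
    have -> : g b (B a (- - J w)) = g b (B (J a) w) by rewrite opprK BJ BJl.
    by rewrite gC [in RHS]Bskew gC opprK [g b _]gC.
  by apply: g0; have := E1 (B (J a) b); lra.
have B0 : B u v = 0.
  have -> : B u v = - B (J (J u)) v.
    rewrite JJ; apply/rowP => k; rewrite !BE ccNl cNr cNr JN !mxE; ring.
  by rewrite z oppr0.
by move: B0; rewrite /B addrAC => /eqP; rewrite subr_eq0 => /eqP.
Qed.

End Difference.

Section Curvature.
Hypothesis ccE : forall u v, cc u v = c u v - A u v.
Hypothesis cc1E : forall a u v, cc1 a u v =
  c1 a u v - jpart J (fun p q => c1 a p q - c1 a q p) u v.
Hypothesis P : forall a b q, c1 a b q - c1 a q b =
     T (c a b) q + T b (c a q) - c a (T b q).

(** Curvature of nabla - A. The derivative terms of A combine with the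
    brackets of A with nabla to A (T (u, v)), because A is built from the
    parallel tensors T and J. *)
Lemma curv_chern_alg u v w : curv_alg cc cc1 u v w =
  curv_alg c c1 u v w - A (T u v) w + A u (A v w) - A v (A u w).
Proof.
have ADl p q r : A (p + q) r = A p r + A q r.
  rewrite /A /jpart /T /tor_alg !(cDl, cDr, JD, JN).
  by apply/rowP => k; rewrite !mxE; ring.
have ANl p r : A (- p) r = - A p r.
  rewrite /A /jpart /T /tor_alg !(cNl, cNr, JD, JN).
  by apply/rowP => k; rewrite !mxE; ring.
have ADr p q r : A r (p + q) = A r p + A r q.
  rewrite /A /jpart /T /tor_alg !(JD, cDl, cDr, JN).
  by apply/rowP => k; rewrite !mxE; ring.
have ANr p r : A r (- p) = - A r p.
  rewrite /A /jpart /T /tor_alg !(JN, cNl, cNr, JD).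
  by apply/rowP => k; rewrite !mxE; ring.
have PA a p q : jpart J (fun p q => c1 a p q - c1 a q p) p q =
    A (c a p) q + A p (c a q) - c a (A p q).
  rewrite /A /jpart !P !cJ !(JD, JN, cZr, cDr, cNr, cJ).
  by apply/rowP => k; rewrite !mxE; ring.
rewrite /curv_alg !cc1E !PA !ccE !(cDr, cNr, ADr, ANr).
rewrite /T /tor_alg ADl ANl.
by apply/rowP => k; rewrite !mxE; ring.
Qed.

End Curvature.
End ChernBismutAlgebra.

Section ChartPair.
Variables (R : realType) (n : nat).
Local Notation E := 'rV[R]_(n + n).
Local Notation EC := 'rV[R[i]]_(n + n).
Local Notation emb := (map_mx (real_complex R)).
Local Notation J := (mulmxr (@Jmx R n) : E -> E).
Variables (D : set E) (G : E -> 'M[R]_(n + n)) (Gb Gc : christoffel R n).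
Hypothesis oD : open D.
Hypothesis smG : smooth_on D G.
Hypothesis smGb : forall a b, smooth_on D (fun x => Gb x a b).
Hypothesis smGc : forall a b, smooth_on D (fun x => Gc x a b).
Hypothesis Gsym : forall x, D x -> (G x)^T = G x.
Hypothesis Gpos : forall x u, D x -> u != 0 -> 0 < metric_val G x u u.
Hypothesis GJ : forall x u v, D x ->
  metric_val G x (u *m Jmx) (v *m Jmx) = metric_val G x u v.
Hypothesis parGb : metric_parallel D G Gb.
Hypothesis parGc : metric_parallel D G Gc.
Hypothesis parJb : complex_parallel D Gb.
Hypothesis parJc : complex_parallel D Gc.
Hypothesis bskew : forall x u v w, D x ->
  metric_val G x (torsion_at Gb x u v) w = - metric_val G x (torsion_at Gb x u w) v.
Hypothesis cchern : forall x u v, D x -> u \in T10 -> v \in T10 ->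
  torsionC Gc x u (conj_vec v) = 0.
Hypothesis Tpar : torsion_parallel_on D Gb.

Lemma J_lin : linear J. Proof. by move=> a u v; rewrite linearP. Qed.

Lemma metric_linl x w : linear (fun u => metric_val G x u w : R^o).
Proof. by move=> a u v; rewrite /metric_val !mulmxDl -!scalemxAl !mxE. Qed.

Lemma metric_val_sym x u v : D x -> metric_val G x u v = metric_val G x v u.
Proof.
move=> Dx; rewrite /metric_val.
have -> : v *m G x *m u^T = (u *m G x *m v^T)^T.
  by rewrite !trmx_mul trmxK Gsym// mulmxA.
by rewrite [RHS]mxE.
Qed.

Lemma gamJ (Gam : christoffel R n) x u v : complex_parallel D Gam -> D x ->
  gam (Gam x) u (J v) = J (gam (Gam x) u v).
Proof.
move=> pJ Dx.
have := pJ (cst u) (cst v) (smooth_cst u) (smooth_cst v) x Dx.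
by rewrite -[fun y => _]/(cst (v *m Jmx)) !cov_cst.
Qed.

Lemma torsion_at_linl (Gam : christoffel R n) x v : linear (fun u => torsion_at Gam x u v).
Proof.
by move=> a u u'; rewrite !torsion_atE /tor gam_linl gam_linr opprD scalerBr addrACA.
Qed.

Lemma torsion_at_linr (Gam : christoffel R n) x u : linear (torsion_at Gam x u).
Proof.
by move=> a v v'; rewrite !torsion_atE /tor gam_linl gam_linr opprD scalerBr addrACA.
Qed.

Lemma re_part (a b d e : E) :
  (- 'i%C) *: ('i%C *: emb b + emb e) + ('i%C *: emb d + emb a) = 0 :> EC -> a + b = 0.
Proof.
rewrite scalerDr scalerA mulNr -expr2 sqr_i opprK scale1r => H.
apply/matrixP => i j; have := congr1 (fun M : EC => complex.Re (M i j)) H.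
by rewrite !mxE /= !(mul0r, mul1r, mulr0, mulN1r, subr0, addr0, add0r, oppr0) addrC.
Qed.

(** The real part of T (u - i J u, v + i J v) = 0. *)
Lemma chern_torsionJJ x u v : D x ->
  torsion_at Gc x u v + torsion_at Gc x (J u) (J v) = 0.
Proof.
move=> Dx; set T := torsion_at Gc x.
have TD : forall w : E, (emb w - 'i%C *: emb (J w) : EC) \in T10.
  move=> w; rewrite mem_T10; have Jl := @JC_lin R n.
  have -> : JC (emb w - 'i%C *: emb (J w)) = JC (emb w) - 'i%C *: JC (emb (J w)).
    by rewrite /JC mulmxBl -scalemxAl.
  rewrite !JC_emb /= JmxK scalerBr scalerA -expr2 sqr_i scaleN1r opprK.
  by rewrite map_mxN scalerN opprK addrC.
have := cchern Dx (TD u) (TD v).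
have -> : conj_vec (emb v - 'i%C *: emb (J v) : EC) = emb v + 'i%C *: emb (J v).
  rewrite addrC -scaleNr /conj_vec conjv_lin !conjv_emb addrC.
  by congr (_ + _ *: _); apply/eqP; rewrite eq_complex /= oppr0 opprK !eqxx.
have Tl := bil_extl (torsion_at_linl Gc x).
have Tr := bil_extr (torsion_at_linr Gc x).
rewrite -[torsionC _ _]/(bil_ext T).
have -> : emb u - 'i%C *: emb (J u) = (- 'i%C) *: emb (J u) + emb u :> EC.
  by rewrite scaleNr addrC.
rewrite [emb v + _]addrC Tl !Tr !(bil_ext_emb (torsion_at_linl Gc x) (torsion_at_linr Gc x)).
exact: re_part.
Qed.

Let A x := jpart J (tor (Gb x)).

Lemma chern_symb x u v : D x -> gam (Gc x) u v = gam (Gb x) u v - A x u v.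
Proof.
move=> Dx.
apply: (chern_eq_bismut (c := gam (Gb x)) (cc := gam (Gc x)) (J := J)
  (g := metric_val G x) (gam_linl _) (gam_linr _) (gam_linl _)).
- exact: J_lin.
- exact: JmxK.
- by move=> a b; exact: gamJ.
- by move=> a b; exact: gamJ.
- exact: metric_linl.
- by move=> a b; exact: metric_val_sym.
- by move=> a b; exact: GJ.
- move=> a a0; apply/eqP; apply: contraT => /(Gpos Dx).
  by rewrite a0 ltxx.
- move=> a b w; rewrite -(metric_par smG parGb)//.
  exact: (metric_par smG parGc).
- by move=> a b w; have := bskew a b w Dx; rewrite !torsion_atE.
- by move=> a b; have := chern_torsionJJ a b Dx; rewrite !torsion_atE.
Qed.

Lemma chern_torsion x u v : D x -> torsion_at Gc x u v =
  torsion_at Gb x u v - jpart J (torsion_at Gb x) u v + jpart J (torsion_at Gb x) v u.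
Proof.
move=> Dx; rewrite /jpart !torsion_atE /tor !chern_symb// /A /jpart.
by rewrite opprB addrA (ACl (1*4*2*3)%AC).
Qed.

Lemma is_derive_mulmxr (V : normedModType R) p q r (f : V -> 'M[R]_(p, q))
    (M : 'M[R]_(q, r)) y v (d : 'M[R]_(p, q)) :
  is_derive y v f d -> is_derive y v (fun z => f z *m M) (d *m M).
Proof.
move=> fd; apply: is_derive_mx => i j; rewrite mxE.
under eq_fun do rewrite mxE.
apply: is_derive_sumf => k.
have := is_derive_mulf (is_derive_coord i k fd) (is_derive_cst (M k j) y v).
by rewrite mulr0 addr0.
Qed.

Lemma chern_dsymb x a u v : D x -> gam (dgam Gc a x) u v =
  gam (dgam Gb a x) u v - jpart J (tor (dgam Gb a x)) u v.
Proof.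
move=> Dx.
have H1 := is_derive_gamc smGb a u v Dx.
have H2 := is_derive_tor smGb a u v Dx.
have H3 := is_derive_mulmxr Jmx (is_derive_tor smGb a u (J v) Dx).
have H := is_deriveB H1 (is_deriveZ 2^-1 (is_deriveB H2 H3)).
have {}H := is_derive_open oD Dx _ H.
have {}H := H _ (fun y Dy => esym (chern_symb u v Dy)).
rewrite -(@derive_val _ _ _ _ _ _ _ (is_derive_gamc smGc a u v Dx)).
by rewrite (@derive_val _ _ _ _ _ _ _ H).
Qed.

Lemma chern_curvature x u v w : D x -> curvature_at Gc x u v w =
  curvature_at Gb x u v w - jpart J (torsion_at Gb x) (torsion_at Gb x u v) w
  + jpart J (torsion_at Gb x) u (jpart J (torsion_at Gb x) v w)
  - jpart J (torsion_at Gb x) v (jpart J (torsion_at Gb x) u w).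
Proof.
move=> Dx; rewrite (curvature_atE smGb)// (curvature_atE smGc)//.
have -> : torsion_at Gb x = tor (Gb x).
  by apply/funext => a; apply/funext => b; exact: torsion_atE.
apply: (curv_chern_alg (c := gam (Gb x)) (cc := gam (Gc x))
  (c1 := fun a b => gam (dgam Gb a x) b) (cc1 := fun a b => gam (dgam Gc a x) b)
  (J := J) (gam_linl _) (gam_linr _) J_lin).
- by move=> a b; exact: gamJ.
- by move=> a b; exact: chern_symb.
- by move=> a b q; exact: chern_dsymb.
- by move=> a b q; exact: (tor_par smGb Tpar).
Qed.

End ChartPair.

(** * Polarisation *)

(** A form that is linear in its first and third and conjugate linear in its
    second and fourth argument, and that vanishes on the diagonal of a
    subspace P, vanishes after symmetrisation. Real parameters t separate the
    homogeneous components; replacing a vector by i times it separates the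
    linear from the conjugate linear ones. *)
Section Polarization.
Variables (C : numClosedFieldType) (W : lmodType C) (P : W -> Prop).
Variable B : W -> W -> W -> W -> C.
Hypothesis PD : forall u v a, P u -> P v -> P (u + a *: v).
Hypothesis B1 : forall u v a y z w, B (u + a *: v) y z w = B u y z w + a * B v y z w.
Hypothesis B3 : forall u v a x y w, B x y (u + a *: v) w = B x y u w + a * B x y v w.
Hypothesis B2 : forall u v a x z w, B x (u + a *: v) z w = B x u z w + a^* * B x v z w.
Hypothesis B4 : forall u v a x y z, B x y z (u + a *: v) = B x y z u + a^* * B x y z v.
Hypothesis B0 : forall x, P x -> B x x x x = 0.

Let iN0 : 'i != 0 :> C. Proof. exact: neq0Ci. Qed.

(** A polynomial of degree at most three without constant term that vanishes
    at 1, -1 and 2 has no linear term. *)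
Lemma quartic_linear (c1 c2 c3 : C) :
  c1 + c2 + c3 = 0 -> - c1 + c2 - c3 = 0 -> 2 * c1 + 4 * c2 + 8 * c3 = 0 -> c1 = 0.
Proof.
move=> h1 h2 h3; have : 6 * c1 = 0.
  transitivity (6 * (c1 + c2 + c3) - 2 * (- c1 + c2 - c3) - (2 * c1 + 4 * c2 + 8 * c3)).
    ring.
  by rewrite h1 h2 h3 !mulr0 !subr0.
by move/eqP; rewrite mulf_eq0 pnatr_eq0 /= => /eqP.
Qed.

Let P0 x : P x -> P 0.
Proof. by move=> Px; have := PD (-1) Px Px; rewrite scaleN1r subrr. Qed.

Let PZ x a : P x -> P (a *: x).
Proof. by move=> Px; rewrite -[_ *: _]add0r; apply: PD => //; exact: P0 Px. Qed.

Let Z1 y a u v w : B (a *: y) u v w = a * B y u v w.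
Proof.
have B0l : B 0 u v w = 0.
  by have := B1 0 0 (-1) u v w; rewrite scaler0 addr0 mulN1r subrr.
by have := B1 0 y a u v w; rewrite !add0r B0l add0r.
Qed.

Let Z2 y a u v w : B u (a *: y) v w = a^* * B u y v w.
Proof.
have B0l : B u 0 v w = 0.
  by have := B2 0 0 (-1) u v w; rewrite scaler0 addr0 rmorphN1 mulN1r subrr.
by have := B2 0 y a u v w; rewrite !add0r B0l add0r.
Qed.

Let Z3 y a u v w : B u v (a *: y) w = a * B u v y w.
Proof.
have B0l : B u v 0 w = 0.
  by have := B3 0 0 (-1) u v w; rewrite scaler0 addr0 mulN1r subrr.
by have := B3 0 y a u v w; rewrite !add0r B0l add0r.
Qed.

Let Z4 y a u v w : B u v w (a *: y) = a^* * B u v w y.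
Proof.
have B0l : B u v w 0 = 0.
  by have := B4 0 0 (-1) u v w; rewrite scaler0 addr0 rmorphN1 mulN1r subrr.
by have := B4 0 y a u v w; rewrite !add0r B0l add0r.
Qed.

Lemma holomorphic_part (a b : C) : a + b = 0 -> 'i * a - 'i * b = 0 -> a = 0.
Proof.
move=> h1 h2; have : 2 * 'i * a = 0.
  transitivity ('i * (a + b) + ('i * a - 'i * b)); first by ring.
  by rewrite h1 h2 mulr0 addr0.
by move/eqP; rewrite !mulf_eq0 pnatr_eq0 /= (negPf iN0) => /eqP.
Qed.

Lemma polarize_one x y : P x -> P y ->
  (B y x x x + B x x y x) + (B x y x x + B x x x y) = 0.
Proof.
move=> Px Py.
have E (t : C) : t^* = t ->
  t * ((B y x x x + B x x y x) + (B x y x x + B x x x y))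
  + t ^+ 2 * (B y y x x + B y x y x + B y x x y + B x y y x + B x y x y + B x x y y)
  + t ^+ 3 * (B y y y x + B y y x y + B y x y y + B x y y y) = 0.
  move=> tr; have := B0 (PD t Px Py).
  rewrite !(B1, B2, B3, B4) tr (B0 Px) (B0 Py) => H; rewrite -[RHS]H; ring.
apply: quartic_linear.
- by have := E 1 (conjC1 _); rewrite !expr1n !mul1r; exact.
- have := E (-1); rewrite rmorphN1 => /(_ erefl) H; rewrite -[RHS]H; ring.
- have := E 2; rewrite rmorph_nat => /(_ erefl) H; rewrite -[RHS]H; ring.
Qed.

Lemma polarize_hol x y : P x -> P y -> B y x x x + B x x y x = 0.
Proof.
move=> Px Py; apply: holomorphic_part (polarize_one Px Py) _.
have := polarize_one Px (PZ 'i Py); rewrite !(Z1, Z2, Z3, Z4) conjCi => H.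
rewrite -[RHS]H; ring.
Qed.

Lemma polarize_two x y z : P x -> P y -> P z ->
  (B y x z x + B z x y x) + (B y z x x + B y x x z + B x z y x + B x x y z) = 0.
Proof.
move=> Px Py Pz.
have E (t : C) : t^* = t ->
  t * ((B y x z x + B z x y x) + (B y z x x + B y x x z + B x z y x + B x x y z))
  + t ^+ 2 * (B y z z x + B y z x z + B y x z z + B z z y x + B z x y z + B x z y z)
  + t ^+ 3 * (B y z z z + B z z y z) = 0.
  move=> tr; have := polarize_hol (PD t Px Pz) Py.
  rewrite !(B1, B2, B3, B4) tr => H; rewrite -[RHS]H.
  apply/eqP; rewrite -subr_eq0; apply/eqP.
  by rewrite -[RHS]oppr0 -(polarize_hol Px Py); ring.
apply: quartic_linear.
- by have := E 1 (conjC1 _); rewrite !expr1n !mul1r; exact.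
- have := E (-1); rewrite rmorphN1 => /(_ erefl) H; rewrite -[RHS]H; ring.
- have := E 2; rewrite rmorph_nat => /(_ erefl) H; rewrite -[RHS]H; ring.
Qed.

Lemma polarize_two_hol x y z : P x -> P y -> P z -> B y x z x + B z x y x = 0.
Proof.
move=> Px Py Pz; apply: holomorphic_part (polarize_two Px Py Pz) _.
have := polarize_two Px Py (PZ 'i Pz); rewrite !(Z1, Z2, Z3, Z4) conjCi => H.
rewrite -[RHS]H; ring.
Qed.

Lemma polarization x y z w : P x -> P y -> P z -> P w ->
  B x y z w + B z y x w + B x w z y + B z w x y = 0.
Proof.
move=> Px Py Pz Pw; have h := polarize_two_hol (PD 1 Py Pw) Px Pz.
rewrite !(B2, B4) conjC1 !mul1r in h.
transitivity ((B x y z y + B z y x y) + (B x y z w + B z y x w + B x w z y + B z w x y)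
  + (B x w z w + B z w x w)); last by rewrite -[RHS]h; ring.
by rewrite !polarize_two_hol// add0r addr0.
Qed.

End Polarization.

(** * Complex linear extension of the identities *)

Section LinearComposites.
Variable K : nzRingType.
Implicit Types U V W : lmodType K.
Lemma lin_id U : linear (fun u : U => u). Proof. by []. Qed.
Lemma lin_add U V (f g : U -> V) : linear f -> linear g -> linear (fun u => f u + g u).
Proof. by move=> fl gl a u v; rewrite fl gl scalerDr addrACA. Qed.
Lemma lin_opp U V (f : U -> V) : linear f -> linear (fun u => - f u).
Proof. by move=> fl a u v; rewrite fl opprD scalerN. Qed.
Lemma lin_comp U V W (f : V -> W) (g : U -> V) : linear f -> linear g ->
  linear (fun u => f (g u)).
Proof. by move=> fl gl a u v; rewrite gl fl. Qed.
End LinearComposites.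

Lemma lin_scale (K : comNzRingType) (U V : lmodType K) (k : K) (f : U -> V) :
  linear f -> linear (fun u => k *: f u).
Proof. by move=> fl a u v; rewrite fl scalerDr !scalerA mulrC. Qed.

(** T and Rm are the real torsion and curvature at a point, TC and RC complex
    multilinear maps extending them, Td, Rd, TD, RD the same for a second
    connection. Both sides of each identity are complex multilinear, so that
    it is enough to compare them on real vectors. *)
Section ComplexIdentities.
Variables (R : realType) (n : nat).
Local Notation C := (R[i]).
Local Notation E := 'rV[R]_(n + n).
Local Notation EC := 'rV[R[i]]_(n + n).
Local Notation emb := (map_mx (real_complex R)).
Local Notation conjv := (@conj_vec R n).
Local Notation J := (mulmxr (@Jmx R n) : E -> E).
Local Notation JC := (@JC R n).
Variables (G : 'M[R]_(n + n)) (T : E -> E -> E) (Rm : E -> E -> E -> E).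
Let g (u v : E) : R := (u *m G *m v^T) 0 0.
Hypothesis Tl : forall v, linear (T^~ v).
Hypothesis Tr : forall u, linear (T u).
Hypothesis R1 : forall v w, linear (fun u => Rm u v w).
Hypothesis R2 : forall u w, linear (fun v => Rm u v w).
Hypothesis R3 : forall u v, linear (Rm u v).
Hypothesis gsym : forall u v, g u v = g v u.
Hypothesis gJ : forall u v, g (J u) (J v) = g u v.
Hypothesis TN : forall u v, T u v = - T v u.
Hypothesis TJJ : forall u v, T (J u) (J v) = T u v + J (T (J u) v) + J (T u (J v)).
Hypothesis Tskew : forall u v w, g (T u v) w = - g (T u w) v.
Hypothesis RN : forall u v w, Rm u v w = - Rm v u w.
Hypothesis RJ : forall u v w, Rm u v (J w) = J (Rm u v w).
Hypothesis Rskew : forall u v w z, g (Rm u v w) z + g w (Rm u v z) = 0.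
Hypothesis RT : forall u v w z, Rm u v (T w z) = T (Rm u v w) z + T w (Rm u v z).
Hypothesis Rbianchi : forall u v w, Rm u v w + Rm v w u + Rm w u v =
  T (T u v) w + T (T v w) u + T (T w u) v.

(** The complex bilinear, not Hermitian, extension of g. *)
Definition gC (u v : EC) : C := (u *m emb G *m v^T) 0 0.
Variables (TC : EC -> EC -> EC) (RC : EC -> EC -> EC -> EC).

Lemma gC_linl v : linear (fun u => gC u v : C^o).
Proof. by move=> a u u'; rewrite /gC !mulmxDl -!scalemxAl !mxE. Qed.
Lemma gC_linr u : linear (fun v => gC u v : C^o).
Proof. by move=> a v v'; rewrite /gC linearP /= mulmxDr -scalemxAr !mxE. Qed.
Lemma gC_emb a b : gC (emb a) (emb b) = real_complex R (g a b).
Proof. by rewrite /gC /g map_trmx -!map_mxM mxE. Qed.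

Hypothesis TCl : forall v, linear (TC ^~ v).
Hypothesis TCr : forall u, linear (TC u).
Hypothesis RC1 : forall v w, linear (fun u => RC u v w).
Hypothesis RC2 : forall u w, linear (fun v => RC u v w).
Hypothesis RC3 : forall u v, linear (RC u v).
Hypothesis TCe : forall a b, TC (emb a) (emb b) = emb (T a b).
Hypothesis RCe : forall a b c, RC (emb a) (emb b) (emb c) = emb (Rm a b c).

Let lTC1 (A : EC -> EC) v : linear A -> linear (fun u => TC (A u) v).
Proof. exact: (@lin_comp _ EC EC EC (TC ^~ v) A). Qed.
Let lTC2 v (A : EC -> EC) : linear A -> linear (fun u => TC v (A u)).
Proof. exact: (@lin_comp _ EC EC EC (TC v) A). Qed.
Let lRC1 (A : EC -> EC) v w : linear A -> linear (fun u => RC (A u) v w).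
Proof. exact: (@lin_comp _ EC EC EC (fun u => RC u v w) A). Qed.
Let lRC2 v (A : EC -> EC) w : linear A -> linear (fun u => RC v (A u) w).
Proof. exact: (@lin_comp _ EC EC EC (fun u => RC v u w) A). Qed.
Let lRC3 v w (A : EC -> EC) : linear A -> linear (fun u => RC v w (A u)).
Proof. exact: (@lin_comp _ EC EC EC (RC v w) A). Qed.
Let lJC (A : EC -> EC) : linear A -> linear (fun u => JC (A u)).
Proof. apply: (@lin_comp _ EC EC EC JC A); exact: JC_lin. Qed.
Let lgC1 (A : EC -> EC) w : linear A -> linear (fun u => gC (A u) w : C^o).
Proof. apply: (@lin_comp _ EC EC C^o (fun u => gC u w) A); exact: gC_linl. Qed.
Let lgC2 w (A : EC -> EC) : linear A -> linear (fun u => gC w (A u) : C^o).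
Proof. apply: (@lin_comp _ EC EC C^o (gC w) A); exact: gC_linr. Qed.

Ltac lin := match goal with
    | |- GRing.linear_for _ (fun u => u) => exact: lin_id
    | |- GRing.linear_for _ (fun u => TC (@?A u) ?v) => refine (@lTC1 A v _); lin
    | |- GRing.linear_for _ (fun u => TC ?v (@?A u)) => refine (@lTC2 v A _); lin
    | |- GRing.linear_for _ (fun u => RC (@?A u) ?v ?w) => refine (@lRC1 A v w _); lin
    | |- GRing.linear_for _ (fun u => RC ?v (@?A u) ?w) => refine (@lRC2 v A w _); lin
    | |- GRing.linear_for _ (fun u => RC ?v ?w (@?A u)) => refine (@lRC3 v w A _); lin
    | |- GRing.linear_for _ (fun u => JC (@?A u)) => refine (@lJC A _); lin
    | |- GRing.linear_for _ (fun u => gC (@?A u) ?w) => refine (@lgC1 A w _); lin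
    | |- GRing.linear_for _ (fun u => gC ?w (@?A u)) => refine (@lgC2 w A _); lin
    | |- GRing.linear_for _ (fun u => - (@?A u)) => refine (@lin_opp _ _ _ A _); lin
    | |- GRing.linear_for _ (fun u => ?k *: (@?A u)) => refine (@lin_scale _ _ _ k A _); lin
    | |- GRing.linear_for _ (fun u => (@?A u) + (@?B u)) => refine (@lin_add _ _ _ A B _ _); lin
    | |- GRing.linear_for _ (TC _) => exact: TCr
    | |- GRing.linear_for _ (RC _ _) => exact: RC3
    | |- GRing.linear_for _ JC => exact: JC_lin
    | |- GRing.linear_for _ (gC _) => exact: gC_linr

    end.

Ltac ext x := match goal with |- ?A = ?B =>
  pattern x; match goal with |- (fun y => @?L y = @?M y) _ =>
    apply: (@lin_ext _ _ _ L M); [ lin | lin | move=> {}x /= ] end end.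

Lemma TC_anti u v : TC u v = - TC v u.
Proof. by ext u; ext v; rewrite !TCe TN map_mxN. Qed.

Lemma TC_skew u v w : gC (TC u v) w = - gC (TC u w) v :> C^o.
Proof. by ext u; ext v; ext w; rewrite !TCe !gC_emb Tskew rmorphN. Qed.

Lemma gC_sym u v : gC u v = gC v u :> C^o.
Proof. by ext u; ext v; rewrite !gC_emb gsym. Qed.

Lemma gC_JC u v : gC (JC u) (JC v) = gC u v :> C^o.
Proof. by ext u; ext v; rewrite !JC_emb !gC_emb gJ. Qed.

Lemma TC_JC u v : TC (JC u) (JC v) = TC u v + JC (TC (JC u) v) + JC (TC u (JC v)).
Proof. by ext u; ext v; rewrite !(JC_emb, TCe) -!map_mxD TJJ. Qed.

Lemma RC_anti u v w : RC u v w = - RC v u w.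
Proof. by ext u; ext v; ext w; rewrite !RCe RN map_mxN. Qed.

Lemma RC_JC u v w : RC u v (JC w) = JC (RC u v w).
Proof. by ext u; ext v; ext w; rewrite !(JC_emb, RCe) RJ. Qed.

Lemma RC_skew u v w z : gC (RC u v w) z = - gC w (RC u v z) :> C^o.
Proof.
ext u; ext v; ext w; ext z; rewrite !RCe !gC_emb -rmorphN; congr (real_complex R _).
by have := Rskew u v w z; rewrite addrC => /eqP; rewrite addrC addr_eq0 => /eqP.
Qed.

Lemma RC_TC u v w z : RC u v (TC w z) = TC (RC u v w) z + TC w (RC u v z).
Proof. by ext u; ext v; ext w; ext z; rewrite !(TCe, RCe) -map_mxD RT. Qed.

Lemma RC_bianchi u v w : RC u v w + RC v w u + RC w u v =
  TC (TC u v) w + TC (TC v w) u + TC (TC w u) v.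
Proof. by ext u; ext v; ext w; rewrite !(TCe, RCe) -!map_mxD Rbianchi. Qed.

Variables (Td : E -> E -> E) (Rd : E -> E -> E -> E).
Variables (TD : EC -> EC -> EC) (RD : EC -> EC -> EC -> EC).
Hypothesis TDl : forall v, linear (TD ^~ v).
Hypothesis TDr : forall u, linear (TD u).
Hypothesis RD1 : forall v w, linear (fun u => RD u v w).
Hypothesis RD2 : forall u w, linear (fun v => RD u v w).
Hypothesis RD3 : forall u v, linear (RD u v).
Hypothesis TDe : forall a b, TD (emb a) (emb b) = emb (Td a b).
Hypothesis RDe : forall a b c, RD (emb a) (emb b) (emb c) = emb (Rd a b c).

Lemma jpart_emb a b : jpart JC TC (emb a) (emb b) = emb (jpart J T a b).
Proof.
rewrite /jpart map_mxZ map_mxB -JC_emb -!TCe -JC_emb; congr (_ *: _).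
by rewrite fmorphV rmorph_nat.
Qed.

Lemma TD_jpart : (forall u v, Td u v = T u v - jpart J T u v + jpart J T v u) ->
  forall u v, TD u v = TC u v - jpart JC TC u v + jpart JC TC v u.
Proof.
move=> TdE; apply: (bil_ext_eq TDl TDr) => [v|u|a b]; try by rewrite /jpart; lin.
by rewrite TDe TdE !jpart_emb TCe map_mxD map_mxB.
Qed.

Lemma RD_jpart : (forall u v w, Rd u v w = Rm u v w - jpart J T (T u v) w
    + jpart J T u (jpart J T v w) - jpart J T v (jpart J T u w)) ->
  forall u v w, RD u v w = RC u v w - jpart JC TC (TC u v) w
    + jpart JC TC u (jpart JC TC v w) - jpart JC TC v (jpart JC TC u w).
Proof.
move=> RdE; apply: (tril_ext_eq RD1 RD2 RD3) => [v w|u w|u v|a b c];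
  try by rewrite /jpart; lin.
by rewrite RDe RdE !(jpart_emb, TCe, RCe) map_mxB map_mxD map_mxB.
Qed.

End ComplexIdentities.

(** * Components in a unitary frame *)

Lemma bianchi_arith (K : comNzRingType) (f1 f2 a b c d y : K) :
  f1 - f2 = - a - b - (- c - d) - y -> f1 - f2 = c + d - a - b - y.
Proof. by move=> ->; ring. Qed.

Lemma curvature_signs (K : zmodType) (r a b c y : K) :
  r - (- a - b) + - c - - y = r + a + b - c + y.
Proof. by rewrite -opprD !opprK addrA. Qed.

Lemma conj_sum5 (K : numClosedFieldType) (a b c d y : K) :
  (a + b - c - d - y)^* = a^* + b^* - d^* - c^* - y^*.
Proof. by rewrite !rmorphB rmorphD /=; congr (_ - _); rewrite addrAC. Qed.

Lemma curvature_arith (K : comNzRingType) (r1 r2 r3 r4 a b c d y : K) :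
  r1 - r2 = c + d - a - b - y -> r1 - r3 = c + d - a - b - y ->
  r2 - r4 = a + b - c - d - - y ->
  (r1 + a + b - c + y) + (r2 + c + d - a + - y) + (r3 + d + c - b + - y)
    + (r4 + b + a - d + y) = 0 ->
  4 * r1 = c + d - 3 * a - 3 * b - 2 * y.
Proof.
move=> h1 h2 h3 h4.
transitivity (0 + (r1 - r2) + (r1 - r3) + ((r1 - r2) + (r2 - r4)) - (a + b + c + d)).
  by rewrite -h4; ring.
by rewrite h1 h2 h3; ring.
Qed.

Section FrameArrays.
Variables (R : realType) (n : nat).
Local Notation C := (R[i]).
Local Notation EC := 'rV[R[i]]_(n + n).
Local Notation conjv := (@conj_vec R n).
Local Notation JC := (@JC R n).
Variables (G : 'M[R]_(n + n)).
Variables (TC : EC -> EC -> EC) (RC : EC -> EC -> EC -> EC).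
Local Notation gC := (gC G).
Local Notation ic := ('i%C : C).
Hypothesis gsym : forall u v, gC u v = gC v u.
Hypothesis gJ : forall u v, gC (JC u) (JC v) = gC u v.
Hypothesis gconj : forall u v, (gC u v)^* = gC (conjv u) (conjv v).
Hypothesis TCl : forall v, linear (TC ^~ v).
Hypothesis TCr : forall u, linear (TC u).
Hypothesis RC1 : forall v w, linear (fun u => RC u v w).
Hypothesis RC2 : forall u w, linear (fun v => RC u v w).
Hypothesis RC3 : forall u v, linear (RC u v).
Hypothesis TCconj : forall u v, conjv (TC u v) = TC (conjv u) (conjv v).
Hypothesis RCconj : forall u v w, conjv (RC u v w) = RC (conjv u) (conjv v) (conjv w).
Hypothesis TN : forall u v, TC u v = - TC v u.
Hypothesis Tskew : forall u v w, gC (TC u v) w = - gC (TC u w) v.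
Hypothesis TJJ : forall u v, TC (JC u) (JC v) = TC u v + JC (TC (JC u) v) + JC (TC u (JC v)).
Hypothesis RN : forall u v w, RC u v w = - RC v u w.
Hypothesis RJ : forall u v w, RC u v (JC w) = JC (RC u v w).
Hypothesis Rskew : forall u v w z, gC (RC u v w) z = - gC w (RC u v z).
Hypothesis RT : forall u v w z, RC u v (TC w z) = TC (RC u v w) z + TC w (RC u v z).
Hypothesis Rbianchi : forall u v w, RC u v w + RC v w u + RC w u v =
  TC (TC u v) w + TC (TC v w) u + TC (TC w u) v.

Let gDl u v w : gC (u + v) w = gC u w + gC v w. Proof. exact: linfD (gC_linl G w) _ _. Qed.
Let gZl a u w : gC (a *: u) w = a * gC u w. Proof. exact: linfZ (gC_linl G w) _ _. Qed.
Let gNl u w : gC (- u) w = - gC u w. Proof. exact: linfN (gC_linl G w) _. Qed.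
Let gDr u v w : gC w (u + v) = gC w u + gC w v. Proof. exact: linfD (gC_linr G w) _ _. Qed.
Let gZr a u w : gC w (a *: u) = a * gC w u. Proof. exact: linfZ (gC_linr G w) _ _. Qed.
Let gNr u w : gC w (- u) = - gC w u. Proof. exact: linfN (gC_linr G w) _. Qed.
Let TDl u v w : TC (u + v) w = TC u w + TC v w. Proof. exact: linfD (TCl w) _ _. Qed.
Let TZl a u w : TC (a *: u) w = a *: TC u w. Proof. exact: linfZ (TCl w) _ _. Qed.
Let TZr a u w : TC w (a *: u) = a *: TC w u. Proof. exact: linfZ (TCr w) _ _. Qed.
Let TNl u w : TC (- u) w = - TC u w. Proof. exact: linfN (TCl w) _. Qed.
Let JD u v : JC (u + v) = JC u + JC v. Proof. exact: linfD (@JC_lin R n) _ _. Qed.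
Let JZ a u : JC (a *: u) = a *: JC u. Proof. exact: linfZ (@JC_lin R n) _ _. Qed.
Let JN u : JC (- u) = - JC u. Proof. exact: linfN (@JC_lin R n) _. Qed.
Let ii : ic * ic = -1. Proof. by rewrite -expr2 sqr_i. Qed.
Let two0 : (2 : C) != 0. Proof. by rewrite pnatr_eq0. Qed.

Let T10J z : z \in T10 -> JC z = ic *: z. Proof. by rewrite mem_T10 => /eqP. Qed.

Let conjK z : conjv (conjv z) = z. Proof. exact: conjvK. Qed.

Let conjJ z : JC (conjv z) = conjv (JC z). Proof. exact: JC_conj. Qed.

Let conjZ (a : C) z : conjv (a *: z) = a^* *: conjv z.
Proof. by rewrite /conj_vec map_mxZ. Qed.

Let conjD y z : conjv (y + z) = conjv y + conjv z.
Proof. by rewrite /conj_vec map_mxD. Qed.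

(** J-invariance gives g (x, z) = g (i x, i z) = - g (x, z). *)
Lemma gC_T10 x z : x \in T10 -> z \in T10 -> gC x z = 0.
Proof.
move=> /T10J xJ /T10J zJ; have := gJ x z.
rewrite xJ zJ gZl gZr mulrA ii mulN1r => /eqP; rewrite -subr_eq0 -opprD oppr_eq0.
by rewrite -mulr2n -mulr_natl mulf_eq0 (negPf two0) => /eqP.
Qed.

Definition hprod u v := gC u (conjv v).

Lemma hprod_herm : hermitian_fun hprod.
Proof.
split=> [y|x y]; first exact: gC_linl.
by rewrite /hprod gconj conjK gsym.
Qed.

(** The identity for T (J x, J z) excludes a (0,1)-part: on vectors of type
    (1,0) it reads - t = t + 2 i J t. *)
Lemma TC_T10 x z : x \in T10 -> z \in T10 -> TC x z \in T10.
Proof.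
move=> /T10J xJ /T10J zJ; rewrite mem_T10; have := TJJ x z.
rewrite xJ zJ !TZl !TZr scalerA ii scaleN1r !JZ.
move: (TC x z) (JC _) => t j H; apply/eqP/rowP => k.
have : - t 0 k = t 0 k + ic * j 0 k + ic * j 0 k.
  by have := congr1 (fun v : EC => v 0 k) H; rewrite !mxE.
rewrite mxE => {}H; have : 2 * (ic * j 0 k + t 0 k) = 0.
  transitivity (t 0 k + ic * j 0 k + ic * j 0 k - - t 0 k); first by ring.
  by rewrite H subrr.
move/eqP; rewrite mulf_eq0 (negPf two0) addr_eq0 => /eqP H2.
by rewrite -[t 0 k]opprK -H2 mulrN mulrA ii mulN1r opprK.
Qed.

Lemma RC_T10 u v z : z \in T10 -> RC u v z \in T10.
Proof. by rewrite !mem_T10 -RJ => /eqP ->; rewrite (linfZ (RC3 u v)). Qed.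

(* projections to the types (1,0) and (0,1), the latter through conjugation *)
Let p10 v := 2^-1 *: (v - ic *: JC v).
Let p10_T10 v : p10 v \in T10.
Proof.
rewrite mem_T10 JZ JD JN JZ.
have -> : JC (JC v) = - v.
  rewrite {1}(vec_reim v) JD JZ !JC_emb /= JD JZ !JC_emb !JmxK !map_mxN scalerN -opprD.
  by rewrite -vec_reim.
have E (a b : C) : 2^-1 * (b - ic * - a) = ic * (2^-1 * (a - ic * b)).
  transitivity (2^-1 * (ic * a - (ic * ic) * b)); last by ring.
  by rewrite ii; ring.
by apply/eqP/rowP => k; have := E (v 0 k) (JC v 0 k); rewrite !mxE.
Qed.

Let p01_T10 v : conjv (v - p10 v) \in T10.
Proof.
have e : v - p10 v = 2^-1 *: (v + ic *: JC v).
  by apply/rowP => k; rewrite !mxE; field.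
have -> : conjv (v - p10 v) = p10 (conjv v).
  rewrite e conjZ conjD conjZ /p10 conjJ; congr (_ *: (_ + _)).
    by rewrite fmorphV rmorph_nat.
  by rewrite -scaleNr; congr (_ *: _); apply/eqP; rewrite eq_complex /= oppr0 !eqxx.
exact: p10_T10.
Qed.

Variable e : 'I_n -> EC.
Hypothesis eF : orthoframe hprod T10 e.
Let eT i : e i \in T10. Proof. by case: eF. Qed.
Let eE u : u \in T10 -> u = \sum_i hprod u (e i) *: e i.
Proof. by case: eF => _ _; exact. Qed.

Lemma gC_suml (I : finType) (a : I -> C) (v : I -> EC) w :
  gC (\sum_i a i *: v i) w = \sum_i a i * gC (v i) w.
Proof. exact: (lin_sum (gC_linl G w)). Qed.

Lemma gC_T01 x z : x \in T10 -> z \in T10 -> gC (conjv x) (conjv z) = 0.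
Proof. by move=> xT zT; rewrite -gconj gC_T10// conjC0. Qed.

(** The e_m and their conjugates form a basis in which g pairs e_m with the
    conjugate of e_m. *)
Lemma frame_pair u v : gC u v =
  \sum_m gC u (conjv (e m)) * gC v (e m) + \sum_m gC u (e m) * gC v (conjv (e m)).
Proof.
have uE : u = \sum_i gC u (conjv (e i)) *: e i + \sum_i gC u (e i) *: conjv (e i).
  rewrite -[LHS](subrK (p10 u)) addrC; congr (_ + _).
    rewrite [LHS](eE (p10_T10 u)); apply: eq_bigr => i _; congr (_ *: _).
    rewrite /hprod; apply/eqP; rewrite -subr_eq0 -gNl -gDl -opprB gNl oppr_eq0.
    by rewrite -[u - _]conjK gC_T01// p01_T10.
  rewrite -[LHS]conjK [conjv (u - _)](eE (p01_T10 u)).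
  rewrite /conj_vec raddf_sum; apply: eq_bigr => i _ /=.
  rewrite -/(conjv _) conjZ; congr (_ *: _).
  by rewrite /hprod gconj !conjK gDl gNl (gC_T10 (p10_T10 u) (eT i)) subr0.
rewrite {1}uE gDl !gC_suml; congr (_ + _); apply: eq_bigr => i _; congr (_ * _);
  exact: gsym.
Qed.

Variable br : EC -> EC -> EC.
Hypothesis brE : forall x z, x \in T10 -> z \in T10 -> br x z = - TC x z.

(** Components of the torsion bracket; by skew-symmetry of T all components
    of T are, up to sign, entries of this array or their conjugates. *)
Definition farr i j k := hprod (br (e i) (e j)) (e k).

Lemma torsion_20 i j k : gC (TC (e i) (e j)) (conjv (e k)) = - farr i j k.
Proof. by rewrite /farr /hprod brE// gNl opprK. Qed.

Lemma torsion_02 i j k : gC (TC (conjv (e i)) (conjv (e j))) (e k) = - (farr i j k)^*.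
Proof.
by have := gconj (TC (e i) (e j)) (conjv (e k)); rewrite conjK TCconj torsion_20 rmorphN => <-.
Qed.

(** Skew-symmetry moves the conjugate vector to the last place. *)
Lemma torsion_11 i j k : gC (TC (e i) (conjv (e j))) (e k) = farr i k j.
Proof. by rewrite Tskew torsion_20 opprK. Qed.

Lemma torsion_11_conj i j k : gC (TC (e i) (conjv (e j))) (conjv (e k)) = - (farr j k i)^*.
Proof. by rewrite TN gNl Tskew opprK torsion_02. Qed.

Lemma farrN i j k : farr i j k = - farr j i k.
Proof. by apply: oppr_inj; rewrite -!torsion_20 TN gNl. Qed.

Let Rfun x y z := RC x (conjv y) z.
Definition rarr i j k l := hprod (Rfun (e i) (e j) (e k)) (e l).

(** By skew-symmetry this is the pairing of T (e_i, conj e_j) with T (e_k,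
    conj e_l). *)
Lemma torsion_torsion_11 i j k l : gC (TC (TC (e i) (conjv (e j))) (e k)) (conjv (e l)) =
  - xarr farr i j k l - xarr farr k l i j.
Proof.
have -> : gC (TC (TC (e i) (conjv (e j))) (e k)) (conjv (e l)) =
    gC (TC (e i) (conjv (e j))) (TC (e k) (conjv (e l))).
  by rewrite TN gNl Tskew opprK gsym.
rewrite frame_pair /xarr -!sumrN; congr (_ + _); apply: eq_bigr => m _.
  by rewrite torsion_11 torsion_11_conj mulNr.
by rewrite torsion_11 torsion_11_conj mulrN mulrC.
Qed.

Lemma torsion_torsion_20 i k j l : gC (TC (TC (e i) (e k)) (conjv (e j))) (conjv (e l)) =
  yarr farr i k j l.
Proof.
have -> : gC (TC (TC (e i) (e k)) (conjv (e j))) (conjv (e l)) =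
    gC (TC (e i) (e k)) (TC (conjv (e j)) (conjv (e l))).
  by rewrite TN gNl Tskew opprK gsym.
rewrite frame_pair [X in _ + X]big1 ?addr0; last first.
  by move=> m _; rewrite gC_T10 ?mul0r//; exact: TC_T10.
by apply: eq_bigr => m _; rewrite torsion_20 torsion_02 mulrNN.
Qed.

(** The first Bianchi identity for e_i, conj e_j, e_k; the term R (e_k, e_i)
    conj e_j is of type (0,1) and disappears. *)
Lemma rarr_bianchi i j k l : rarr i j k l - rarr k j i l =
  xarr farr k j i l + xarr farr i l k j - xarr farr i j k l - xarr farr k l i j
  - yarr farr i k j l.
Proof.
have := congr1 (fun v => gC v (conjv (e l))) (Rbianchi (e i) (conjv (e j)) (e k)).
rewrite !gDl torsion_torsion_11.
have -> : gC (RC (e k) (e i) (conjv (e j))) (conjv (e l)) = 0.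
  rewrite -[RC _ _ _]conjK RCconj conjK gC_T01//; exact: RC_T10.
rewrite addr0 [RC (conjv _) _ _]RN gNl.
rewrite [TC (conjv (e j)) (e k)]TN TNl gNl torsion_torsion_11.
rewrite [TC (e k) (e i)]TN TNl gNl torsion_torsion_20; exact: bianchi_arith.
Qed.

Lemma rarr_conj i j k l : (rarr i j k l)^* = rarr j i l k.
Proof.
rewrite /rarr /hprod /Rfun gconj conjK RCconj conjK Rskew RN gNr opprK gsym.
by [].
Qed.

(** Conjugate of the previous identity. *)
Lemma rarr_bianchi' i j k l : rarr i j k l - rarr i l k j =
  xarr farr k j i l + xarr farr i l k j - xarr farr i j k l - xarr farr k l i j
  - yarr farr i k j l.
Proof.
rewrite -[LHS]conjCK rmorphB /= !rarr_conj rarr_bianchi.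
by rewrite conj_sum5 !xarrJ yarrJ.
Qed.

Variable Rc : EC -> EC -> EC -> EC.
Local Notation A := (jpart JC TC).
Hypothesis Rc1 : forall v w, linear (fun u => Rc u v w).
Hypothesis Rc2 : forall u w, linear (fun v => Rc u v w).
Hypothesis Rc3 : forall u v, linear (Rc u v).
Hypothesis RcE : forall u v w, Rc u v w =
  RC u v w - A (TC u v) w + A u (A v w) - A v (A u w).
Hypothesis Hc0 : forall x, x \in T10 -> gC (Rc x (conjv x) x) (conjv x) = 0.

Let AE u z : z \in T10 -> A u z = p10 (TC u z).
Proof. by move=> /T10J zJ; rewrite /jpart zJ TZr JZ. Qed.

Let p10_id z : z \in T10 -> p10 z = z.
Proof.
move=> /T10J zJ; rewrite /p10 zJ scalerA ii scaleN1r opprK.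
by rewrite -mulr2n -[z *+ 2]scaler_nat scalerA mulVf// scale1r.
Qed.

Let gp10 v w : w \in T10 -> gC (p10 v) (conjv w) = gC v (conjv w).
Proof.
move=> wT; rewrite -[in RHS](subrK (p10 v) v) gDl -[v - _]conjK.
by rewrite (gC_T01 (p01_T10 v) wT) add0r.
Qed.

(** Components of the Chern curvature. *)
Definition rcarr i j k l := hprod (Rc (e i) (conjv (e j)) (e k)) (e l).

Lemma rcarrE i j k l : rcarr i j k l =
  rarr i j k l + xarr farr i j k l + xarr farr k l i j - xarr farr k j i l + yarr farr i k j l.
Proof.
have t1 : gC (A (TC (e i) (conjv (e j))) (e k)) (conjv (e l)) =
    - xarr farr i j k l - xarr farr k l i j by rewrite AE// gp10// torsion_torsion_11.
(* A maps vectors of type (1,0) to the (1,0)-part of T, which is expanded in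
   the frame *)
have t2 : gC (A (e i) (A (conjv (e j)) (e k))) (conjv (e l)) = - xarr farr k j i l.
  rewrite [A (conjv _) _]AE// AE// gp10//.
  rewrite (eE (p10_T10 (TC (conjv (e j)) (e k)))) (lin_sum (TCr _)) gC_suml.
  rewrite /xarr -sumrN; apply: eq_bigr => m _.
  by rewrite /hprod gp10// torsion_20 [TC (conjv _) _]TN gNl torsion_11_conj opprK mulrN.
have t3 : gC (A (conjv (e j)) (A (e i) (e k))) (conjv (e l)) = - yarr farr i k j l.
  rewrite [A (e i) _]AE// p10_id ?TC_T10// AE ?TC_T10// gp10//.
  by rewrite TN gNl torsion_torsion_20.
have gsplit a b c d w : gC (a - b + c - d) w = gC a w - gC b w + gC c w - gC d w.
  by rewrite gDl gDl gDl !gNl.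
rewrite /rcarr /hprod RcE.
rewrite gsplit.
transitivity (rarr i j k l - (- xarr farr i j k l - xarr farr k l i j)
  + (- xarr farr k j i l) - (- yarr farr i k j l)); last exact: curvature_signs.
by congr (_ - _ + _ - _); [exact: t1|exact: t2|exact: t3].
Qed.

(** H^c = 0 says that the components of the Chern curvature, symmetrised in
    i, k and in j, l, vanish. The Bianchi identities express all four
    curvature terms through the first one. *)
Lemma rarr_formula i j k l : 4 * rarr i j k l =
  xarr farr k j i l + xarr farr i l k j - 3 * xarr farr i j k l
  - 3 * xarr farr k l i j - 2 * yarr farr i k j l.
Proof.
have y1 a b c d : yarr farr b a c d = - yarr farr a b c d.
  by rewrite /yarr -sumrN; apply: eq_bigr => m _; rewrite farrN mulNr.
have y2 a b c d : yarr farr a b d c = - yarr farr a b c d.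
  by rewrite /yarr -sumrN; apply: eq_bigr => m _; rewrite [farr d c m]farrN rmorphN mulrN.
have h1 := rarr_bianchi i j k l; have h2 := rarr_bianchi' i j k l.
have h3 := rarr_bianchi' k j i l; rewrite y1 in h3.
have h4 : rcarr i j k l + rcarr k j i l + rcarr i l k j + rcarr k l i j = 0.
  apply: (@polarization _ EC (fun u => u \in T10)
    (fun x y z w => hprod (Rc x (conjv y) z) w)).
  - by move=> u v a uT vT; rewrite memvD// memvZ.
  - move=> u v a y z w; rewrite /hprod -gZl -gDl; congr (gC _ _).
    by rewrite addrC Rc1 addrC.
  - move=> u v a y z w; rewrite /hprod -gZl -gDl; congr (gC _ _).
    by rewrite addrC Rc3 addrC.
  - move=> u v a y z w; rewrite /hprod -gZl -gDl; congr (gC _ _).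
    by rewrite conjD conjZ addrC Rc2 addrC.
  - by move=> u v a x y z; rewrite /hprod conjD conjZ gDr gZr.
  - exact: Hc0.
  - exact: eT.
  - exact: eT.
  - exact: eT.
  - exact: eT.
have z : yarr farr k i l j = yarr farr i k j l by rewrite y1 y2 opprK.
rewrite !rcarrE (y1 i k j l) (y2 i k j l) z in h4.
exact: curvature_arith h1 h2 h3 h4.
Qed.

End FrameArrays.

(** * Powers of a two-form as Pfaffian sums *)

(** The positions 0, .., 2k - 1 are grouped into pairs 2j, 2j + 1. *)
Section Pairs.
Variable k : nat.
Lemma pos0_proof (j : 'I_k) : (j * 2 < k * 2)%N. Proof. by rewrite ltn_mul2r ltn_ord. Qed.
Lemma pos1_proof (j : 'I_k) : (j * 2 + 1 < k * 2)%N. Proof. by have := ltn_ord j; lia. Qed.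
Definition pos0 j := Ordinal (pos0_proof j).
Definition pos1 j := Ordinal (pos1_proof j).

Lemma pos0_inj : injective pos0.
Proof. by move=> i j /(congr1 val) /= e; apply: val_inj => /=; lia. Qed.
Lemma pos1_inj : injective pos1.
Proof. by move=> i j /(congr1 val) /= e; apply: val_inj => /=; lia. Qed.
Lemma pos01 i j : pos0 i != pos1 j.
Proof. by apply/eqP => /(congr1 val) /=; lia. Qed.

Lemma pos_cases (a : 'I_(k * 2)) : exists j, a = pos0 j \/ a = pos1 j.
Proof.
have aj : (a %/ 2 < k)%N by have := ltn_ord a; lia.
exists (Ordinal aj); have := divn_eq a 2.
have : (a %% 2 < 2)%N by rewrite ltn_mod.
case: (a %% 2)%N => [|[|//]] _ e; [left|right]; apply: val_inj => /=; lia.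
Qed.
End Pairs.

Section Pfaffian.
Variable R : numFieldType.

Definition pairprod k (T : Type) (A : T -> T -> R) (u : 'I_(k * 2) -> T) : R :=
  \prod_(j < k) A (u (pos0 j)) (u (pos1 j)).

(** k! 2^k times the Pfaffian of the matrix A (u a, u b) when A is
    alternating. *)
Definition pfsum k (T : Type) (A : T -> T -> R) (u : 'I_(k * 2) -> T) : R :=
  \sum_(s : 'S_(k * 2)) (-1) ^+ s * pairprod A (fun i => u (s i)).

Lemma sum_lift_perm n (F : 'S_n.+1 -> R) :
  \sum_s F s = \sum_(j < n.+1) \sum_(t : 'S_n) F (lift_perm ord0 j t).
Proof.
rewrite pair_big /=.
pose f (p : 'I_n.+1 * 'S_n) := lift_perm ord0 p.1 p.2.
have f_inj : injective f.
  move=> [j t] [j' t'] /= /permP e.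
  have ej : j = j' by have := e ord0; rewrite /f !lift_perm_id.
  subst j'; congr (_, _); apply/permP => i.
  by have := e (lift ord0 i); rewrite /f !lift_perm_lift => /lift_inj.
have fb : bijective f.
  apply: inj_card_bij => //.
  by rewrite card_prod card_ord !card_Sn factS.
by rewrite (reindex f) //=; exact: onW_bij.
Qed.

Lemma pairprodS k (T : Type) (A : T -> T -> R) (u : 'I_(k.+1 * 2) -> T) :
  pairprod A u = A (u ord0) (u (lift ord0 ord0)) *
    pairprod A (fun i : 'I_(k * 2) => u (lift ord0 (lift ord0 i))).
Proof.
rewrite /pairprod big_ord_recl; congr (A (u _) (u _) * _); try exact: val_inj.
by apply: eq_bigr => j _; congr (A (u _) (u _)); apply: val_inj => /=;
  rewrite /bump /=; lia.
Qed.

Lemma perm_sumK n (t : 'S_n) (F : 'S_n -> R) : \sum_s F (t * s)%g = \sum_s F s.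
Proof. by rewrite [RHS](reindex_inj (mulgI t)). Qed.

Lemma sign_lift_perm n (a : 'I_n.+1) (t : 'S_n) :
  (-1) ^+ lift_perm ord0 a t = (-1) ^+ a * (-1) ^+ t :> R.
Proof. by rewrite odd_lift_perm /= signr_addb signr_odd. Qed.

(** Expansion according to the values a and lift a b of a permutation at the
    positions 0 and 1; the two removed indices contribute the sign
    (-1)^(a+b). *)
Lemma pfsumS k (T : Type) (A : T -> T -> R) (X : T -> T -> R) (u : 'I_(k.+1 * 2) -> T) :
  \sum_(s : 'S_(k.+1 * 2)) (-1) ^+ s * (X (u (s ord0)) (u (s (lift ord0 ord0))) *
    pairprod A (fun i : 'I_(k * 2) => u (s (lift ord0 (lift ord0 i))))) =
  \sum_(a < (k * 2).+2) \sum_(b < (k * 2).+1) (-1) ^+ (a + b) *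
    (X (u a) (u (lift a b)) * pfsum A (fun i : 'I_(k * 2) => u (lift a (lift b i)))).
Proof.
rewrite (@sum_lift_perm (k * 2).+1); apply: eq_bigr => a _.
rewrite (@sum_lift_perm (k * 2)); apply: eq_bigr => b _.
rewrite /pfsum !mulr_sumr; apply: eq_bigr => t _.
rewrite !lift_perm_id !lift_perm_lift !lift_perm_id.
rewrite sign_lift_perm sign_lift_perm exprD.
rewrite -![in LHS]mulrA -![in RHS]mulrA; do 2 congr (_ * _).
rewrite mulrCA; congr (_ * (_ * _)).
by apply: eq_bigr => j _; rewrite !lift_perm_lift.
Qed.

(** The index a occurs in some factor of every product. *)
Lemma pfsum_isolated k (T : Type) (A : T -> T -> R) (u : 'I_(k * 2) -> T) a :
  (forall b, A (u a) (u b) = 0) -> (forall b, A (u b) (u a) = 0) -> pfsum A u = 0.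
Proof.
move=> Al Ar; rewrite /pfsum big1 // => s _; rewrite /pairprod.
have [j e] := pos_cases (s^-1 a)%g.
have sa : s (s^-1 a)%g = a by rewrite permKV.
by rewrite (bigD1 j) //=; case: e => e; rewrite -e sa ?Al ?Ar mul0r mulr0.
Qed.

(** The other element of the pair {2m, 2m + 1}. *)
Definition partner (a : nat) : nat := if odd a then a.-1 else a.+1.

Variable kappa : R.

(** The matrix of A on u consists of diagonal blocks with rows (0, kappa) and
    (- kappa, 0). *)
Definition standard k (T : Type) (A : T -> T -> R) (u : 'I_(k * 2) -> T) :=
  forall a b : 'I_(k * 2), A (u a) (u b) =
    if b == partner a :> nat then (-1) ^+ a * kappa else 0.

Lemma partner_parity (a : nat) :
  (exists2 m, a = m.*2 & partner a = m.*2.+1) \/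
  (exists2 m, a = m.*2.+1 & partner a = m.*2).
Proof.
have := odd_double_half a; rewrite /partner; case oa: (odd a) => /= ea.
  by right; exists a./2 => //; rewrite -[in LHS]ea.
by left; exists a./2 => //; rewrite -[in LHS]ea.
Qed.

Lemma partnerK a : partner (partner a) = a.
Proof.
have [[m -> ->]|[m -> ->]] := partner_parity a; rewrite /partner /=.
  by rewrite odd_double.
by rewrite odd_double.
Qed.

Lemma partner_lt k (a : 'I_(k * 2)) : (partner a < k * 2)%N.
Proof.
by have := ltn_ord a; have [[m -> ->]|[m -> ->]] := partner_parity a; lia.
Qed.

Definition partner_ord k (a : 'I_(k * 2)) := Ordinal (partner_lt a).

(** The value of the sum on a standard family: kappa^k times the number k!
    2^k of permutations that respect the pairs. *)
Definition pfaffian_const k : R := kappa ^+ k * \prod_(j < k) (j.+1 * 2)%:R.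

Lemma partner_bump (a : nat) : bump a (a - odd a) = partner a.
Proof.
rewrite /bump; have [[m -> ->]|[m -> ->]] := partner_parity a.
  by rewrite odd_double subn0 leqnn.
by rewrite /= odd_double subn1 /= ltnn.
Qed.

(** Removing the pair of a from 0, 1, .. shifts the larger numbers by two; a
    - odd a is the index which lift a sends to the partner of a. *)
Lemma bump2 (a c : nat) : let b := (a - odd a)%N in
  bump a (bump b c) = (if c < b then c else c.+2)%N.
Proof.
move=> b; rewrite /bump; have := odd_double_half a; rewrite /b => ea.
case: (leqP (a - odd a) c) => hb /=; case: leqP => h1; move: ea hb h1;
by case: (odd a) => /=; lia.
Qed.

Lemma partner_bump2 (a c d : nat) : let b := (a - odd a)%N in
  (bump a (bump b d) == partner (bump a (bump b c))) = (d == partner c).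
Proof.
move=> b; rewrite !bump2 -/b.
have ob : odd b = false.
  by rewrite /b -{1}(odd_double_half a) addKn odd_double.
have := odd_double_half b; rewrite ob add0n => eb; rewrite /partner.
have := odd_double_half c; case: ltnP => hc; case: ltnP => hd; rewrite /= ?negbK;
case oc: (odd c) => /= ec; apply/eqP/eqP; lia.
Qed.

(** In a standard family only the removal of a whole pair leaves a nonzero
    Pfaffian sum: otherwise a partner is left behind without its mate. *)
Lemma standard_pair_sum k (T : Type) (A X : T -> T -> R) (u : 'I_(k.+1 * 2) -> T) :
  standard A u ->
  (forall v : 'I_(k * 2) -> T, standard A v -> pfsum A v = pfaffian_const k) ->
  \sum_(a < (k * 2).+2) \sum_(b < (k * 2).+1) (-1) ^+ (a + b) *
    (X (u a) (u (lift a b)) * pfsum A (fun i : 'I_(k * 2) => u (lift a (lift b i)))) =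
  pfaffian_const k * \sum_(a < k.+1 * 2) (-1) ^+ a * X (u a) (u (partner_ord a)).
Proof.
move=> st IH; rewrite mulr_sumr; apply: eq_bigr => a _.
have b0lt : (a - odd a < (k * 2).+1)%N.
  have := ltn_ord a; have := odd_double_half a.
  by case: (odd a) => /= e l; rewrite ?subn0; move: e l; lia.
pose b0 := Ordinal b0lt.
have lb0 : lift a b0 = partner_ord (k := k.+1) a.
  by apply: val_inj; exact: partner_bump.
rewrite (bigD1 b0) //= big1 ?addr0; last first.
  move=> b bb0; have pa : partner_ord (k := k.+1) a != lift a b.
    by rewrite -lb0; apply: contraNneq bb0 => /lift_inj ->.
  have [c e] : exists c, partner_ord (k := k.+1) a = lift a (lift b c).
    have := neq_lift a b0; rewrite lb0 => /unlift_some[b' e _].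
    have bb' : b != b' by apply: contraNneq pa => ->; rewrite e.
    by have /unlift_some[c e' _] := bb'; exists c; rewrite e e'.
  have la d : lift a (lift b d) = a :> nat -> False.
    by move=> /val_inj /eqP; rewrite eq_sym (negPf (neq_lift _ _)).
  rewrite (pfsum_isolated (a := c)) ?mulr0// => d; rewrite st -e; case: ifP => // /eqP h.
    by case: (la d); rewrite h partnerK.
  by case: (la d); rewrite -[LHS]partnerK -h /= partnerK.
rewrite lb0 IH; last first.
  move=> c d; rewrite st.
  have := partner_bump2 a c d; rewrite /= => ->; case: ifP => // _; congr (_ * _).
  rewrite bump2 -signr_odd -[RHS]signr_odd; congr (_ ^+ nat_of_bool _).
  by case: ifP => //= _; rewrite negbK.
have -> : (-1) ^+ (a + (a - odd a)) = (-1) ^+ a :> R.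
  rewrite exprD -[X in _ * X]signr_odd; have -> : odd (a - odd a) = false.
    by rewrite -{1}(odd_double_half a) addKn odd_double.
  by rewrite mulr1.
by rewrite mulrA mulrC.
Qed.

Lemma pfsum_standard k (T : Type) (A : T -> T -> R) (u : 'I_(k * 2) -> T) :
  standard A u -> pfsum A u = pfaffian_const k.
Proof.
elim: k u => [|k IH] u st.
  rewrite /pfsum /pfaffian_const (big_pred1 1%g) => [|s]; last first.
    by apply/esym/eqP/permP => -[].
  by rewrite odd_perm1 /pairprod !big_ord0 expr0 mulr1.
rewrite /pfsum; under eq_bigr do rewrite pairprodS.
rewrite pfsumS standard_pair_sum//.
under eq_bigr do rewrite st eqxx mulrA -exprD addnn -signr_odd odd_double mul1r.
rewrite sumr_const card_ord /pfaffian_const exprS big_ord_recr /= -[_ *+ _]mulr_natr; ring.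
Qed.

End Pfaffian.

Lemma is_derive_prodf (R : realType) (V : normedModType R) m (h : 'I_m -> V -> R) x v
    (dh : 'I_m -> R) :
  (forall i, is_derive x v (h i) (dh i)) ->
  is_derive x v (fun y => \prod_i h i y) (\sum_i dh i * \prod_(j | j != i) h j x).
Proof.
elim: m h dh => [|m IH] h dh H.
  rewrite big_ord0; under eq_fun do rewrite big_ord0.
  exact: is_derive_cst.
under eq_fun do rewrite big_ord_recl.
have := is_derive_mulf (H ord0) (IH _ _ (fun i => H (lift ord0 i))).
rewrite big_ord_recl mulr_sumr; congr (is_derive _ _ _ (_ + _)).
  by congr (_ * _); rewrite [RHS]big_mkcond big_ord_recl /= mul1r.
apply: eq_bigr => i _; rewrite [X in _ = _ * X]big_mkcond big_ord_recl /= mulrCA.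
congr (_ * (_ * _)); rewrite big_mkcond; apply: eq_bigr => j _.
by rewrite (inj_eq lift_inj).
Qed.

Section LeibnizPfaffian.
Variables (R : numFieldType) (T : Type) (A : T -> T -> R).

(** The l-th factor of the product is exchanged with the first one by a
    permutation of the positions which is even, as it moves both elements of
    a pair. *)
Lemma pfsum_leibniz k (B : T -> T -> R) (u : 'I_(k.+1 * 2) -> T) :
  \sum_(s : 'S_(k.+1 * 2)) (-1) ^+ s * (\sum_l B (u (s (pos0 l))) (u (s (pos1 l))) *
    \prod_(j | j != l) A (u (s (pos0 j))) (u (s (pos1 j)))) =
  k.+1%:R * \sum_(s : 'S_(k.+1 * 2)) (-1) ^+ s * (B (u (s ord0)) (u (s (lift ord0 ord0))) *
    pairprod A (fun i : 'I_(k * 2) => u (s (lift ord0 (lift ord0 i))))).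
Proof.
under eq_bigr do rewrite mulr_sumr.
have natE (x : R) : k.+1%:R * x = \sum_(l < k.+1) x.
  by rewrite sumr_const card_ord mulr_natl.
rewrite exchange_big /= natE.
apply: eq_bigr => l _.
pose t := (tperm (pos0 ord0) (pos0 l) * tperm (pos1 ord0) (pos1 l))%g.
have t0 j : t (pos0 j) = pos0 (tperm ord0 l j).
  rewrite /t permM.
  have -> : tperm (pos0 ord0) (pos0 l) (pos0 j) = pos0 (tperm ord0 l j).
    by rewrite -(inj_tperm _ _ _ (@pos0_inj k.+1)).
  by rewrite tpermD// eq_sym pos01.
have t1 j : t (pos1 j) = pos1 (tperm ord0 l j).
  rewrite /t permM [tperm (pos0 _) _ _]tpermD ?pos01//.
  by rewrite -(inj_tperm _ _ _ (@pos1_inj k.+1)).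
have st : (-1) ^+ t = 1 :> R.
  rewrite /t odd_permM !odd_tperm (inj_eq (@pos0_inj _)) (inj_eq (@pos1_inj _)).
  by rewrite addbb.
clearbody t; rewrite -[LHS](perm_sumK t); apply: eq_bigr => s _.
rewrite odd_permM signr_addb st mul1r !permM t0 t1 tpermR.
congr (_ * (B (u (s _)) (u (s _)) * _)); try exact: val_inj.
rewrite (reindex_inj (@perm_inj _ (tperm ord0 l))) /=.
have e0 j : (tperm ord0 l j != l) = (j != ord0).
  by rewrite -[X in _ != X](tpermL ord0 l) (inj_eq perm_inj).
under eq_bigl do rewrite e0.
rewrite big_mkcond big_ord_recl /= mul1r /pairprod; apply: eq_bigr => j _.
rewrite !permM t0 t1 !tpermK.
by congr (A (u (s _)) (u (s _))); apply: val_inj => /=; rewrite /bump /=; lia.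
Qed.

Definition prepend k (v0 : T) (f : 'I_(k.+1 * 2) -> T) (i : 'I_(k.+1 * 2).+1) : T :=
  if unlift ord0 i is Some j then f j else v0.

Variable kappa : R.

(** Up to a power of 2 this is d (omega^(k+1)) on v0, f_0, f_1, .., with A =
    omega and D x y z the derivative of omega (y, z) in direction x. As v0 is
    orthogonal to all vectors, only terms in which v0 enters D survive: as
    direction of derivation (the summand i = 0), or as the first or second
    argument; the last two coincide by antisymmetry, which explains the
    coefficient 2. *)
Lemma alternating_leibniz k (D : T -> T -> T -> R) (v0 : T) (f : 'I_(k.+1 * 2) -> T) :
  standard kappa A f -> (forall a, A v0 (f a) = 0) -> (forall a, A (f a) v0 = 0) ->
  A v0 v0 = 0 -> (forall x y z, D x y z = - D x z y) ->
  \sum_(i < (k.+1 * 2).+1) (-1) ^+ i * \sum_(s : 'S_(k.+1 * 2)) (-1) ^+ s *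
    (\sum_l D (prepend v0 f i) (prepend v0 f (lift i (s (pos0 l))))
      (prepend v0 f (lift i (s (pos1 l)))) *
    \prod_(j | j != l) A (prepend v0 f (lift i (s (pos0 j))))
      (prepend v0 f (lift i (s (pos1 j))))) =
  k.+1%:R * (pfaffian_const kappa k * \sum_(a < k.+1 * 2) (-1) ^+ a *
    (D v0 (f a) (f (partner_ord a)) + D (f a) (f (partner_ord a)) v0 *+ 2)).
Proof.
move=> stf A0l A0r A00 DN; set v := prepend v0 f.
have v_0 : v ord0 = v0 by rewrite /v /prepend unlift_none.
have v_l a : v (lift ord0 a) = f a by rewrite /v /prepend liftK.
have A0 b : A v0 (v b) = 0 /\ A (v b) v0 = 0.
  by case: (unliftP ord0 b) => [j|] ->; rewrite ?v_l ?v_0 ?A0l ?A0r ?A00.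
have std (w : 'I_(k * 2) -> T) : standard kappa A w -> pfsum A w = pfaffian_const kappa k.
  exact: pfsum_standard.
pose X i y z := D (v i) y z.
under eq_bigr => i _.
  rewrite (pfsum_leibniz (X i) (fun a => v (lift i a))).
  rewrite (pfsumS A (X i) (fun a => v (lift i a))).
  over.
rewrite /=; under eq_bigr do rewrite mulrCA; rewrite -mulr_sumr; congr (_ * _).
rewrite big_ord_recl /= expr0 mul1r.
under [in X in X + _]eq_bigr do under eq_bigr do rewrite !v_l.
have -> : \sum_(a < (k * 2).+2) \sum_(b < (k * 2).+1) (-1) ^+ (a + b) *
    (X ord0 (f a) (f (lift a b)) *
      pfsum A (fun i : 'I_(k * 2) => v (lift ord0 (lift a (lift b i))))) =
    pfaffian_const kappa k * \sum_(a < k.+1 * 2) (-1) ^+ a * X ord0 (f a) (f (partner_ord a)).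
  rewrite -(standard_pair_sum (X ord0) stf std); apply: eq_bigr => a _; apply: eq_bigr => b _.
  by congr (_ * (_ * _)); rewrite /pfsum; apply: eq_bigr => s _; congr (_ * _);
    rewrite /pairprod; apply: eq_bigr => j _; rewrite !v_l.
(* terms in which v0 is an argument of the differentiated factor, with its
   two possible places combined *)
pose Y y z := D y z v0 *+ 2.
have -> : \sum_(c < (k * 2).+2) (-1) ^+ bump 0 c * \sum_(a < (k * 2).+2) \sum_(b < (k * 2).+1)
    (-1) ^+ (a + b) *
      (X (lift ord0 c) (v (lift (lift ord0 c) a)) (v (lift (lift ord0 c) (lift a b))) *
       pfsum A (fun i : 'I_(k * 2) => v (lift (lift ord0 c) (lift a (lift b i))))) =
    pfaffian_const kappa k * \sum_(a < k.+1 * 2) (-1) ^+ a * Y (f a) (f (partner_ord a)).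
  rewrite -(standard_pair_sum Y stf std); apply: eq_bigr => c _.
  have vc0 : v (lift (lift ord0 c) ord0) = v0 by rewrite -v_0; congr v; exact: val_inj.
  have vcl d : v (lift (lift ord0 c) (lift ord0 d)) = f (lift c d).
    by rewrite -v_l; congr v; apply: val_inj; rewrite /= /bump; lia.
  have pfl (b : 'I_(k * 2).+1) :
      pfsum A (fun i : 'I_(k * 2) => v (lift (lift ord0 c) (lift ord0 (lift b i)))) =
      pfsum A (fun i : 'I_(k * 2) => f (lift c (lift b i))).
    rewrite /pfsum; apply: eq_bigr => s _; congr (_ * _).
    by rewrite /pairprod; apply: eq_bigr => j _; rewrite !vcl.
  rewrite big_ord_recl /=.
  have -> : \sum_(d < (k * 2).+1) \sum_(b < (k * 2).+1) (-1) ^+ (bump 0 d + b) *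
      (X (lift ord0 c) (v (lift (lift ord0 c) (lift ord0 d)))
          (v (lift (lift ord0 c) (lift (lift ord0 d) b))) *
       pfsum A (fun i : 'I_(k * 2) =>
         v (lift (lift ord0 c) (lift (lift ord0 d) (lift b i))))) =
      \sum_(d < (k * 2).+1) (-1) ^+ d * (D (f c) v0 (f (lift c d)) *
        pfsum A (fun i : 'I_(k * 2) => f (lift c (lift d i)))).
    apply: eq_bigr => d _; rewrite big_ord_recl big1 ?addr0 => [|b _].
      have -> : lift (lift ord0 d) ord0 = ord0 :> 'I_(k * 2).+2 by exact: val_inj.
      rewrite vc0 vcl /X v_l DN addn0 /bump leq0n exprD expr1 mulN1r.
      rewrite !mulNr mulrN opprK.
      congr (_ * (_ * _)); rewrite /pfsum; apply: eq_bigr => s _; congr (_ * _).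
      have ll i : lift (lift ord0 d) (lift ord0 i) = lift ord0 (lift d i) :> 'I_(k * 2).+2.
        by apply: val_inj; rewrite /= /bump; lia.
      by rewrite /pairprod; apply: eq_bigr => j _; rewrite !ll !vcl.
    have [e he] : exists e, v (lift (lift ord0 c) (lift (lift ord0 d) (lift (lift ord0 b) e))) = v0.
      exists (Ordinal (leq_ltn_trans (leq0n b) (ltn_ord b))).
      by rewrite -v_0; congr v; apply: val_inj.
    rewrite (pfsum_isolated (a := e)) ?mulr0// => e'; rewrite he.
      by case: (A0 (lift (lift ord0 c) (lift (lift ord0 d) (lift (lift ord0 b) e')))).
    by case: (A0 (lift (lift ord0 c) (lift (lift ord0 d) (lift (lift ord0 b) e')))).
  rewrite -big_split mulr_sumr; apply: eq_bigr => b _ /=.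
  rewrite vc0 vcl pfl /X v_l /Y add0n -mulrDr -mulrDl mulrA -exprD.
  rewrite [D _ (f _) v0]DN /bump leq0n mulNrn -mulr2n -addnA exprD expr1 mulN1r.
  by rewrite !mulNr mulrN.
rewrite -mulrDr -big_split; congr (_ * _); apply: eq_bigr => a _ /=.
by rewrite -mulrDr /X v_0.
Qed.

End LeibnizPfaffian.

(** * Balanced metrics have trace-free torsion *)

Lemma sum_ord_pairs (V : zmodType) k (F : 'I_(k * 2) -> V) :
  \sum_(a < k * 2) F a = \sum_(j < k) (F (pos0 j) + F (pos1 j)).
Proof.
elim: k F => [|k IH] F; first by rewrite !big_ord0.
rewrite [RHS]big_ord_recl (@big_ord_recl _ _ _ (k * 2).+1) (@big_ord_recl _ _ _ (k * 2)).
rewrite addrA (IH (fun i => F (lift ord0 (lift ord0 i)))).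
congr (F _ + F _ + _); try exact: val_inj.
by apply: eq_bigr => j _; congr (F _ + F _); apply: val_inj; rewrite /= /bump; lia.
Qed.

Section WedgePower.
Variables (R : realType) (n : nat).
Local Notation E := 'rV[R]_(n + n).
Variables (w : Defs.form R n 2) (W : E -> E -> E -> R).
Hypothesis wW : forall x u, w x u = W x (u ord0) (u ord_max).

(** A permutation s of the 2k + 2 positions is multiplied by permutations t
    fixing the first two; summing over t cancels the factor (2k)! in the
    definition of the wedge product. *)
Lemma wedge_powE k x v : wedge_pow w k x v = 2^-1 ^+ k * pfsum (W x) v.
Proof.
elim: k v => [|k IH] v.
  rewrite /= /pfsum (big_pred1 1%g) => [|s]; last by apply/esym/eqP/permP => -[].
  by rewrite odd_perm1 /pairprod big_ord0 !expr0 !mulr1.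
(* extension of a permutation by the identity on the positions 0 and 1 *)
pose up2 (t : 'S_(k * 2)) : 'S_(k.+1 * 2) := lift_perm ord0 ord0 (lift_perm ord0 ord0 t).
have up0 t : up2 t ord0 = ord0 by exact: lift_perm_id.
have up1 t : up2 t (lift ord0 ord0) = lift ord0 ord0.
  by rewrite /up2 lift_perm_lift lift_perm_id.
have upS t i : up2 t (lift ord0 (lift ord0 i)) = lift ord0 (lift ord0 (t i)).
  by rewrite /up2 !lift_perm_lift.
have upN t : (-1) ^+ up2 t = (-1) ^+ t :> R.
  by rewrite /up2 !sign_lift_perm /= !mul1r.
clearbody up2.
have wE (s : 'S_(k.+1 * 2)) :
    (-1) ^+ s * (w x (fun i => v (s (lshift (k * 2) i))) *
      wedge_pow w k x (fun j => v (s (rshift 2 j)))) =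
    2^-1 ^+ k * \sum_t (-1) ^+ (up2 t * s)%g * pairprod (W x) (fun i => v ((up2 t * s)%g i)).
  rewrite IH wW /pfsum !mulr_sumr.
  apply: eq_bigr => t _; rewrite pairprodS !permM up0 up1 odd_permM signr_addb upN.
  have -> : @lshift 2 (k * 2) ord0 = ord0 by exact: val_inj.
  have -> : @lshift 2 (k * 2) ord_max = lift ord0 ord0 by exact: val_inj.
  have -> : pairprod (W x) (fun i => v (s (rshift 2 (t i)))) =
      pairprod (W x) (fun i : 'I_(k * 2) => v ((up2 t * s)%g (lift ord0 (lift ord0 i)))).
    apply: eq_bigr => j _; rewrite !permM !upS.
    by congr (W x (v (s _)) (v (s _))); apply: val_inj.
  by move: (_ ^+ s) (W x _ _) (_ ^+ k) (_ ^+ t) (pairprod _ _) => a b c d e; ring.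
rewrite /= /wedge (eq_bigr _ (fun s _ => wE s)) -mulr_sumr exchange_big /=.
under eq_bigr do rewrite (perm_sumK _ (fun s => (-1) ^+ s * pairprod (W x) (fun i => v (s i)))).
rewrite -/(pfsum (W x) v) sumr_const card_Sn natrM exprS.
have f0 : (k * 2)`!%:R != 0 :> R by rewrite pnatr_eq0 -lt0n fact_gt0.
move: (pfsum _ _) (_ ^+ k) f0 => p c f0; rewrite -[p *+ _]mulr_natl.
have -> : 2`!%:R = 2 :> R by [].
move: ((k * 2)`!%:R) f0 => F f0.
by field.
Qed.

Variables (dW : E -> E -> E -> R) (x : E).
Hypothesis W_derive : forall d a b, is_derive x d (fun y => W y a b : R) (dW d a b).

Lemma ext_d_wedge_pow k v : ext_d (wedge_pow w k) x v = 2^-1 ^+ k *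
  \sum_(i < (k * 2).+1) (-1) ^+ i * \sum_(s : 'S_(k * 2)) (-1) ^+ s *
    (\sum_l dW (v i) (v (lift i (s (pos0 l)))) (v (lift i (s (pos1 l)))) *
    \prod_(j | j != l) W x (v (lift i (s (pos0 j)))) (v (lift i (s (pos1 j))))).
Proof.
rewrite /ext_d mulr_sumr; apply: eq_bigr => i _; rewrite [RHS]mulrCA; congr (_ * _).
pose u (a : 'I_(k * 2)) := v (lift i a).
under eq_fun do rewrite (wedge_powE _ u) /pfsum.
have dP (s : 'S_(k * 2)) := is_derive_prodf
  (fun l => W_derive (v i) (u (s (pos0 l))) (u (s (pos1 l)))).
have dsum (r : seq 'S_(k * 2)) : is_derive x (v i)
    (fun y => \sum_(s <- r) (-1) ^+ s * pairprod (W y) (fun a => u (s a)) : R)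
    (\sum_(s <- r) (-1) ^+ s *
      (\sum_l dW (v i) (u (s (pos0 l))) (u (s (pos1 l))) *
       \prod_(j | j != l) W x (u (s (pos0 j))) (u (s (pos1 j))))).
  elim: r => [|s r IHr].
    by rewrite big_nil; under eq_fun do rewrite big_nil; exact: is_derive_cst.
  rewrite big_cons; under eq_fun do rewrite big_cons.
  have := is_derive_mulf (is_derive_cst ((-1) ^+ s : R) x (v i)) (dP s).
  by rewrite mul0r add0r => /is_deriveD /(_ IHr).
have := is_derive_mulf (is_derive_cst (2^-1 ^+ k : R) x (v i)) (dsum (index_enum _)).
by rewrite mul0r add0r => /@derive_val.
Qed.

(** For a standard family f orthogonal to v0 the exterior derivative of the
    power is a nonzero multiple of the sum of d omega (v0, f_2j, f_2j+1). *)
Lemma ext_d_wedge_pow_pairs k kappa v0 (f : 'I_(k.+1 * 2) -> E) :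
  kappa != 0 -> standard kappa (W x) f ->
  (forall a, W x v0 (f a) = 0) -> (forall a, W x (f a) v0 = 0) -> W x v0 v0 = 0 ->
  (forall d a b, dW d a b = - dW d b a) ->
  ext_d (wedge_pow w k.+1) x (prepend v0 f) = 0 ->
  \sum_j (dW v0 (f (pos0 j)) (f (pos1 j)) + dW (f (pos0 j)) (f (pos1 j)) v0 +
          dW (f (pos1 j)) v0 (f (pos0 j))) = 0.
Proof.
move=> k0 stf Wl Wr W0 dWN.
rewrite ext_d_wedge_pow (alternating_leibniz stf Wl Wr W0 dWN) => /eqP.
have pf0 : pfaffian_const kappa k != 0.
  by rewrite mulf_neq0 ?expf_neq0//; apply/prodf_neq0 => j _; rewrite pnatr_eq0 muln_eq0.
have h0 : (2^-1 : R) ^+ k.+1 != 0 by rewrite expf_neq0 ?invr_eq0 ?pnatr_eq0.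
rewrite mulf_eq0 (negPf h0) mulf_eq0 pnatr_eq0 mulf_eq0 (negPf pf0) /=.
rewrite sum_ord_pairs => /eqP S0; apply: (@mulfI _ (2%:R : R)); first by rewrite pnatr_eq0.
rewrite mulr0 -[RHS]S0 mulr_sumr; apply: eq_bigr => j _.
have e0 : (-1) ^+ (pos0 j) = 1 :> R by rewrite /= -signr_odd oddM andbF.
have e1 : (-1) ^+ (pos1 j) = -1 :> R by rewrite /= exprD e0 mul1r.
have p0 : partner_ord (pos0 j) = pos1 j.
  by apply: val_inj; rewrite /= /partner oddM andbF addn1.
have p1 : partner_ord (pos1 j) = pos0 j.
  by apply: val_inj; rewrite /= /partner oddD oddM andbF addn1.
rewrite e0 e1 p0 p1 (dWN v0 (f (pos1 j))) (dWN _ v0 (f (pos0 j))).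
by move: (dW _ _ _) (dW _ _ _) (dW _ _ _) => a b c; ring.
Qed.

End WedgePower.

(** The fundamental form is g (J ., .). The map gm is the covariant
    derivative of constant fields of a Hermitian connection with totally skew
    torsion. *)
Section FundamentalForm.
Variables (K : numFieldType) (U : zmodType) (g : U -> U -> K) (J : U -> U).
Variable gm : U -> U -> U.
Hypothesis gsym : forall a b, g a b = g b a.
Hypothesis gJJ : forall a b, g (J a) (J b) = g a b.
Hypothesis JK : forall a, J (J a) = - a.
Hypothesis gBl : forall a b c, g (a - b) c = g a c - g b c.
Hypothesis JB : forall a b, J (a - b) = J a - J b.
Hypothesis gmJ : forall a b, gm a (J b) = J (gm a b).
Local Notation T := (fun a b => gm a b - gm b a).
Hypothesis gskew : forall a b c, g (T a b) c = - g (T a c) b.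

Lemma form_Nl a b : g (- a) b = - g a b.
Proof.
have g0 : g 0 b = 0 by have := gBl 0 0 b; rewrite !subrr.
by rewrite -sub0r gBl g0 sub0r.
Qed.

Lemma form_Jr a b : g a (J b) = - g (J a) b.
Proof. by rewrite -gJJ JK gsym form_Nl gsym. Qed.

Lemma form_torr a b : g (T a b) b = 0.
Proof.
have := gskew a b b => /eqP; rewrite -subr_eq0 opprK -mulr2n -mulr_natl mulf_eq0.
by rewrite pnatr_eq0 => /eqP.
Qed.

Let w d a b := g (gm d (J a)) b + g (J a) (gm d b).

(** In terms of the torsion, d omega is the cyclic sum of g (J T (x, y), z).
    For the arguments z, p, J p the two terms containing T (z, p) and T (J p,
    z) are paired with p and J p themselves and vanish by skew-symmetry. *)
Lemma fundamental_form_cyclic z p : w z p (J p) + w p (J p) z + w (J p) z p =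
  g (J (T p (J p))) z.
Proof.
have e1 : g (gm z p) p = g (gm p z) p.
  by apply/eqP; rewrite -subr_eq0 -gBl form_torr.
have e2 : g (gm z p) p = g (gm (J p) z) (J p).
  rewrite -gJJ -gmJ; apply/eqP; rewrite -subr_eq0 -gBl; apply/eqP; exact: form_torr.
rewrite /w !gmJ !gJJ !JK JB JK gBl !form_Nl.
rewrite (gsym p (gm z p)) (gsym p (gm p z)) -e1.
rewrite (form_Jr (gm (J p) z) p) in e2.
have -> : g (J z) (gm (J p) p) = - g (J (gm (J p) p)) z.
  by rewrite -(gsym z) form_Jr opprK gsym.
have -> : g (J (gm (J p) z)) p = - g (gm z p) p by rewrite e2 opprK.
by move: (g (gm z p) p) (g (gm p p) z) (g (J (gm (J p) p)) z) => a b c; ring.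
Qed.

Variables (n : nat) (p : 'I_n -> U).
Hypothesis pO : forall i j, g (p i) (p j) = 2^-1 *+ (i == j).
Hypothesis pJ : forall i j, g (J (p i)) (p j) = 0.

(** The real orthogonal basis formed by the p_i and the J p_i. *)
Definition Jframe (s : bool) i := if s then J (p i) else p i.

Lemma form_Jframe s t i j :
  g (J (Jframe s i)) (Jframe t j) = if (i == j) && (s != t) then (-1) ^+ s * 2^-1 else 0.
Proof.
case: s; case: t; rewrite /= ?andbF ?andbT ?JK ?form_Nl ?gJJ ?pJ ?pO.
- by rewrite form_Jr pJ !oppr0.
- by rewrite expr1 mulN1r; case: eqP => _; rewrite ?oppr0.
- by rewrite mul1r; case: eqP.
- by [].
Qed.

End FundamentalForm.

Lemma partner_half a b : (b == partner a) = (a./2 == b./2) && (odd a != odd b).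
Proof.
have := odd_double_half b; have := odd_double_half a; rewrite /partner.
case: (odd a); case: (odd b) => /= ea eb; rewrite ?andbF ?andbT; lia.
Qed.

Section BalancedTrace.
Variables (R : realType) (k : nat).
Local Notation n := k.+2.
Local Notation E := 'rV[R]_(n + n).
Local Notation J := (mulmxr (@Jmx R n) : E -> E).
Variables (D : set E) (G : E -> 'M[R]_(n + n)) (Gb : christoffel R n).
Hypothesis smG : smooth_on D G.
Hypothesis Gsym : forall x, D x -> (G x)^T = G x.
Hypothesis GJ : forall x u v, D x ->
  metric_val G x (u *m Jmx) (v *m Jmx) = metric_val G x u v.
Hypothesis parGb : metric_parallel D G Gb.
Hypothesis parJb : complex_parallel D Gb.
Hypothesis bskew : forall x u v w, D x ->
  metric_val G x (torsion_at Gb x u v) w = - metric_val G x (torsion_at Gb x u w) v.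
Variable x : E.
Hypothesis Dx : D x.
Hypothesis bal : forall v, ext_d (wedge_pow (hermitian_form G) k.+1) x v = 0.
Variable p : 'I_n -> E.
Let g := metric_val G x.
Hypothesis pO : forall i j, g (p i) (p j) = 2^-1 *+ (i == j).
Hypothesis pJ : forall i j, g (J (p i)) (p j) = 0.

Let gsym a b : g a b = g b a. Proof. exact: (metric_val_sym Gsym a b Dx). Qed.
Let gJJ a b : g (J a) (J b) = g a b. Proof. exact: GJ. Qed.
Let JK a : J (J a) = - a. Proof. exact: JmxK. Qed.
Let gBl (a b c : E) : g (a - b) c = g a c - g b c.
Proof. by rewrite /g /metric_val !mulmxBl !mxE. Qed.
Let JB (a b : E) : J (a - b) = J a - J b. Proof. exact: mulmxBl. Qed.
Let gmJ a b : gam (Gb x) a (J b) = J (gam (Gb x) a b). Proof. exact: (gamJ a b parJb Dx). Qed.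
Let gskew a b c : g (tor (Gb x) a b) c = - g (tor (Gb x) a c) b.
Proof. by rewrite -!torsion_atE; exact: (bskew a b c Dx). Qed.

Let dW (d a b : E) : R := (J a *m dG G d x *m b^T) 0 0.
Let dWE d a b : dW d a b = g (gam (Gb x) d (J a)) b + g (J a) (gam (Gb x) d b).
Proof. exact: (metric_par smG parGb d (J a) b Dx). Qed.

Let Jr := form_Jr gsym gJJ JK gBl.

Let dWN d a b : dW d a b = - dW d b a.
Proof.
rewrite !dWE !gmJ opprD addrC; congr (_ + _).
  by rewrite gsym Jr.
by rewrite [g (J b) _]gsym Jr opprK.
Qed.

(** Evaluate d (omega^{n-1}) = 0 on a vector of the pair i and on all the
    other pairs. The missing summand j = i vanishes by skew-symmetry of the
    torsion. *)
Lemma balanced_real_trace s i :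
  \sum_j g (J (torsion_at Gb x (p j) (J (p j)))) (Jframe J p s i) = 0.
Proof.
set P := Jframe J p.
have PE := form_Jframe gsym gJJ JK gBl pO pJ.
have cyc := fundamental_form_cyclic gsym gJJ JK gBl JB gmJ gskew.
(* the pairs p_j, J p_j for j different from i, in order *)
pose f (a : 'I_(k.+1 * 2)) := P (odd a) (lift i (inord a./2)).
have f0 j : f (pos0 j) = p (lift i j).
  by rewrite /f /= oddM andbF muln2 doubleK inord_val.
have f1 j : f (pos1 j) = J (p (lift i j)).
  by rewrite /f /= oddD oddM andbF addn1 muln2 /= uphalf_double inord_val.
have half_lt (a : 'I_(k.+1 * 2)) : (a./2 < k.+1)%N.
  by have := ltn_ord a; rewrite -[in X in X -> _](odd_double_half a); lia.
have st : standard 2^-1 (fun a b => g (J a) b) f.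
  move=> a b; rewrite PE partner_half (inj_eq lift_inj) -val_eqE /= !inordK//.
  by rewrite signr_odd.
have W0 a : g (J (P s i)) (f a) = 0.
  by rewrite PE (negPf (neq_lift _ _)).
have W0' a : g (J (f a)) (P s i) = 0.
  by rewrite PE eq_sym (negPf (neq_lift _ _)).
have W00 : g (J (P s i)) (P s i) = 0 by rewrite PE !eqxx.
pose W y a b := metric_val G y (J a) b.
have WE y u : hermitian_form G y u = W y (u ord0) (u ord_max) by [].
have dWd d a b : is_derive x d (fun y => W y a b : R) (dW d a b).
  exact: is_derive_metricc (is_derive_G smG d Dx).
have h0 : 2^-1 != 0 :> R by rewrite invr_eq0 pnatr_eq0.
have := ext_d_wedge_pow_pairs WE dWd h0 st W0 W0' W00 dWN (bal _).
rewrite (bigD1_ord i) //= => H.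
rewrite [X in X + _](_ : _ = 0) ?add0r.
  rewrite -[RHS]H; apply: eq_bigr => j _; rewrite f0 f1 !dWE torsion_atE.
  exact/esym/cyc.
rewrite torsion_atE /P /Jframe; case: (s).
  have tN a b : tor (Gb x) a b = - tor (Gb x) b a by rewrite /tor opprB.
  by rewrite gJJ tN (form_Nl gBl) (form_torr gskew) oppr0.
by rewrite -[LHS]opprK -Jr (form_torr gskew) oppr0.
Qed.

End BalancedTrace.

Section RealFrame.
Variables (R : realType) (n : nat).
Local Notation C := (R[i]).
Local Notation E := 'rV[R]_(n + n).
Local Notation EC := 'rV[R[i]]_(n + n).
Local Notation emb := (map_mx (real_complex R)).
Local Notation conjv := (@conj_vec R n).
Local Notation J := (mulmxr (@Jmx R n) : E -> E).
Local Notation ic := ('i%C : C).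
Local Notation rc := (real_complex R).
Local Notation re := (map_mx (@complex.Re R)).
Variables (G : 'M[R]_(n + n)).
Local Notation g := (fun u v : E => (u *m G *m v^T) 0 0).
Local Notation gC := (gC G).
Hypothesis gsym : forall u v, g u v = g v u.
Hypothesis gJ : forall u v, g (J u) (J v) = g u v.

Let gJr (a b : E) : g a (J b) = - g (J a) b.
Proof.
rewrite -[LHS]gJ /= JmxK; move: (a *m _) => v.
by rewrite [(- b)^T]raddfN mulmxN mxE.
Qed.

Let gDl u v w : gC (u + v) w = gC u w + gC v w. Proof. exact: linfD (gC_linl G w) _ _. Qed.
Let gZl a u w : gC (a *: u) w = a * gC u w. Proof. exact: linfZ (gC_linl G w) _ _. Qed.
Let gDr u v w : gC w (u + v) = gC w u + gC w v. Proof. exact: linfD (gC_linr G w) _ _. Qed.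
Let gZr a u w : gC w (a *: u) = a * gC w u. Proof. exact: linfZ (gC_linr G w) _ _. Qed.

(** The real part of J z = i z determines the imaginary part of z. *)
Lemma T10_re (z : EC) : z \in T10 -> z = emb (re z) + (- ic) *: emb (J (re z)).
Proof.
rewrite mem_T10 => /eqP H.
have imE : map_mx (@complex.Im R) z = - J (re z).
  apply/rowP => j; have := congr1 (fun u : EC => complex.Re (u 0 j)) H.
  have -> : JC z = ic *: emb (J (map_mx (@complex.Im R) z)) + emb (J (re z)).
    by rewrite {1}(vec_reim z) addrC (@JC_lin R n) !JC_emb.
  rewrite !mxE; case: (z 0 j) => a b /=.
  by rewrite !mul0r !mul1r oppr0 !add0r => ->; rewrite opprK.
rewrite {1}(vec_reim z) imE scaleNr; congr (_ + _).
by rewrite map_mxN scalerN.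
Qed.

Lemma conj_T10_re z : z \in T10 -> conjv z = emb (re z) + ic *: emb (J (re z)).
Proof.
move=> zT; have zE : z = (- ic) *: emb (J (re z)) + emb (re z).
  by rewrite [RHS]addrC -T10_re.
rewrite [X in conjv X = _]zE; apply: (etrans (conjv_lin _ _ _)).
rewrite !conjv_emb [RHS]addrC.
congr (_ *: _ + _).
by apply/eqP; rewrite eq_complex /= oppr0 opprK !eqxx.
Qed.

Lemma gC_realparts (a b c d : E) (x y : C) :
  gC (emb a + x *: emb b) (emb c + y *: emb d) =
  rc (g a c) + y * rc (g a d) + x * (rc (g b c) + y * rc (g b d)).
Proof. by rewrite gDl gZl !gDr !gZr !gC_emb. Qed.

Lemma reim_inj (x y x' y' : R) :
  rc x + ic * rc y = rc x' + ic * rc y' -> x = x' /\ y = y'.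
Proof. by rewrite -(complexE (Complex x y)) -(complexE (Complex x' y')) => -[]. Qed.

Lemma hprod_realparts z w : z \in T10 -> w \in T10 -> hprod G z w =
  rc (2 * g (re z) (re w)) + ic * rc (- (2 * g (J (re z)) (re w))).
Proof.
move=> zT wT; rewrite /hprod {1}(T10_re zT) (conj_T10_re wT) gC_realparts gJ.
rewrite gJr.
move: (g (re z) (re w)) (g (J (re z)) (re w)) => a b.
rewrite !rmorphN !rmorphM rmorph_nat.
have ii : ic * ic = -1 by rewrite -expr2 sqr_i.
transitivity (2 * rc a - 2 * (ic * rc b) - (ic * ic + 1) * rc a); first by ring.
by rewrite ii addNr mul0r subr0; ring.
Qed.

Variable e : 'I_n -> EC.
Hypothesis eF : orthoframe (hprod G) T10 e.
Local Notation p := (fun i => re (e i)).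

(** Real and imaginary parts of the equations h (e_i, e_j) = delta_ij. *)
Lemma re_frame i j : g (p i) (p j) = 2^-1 *+ (i == j) /\ g (J (p i)) (p j) = 0.
Proof.
have [eT eO _] := eF; have := eO i j; rewrite hprod_realparts//.
move: (g _ _) (g _ _) => a b.
have -> : (i == j)%:R = rc (i == j)%:R + ic * rc 0 by rewrite rmorph_nat rmorph0 mulr0 addr0.
move: (i == j) => c H.
have [h1 h2] := reim_inj H.
split; last by move/eqP: h2; rewrite oppr_eq0 mulf_eq0 pnatr_eq0 => /eqP.
apply: (@mulfI _ (2 : R)); first by rewrite pnatr_eq0.
by rewrite h1; case: c {H h1} => /=; rewrite ?mulr0// mulr1n divff// pnatr_eq0.
Qed.

Variables (T : E -> E -> E) (TC : EC -> EC -> EC).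
Hypothesis TCl : forall v, linear (TC ^~ v).
Hypothesis TCr : forall u, linear (TC u).
Hypothesis TCe : forall a b, TC (emb a) (emb b) = emb (T a b).
Hypothesis TN : forall u v, T u v = - T v u.

(** T (p - i J p, p + i J p) = 2 i T (p, J p). *)
Lemma torsion_conj_pair z : z \in T10 ->
  TC z (conjv z) = (2 * ic) *: emb (T (re z) (J (re z))).
Proof.
move=> zT; rewrite {1}(T10_re zT) (conj_T10_re zT).
have Tl a u v w : TC (u + a *: v) w = TC u w + a *: TC v w.
  by rewrite addrC TCl addrC.
have Tr a u v w : TC w (u + a *: v) = TC w u + a *: TC w v.
  by rewrite addrC TCr addrC.
rewrite Tl !Tr !TCe; move: (re z) (J _) => a b.
have T0 u : T u u = 0.
  apply/rowP => j; have /eqP := congr1 (fun v : E => v 0 j) (TN u u); rewrite !mxE.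
  by rewrite -subr_eq0 opprK -mulr2n -mulr_natl mulf_eq0 pnatr_eq0 => /eqP.
rewrite !T0 (TN b a) !raddf0 add0r ?scaler0 addr0 map_mxN scalerN scaleNr opprK.
by rewrite mulr_natl -scalerMnl mulr2n.
Qed.

Hypothesis real_trace : forall s k, \sum_j g (J (T (p j) (J (p j)))) (Jframe J p s k) = 0.

Lemma balanced_trace k : \sum_j gC (TC (e j) (conjv (e j))) (e k) = 0.
Proof.
have [eT _ _] := eF.
have termE j : gC (TC (e j) (conjv (e j))) (e k) =
    2 * ic * (rc (g (J (T (p j) (J (p j)))) (J (p k))) + ic * rc (g (J (T (p j) (J (p j)))) (p k))).
  rewrite torsion_conj_pair// gZl; congr (_ * _).
  rewrite {1}(T10_re (eT k)); move: (T _ _) (re (e k)) => t q.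
  rewrite gDr gZr !gC_emb -[g (J t) (J q)]gJ gJ; congr (rc _ + _); first by rewrite gJ.
  by rewrite mulNr -mulrN -rmorphN gJr opprK.
under eq_bigr do rewrite termE.
rewrite -mulr_sumr big_split /= -mulr_sumr -!(raddf_sum rc).
by have := real_trace true k; have := real_trace false k; rewrite /Jframe /= => -> ->;
  rewrite !raddf0 mulr0 addr0 mulr0.
Qed.

End RealFrame.

(** * The torsion Lie algebra at a point *)

Section PointIdentities.
Variables (R : realType) (n : nat).
Local Notation E := 'rV[R]_(n + n).
Local Notation J := (mulmxr (@Jmx R n) : E -> E).
Variables (D : set E) (Gam : christoffel R n).
Hypothesis oD : open D.
Hypothesis smGam : forall a b, smooth_on D (fun x => Gam x a b).
Variable x : E.
Hypothesis Dx : D x.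

(** Expand with the J-linearity of the covariant derivative. *)
Lemma torJJ : complex_parallel D Gam -> forall u v, torsion_at Gam x (J u) (J v) =
  torsion_at Gam x u v + J (torsion_at Gam x (J u) v) + J (torsion_at Gam x u (J v)).
Proof.
move=> pJ u v; rewrite !torsion_atE /tor.
have JB (a b : E) : J (a - b) = J a - J b by exact: mulmxBl.
rewrite !(gamJ _ _ pJ Dx) !JB.
rewrite -[J (J (gam _ u v))]/(_ *m Jmx *m Jmx) -[J (J (gam _ v u))]/(_ *m Jmx *m Jmx) !JmxK.
move: (gam _ u v) (gam _ v u) (J _) (J _) => a b c d.
by apply/rowP => j; rewrite !mxE; ring.
Qed.

Lemma gam_linc (a : R) (b c d : 'I_(n + n) -> 'I_(n + n) -> E) u v :
  (forall i j, d i j = a *: b i j + c i j) -> gam d u v = a *: gam b u v + gam c u v.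
Proof.
move=> H; rewrite /gam scaler_sumr -big_split; apply: eq_bigr => i _ /=.
rewrite scaler_sumr -big_split; apply: eq_bigr => j _ /=.
by rewrite H scalerDr !scalerA mulrC.
Qed.

Lemma dgam_lin a u u' v w :
  gam (dgam Gam (a *: u + u') x) v w = a *: gam (dgam Gam u x) v w + gam (dgam Gam u' x) v w.
Proof.
apply: gam_linc => i j; have df := smGam i j [::] Dx.
by rewrite /dgam /= !deriveE// linearP.
Qed.

Lemma curvature_lin1 v w : linear (fun u => curvature_at Gam x u v w).
Proof.
have L : linear (fun u => curv Gam x u v w).
  apply: lin_add; last first.
    by apply/lin_opp/(lin_comp (gam_linr (Gam x) v)); exact: gam_linl.
  apply: lin_add; last exact: gam_linl.
  apply: lin_add; last by apply/lin_opp; exact: gam_linl.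
  by move=> a u u'; exact: dgam_lin.
by move=> a u u'; rewrite !(curvature_atE smGam)//; exact: L.
Qed.

Lemma curvature_antisym u v w : curvature_at Gam x u v w = - curvature_at Gam x v u w.
Proof.
rewrite !(curvature_atE smGam)// /curv.
by rewrite !opprD !opprK (ACl (2*1*4*3)%AC).
Qed.

Lemma curvature_lin2 u w : linear (fun v => curvature_at Gam x u v w).
Proof.
move=> a v v'; rewrite !(curvature_antisym u).
exact: (lin_opp (curvature_lin1 u w)).
Qed.

Lemma curvature_lin3 u v : linear (curvature_at Gam x u v).
Proof.
have L : linear (curv Gam x u v).
  apply: lin_add; last by apply/lin_opp/(lin_comp (gam_linr _ v)); exact: gam_linr.
  apply: lin_add; last by apply: (lin_comp (gam_linr _ u)); exact: gam_linr.
  apply: lin_add; first exact: gam_linr.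
  by apply/lin_opp; exact: gam_linr.
by move=> a w w'; rewrite !(curvature_atE smGam)//; exact: L.
Qed.

Lemma curvature_J : complex_parallel D Gam -> forall u v w,
  curvature_at Gam x u v (J w) = J (curvature_at Gam x u v w).
Proof.
move=> pJ u v w; rewrite !(curvature_atE smGam)// /curv.
have dJ a b : gam (dgam Gam a x) b (J w) = J (gam (dgam Gam a x) b w).
  have H := is_derive_mulmxr Jmx (is_derive_gamc smGam a b w Dx).
  have {}H := is_derive_open oD Dx (fun y Dy => esym (gamJ b w pJ Dy)) H.
  rewrite -[LHS](@derive_val _ _ _ _ _ _ _ (is_derive_gamc smGam a b (J w) Dx)).
  exact: (@derive_val _ _ _ _ _ _ _ H).
have gJJ a b : gam (Gam x) a (gam (Gam x) b (J w)) = J (gam (Gam x) a (gam (Gam x) b w)).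
  exact: etrans (congr1 _ (gamJ b w pJ Dx)) (gamJ a (gam (Gam x) b w) pJ Dx).
have J4 (a b c d a' b' c' d' : E) : a' = J a -> b' = J b -> c' = J c -> d' = J d ->
    a' - b' + c' - d' = J (a - b + c - d).
  by move=> -> -> -> ->; rewrite [RHS]mulmxBl mulmxDl mulmxBl.
exact: J4 (dJ u v) (dJ v u) (gJJ u v) (gJJ v u).
Qed.

End PointIdentities.

Section DimT10.
Variables (R : realType) (n : nat).
Local Notation C := (R[i]).
Local Notation EC := 'rV[R[i]]_(n + n).

(** The vectors of type (1,0) are the pairs (a, - i a). *)
Lemma dim_T10 : \dim (T10 : {vspace EC}) = n.
Proof.
pose M : 'M[C]_(n, n + n) := row_mx 1%:M (- 'i%C)%:M.
pose f : 'Hom('rV[C]_n, EC) := linfun (mulmxr M).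
have fE a : f a = row_mx a (- 'i%C *: a).
  by rewrite lfunE /= /M mul_mx_row mulmx1 mul_mx_scalar.
have JE (a b : 'rV[C]_n) : JC (row_mx a b) = row_mx (- b) a.
  rewrite /JC /Jmx map_block_mx !map_mx0 map_mxN map_mx1 mul_row_block.
  by rewrite !mulmx0 mulmxN !mulmx1 add0r addr0.
have ii : ('i%C : C) * 'i%C = -1 by rewrite -expr2 sqr_i.
have <- : (f @: fullv)%VS = T10.
  apply/vspaceP => z; apply/idP/idP.
    move=> /memv_imgP[a _ ->]; rewrite mem_T10 fE JE scale_row_mx scalerA mulrN ii opprK scale1r.
    by rewrite scaleNr opprK.
  rewrite mem_T10 -(hsubmxK z) JE scale_row_mx => /eqP /eq_row_mx[_ e].
  by apply/memv_imgP; exists (lsubmx z); rewrite ?memvf// fE e scalerA mulNr ii opprK scale1r.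
rewrite limg_dim_eq ?dimvf ?dim_matrix; first exact: mul1n.
apply/eqP; rewrite -subv0; apply/subvP => a /memv_capP[_]; rewrite memv_ker fE => /eqP.
by rewrite -row_mx0 => /eq_row_mx[-> _]; rewrite mem0v.
Qed.

End DimT10.

Lemma map_form (K : comNzRingType) (f : {rmorphism K -> K}) m (A : 'M[K]_m) (u v : 'rV[K]_m) :
  map_mx f A = A -> f ((u *m A *m v^T) 0 0) = (map_mx f u *m A *m (map_mx f v)^T) 0 0.
Proof. by move=> fA; rewrite -{2}fA map_trmx -!map_mxM [RHS]mxE. Qed.

(** T and Rm are torsion and curvature of the Bismut connection at a point,
    Td and Rd those of the Chern connection, G the metric there. *)
Section PointwiseSplit.
Variables (R : realType) (n : nat).
Local Notation C := (R[i]).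
Local Notation E := 'rV[R]_(n + n).
Local Notation EC := 'rV[R[i]]_(n + n).
Local Notation emb := (map_mx (real_complex R)).
Local Notation conjv := (@conj_vec R n).
Local Notation J := (mulmxr (@Jmx R n) : E -> E).
Local Notation JC := (@JC R n).
Variables (G : 'M[R]_(n + n)) (T Td : E -> E -> E) (Rm Rd : E -> E -> E -> E).
Local Notation g := (fun u v : E => (u *m G *m v^T) 0 0).
Local Notation gC := (gC G).
Local Notation h := (hprod G).
Hypothesis Tl : forall v, linear (T^~ v).
Hypothesis Tr : forall u, linear (T u).
Hypothesis R1 : forall v w, linear (fun u => Rm u v w).
Hypothesis R2 : forall u w, linear (fun v => Rm u v w).
Hypothesis R3 : forall u v, linear (Rm u v).
Hypothesis gsym : forall u v, g u v = g v u.
Hypothesis gJ : forall u v, g (J u) (J v) = g u v.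
Hypothesis gpos : forall u, u != 0 -> 0 < g u u.
Hypothesis TN : forall u v, T u v = - T v u.
Hypothesis TJJ : forall u v, T (J u) (J v) = T u v + J (T (J u) v) + J (T u (J v)).
Hypothesis Tskew : forall u v w, g (T u v) w = - g (T u w) v.
Hypothesis RN : forall u v w, Rm u v w = - Rm v u w.
Hypothesis RJ : forall u v w, Rm u v (J w) = J (Rm u v w).
Hypothesis Rskew : forall u v w z, g (Rm u v w) z + g w (Rm u v z) = 0.
Hypothesis RT : forall u v w z, Rm u v (T w z) = T (Rm u v w) z + T w (Rm u v z).
Hypothesis Rbianchi : forall u v w, Rm u v w + Rm v w u + Rm w u v =
  T (T u v) w + T (T v w) u + T (T w u) v.
Hypothesis Tdl : forall v, linear (Td^~ v).
Hypothesis Tdr : forall u, linear (Td u).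
Hypothesis TdN : forall u v, Td u v = - Td v u.
Hypothesis Rd1 : forall v w, linear (fun u => Rd u v w).
Hypothesis Rd2 : forall u w, linear (fun v => Rd u v w).
Hypothesis Rd3 : forall u v, linear (Rd u v).
Hypothesis TdE : forall u v, Td u v = T u v - jpart J T u v + jpart J T v u.
Hypothesis RdE : forall u v w, Rd u v w = Rm u v w - jpart J T (T u v) w
  + jpart J T u (jpart J T v w) - jpart J T v (jpart J T u w).
Local Notation TC := (bil_ext T).
Local Notation RC := (tril_ext Rm).
Local Notation br := (bil_ext Td).
Local Notation Rc := (tril_ext Rd).
Hypothesis trace0 : forall e : 'I_n -> EC, orthoframe h T10 e ->
  forall k, \sum_j gC (TC (e j) (conjv (e j))) (e k) = 0.
Hypothesis Hc0 : forall x, x \in T10 -> gC (Rc x (conjv x) x) (conjv x) = 0.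

Let TCl := bil_extl Tl.
Let TCr := bil_extr Tr.
Let TCe := bil_ext_emb Tl Tr.
Let RC1 := tril_ext1 R1.
Let RC2 := tril_ext2 R2.
Let RC3 := tril_ext3 R3.
Let RCe := tril_ext_emb R1 R2 R3.
Let brl := bil_extl Tdl.
Let brr := bil_extr Tdr.
Let bre := bil_ext_emb Tdl Tdr.
Let Rc1 := tril_ext1 Rd1.
Let Rc2 := tril_ext2 Rd2.
Let Rc3 := tril_ext3 Rd3.
Let Rce := tril_ext_emb Rd1 Rd2 Rd3.

Let TCconj := bil_ext_conj Tl Tr.
Let RCconj := tril_ext_conj R1 R2 R3.
Let TCN := TC_anti TN TCl TCr TCe.
Let TCskew u v w : gC (TC u v) w = - gC (TC u w) v := TC_skew Tskew TCl TCr TCe u v w.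
Let gCsym u v : gC u v = gC v u := gC_sym gsym u v.
Let gCJ u v : gC (JC u) (JC v) = gC u v := gC_JC gJ u v.
Let TCJJ := TC_JC TJJ TCl TCr TCe.
Let RCN := RC_anti RN RC1 RC2 RC3 RCe.
Let RCJ := RC_JC RJ RC1 RC2 RC3 RCe.
Let RCskew u v w z : gC (RC u v w) z = - gC w (RC u v z) := RC_skew Rskew RC1 RC2 RC3 RCe u v w z.
Let RCT := RC_TC RT TCl TCr RC1 RC2 RC3 TCe RCe.
Let RCbianchi := RC_bianchi Rbianchi TCl TCr RC1 RC2 RC3 TCe RCe.
Let brJ := TD_jpart TCl TCr TCe brl brr bre TdE.
Let RcJ := RD_jpart TCl TCr RC1 RC2 RC3 TCe RCe Rc1 Rc2 Rc3 Rce RdE.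

Lemma gC_conj u v : (gC u v)^* = gC (conjv u) (conjv v).
Proof.
have H := @map_form _ (conjc : {rmorphism C -> C}) _ (emb G) u v.
rewrite /gC; apply: H; apply/matrixP => i j.
by rewrite !mxE /= oppr0.
Qed.

Lemma hprod_gt0 u : u != 0 -> 0 < h u u.
Proof.
move=> u0; rewrite /hprod {1}(vec_reim u).
set a := map_mx (@complex.Re R) u; set b := map_mx (@complex.Im R) u.
have -> : conjv u = emb a + (- 'i%C) *: emb b.
  by apply/rowP => j; rewrite !mxE; case: (u 0 j) => p q; simpc.
rewrite gC_realparts [g b a]gsym.
have -> : real_complex R (g a a) + - 'i%C * real_complex R (g a b)
    + 'i%C * (real_complex R (g a b) + - 'i%C * real_complex R (g b b)) =
    real_complex R (g a a + g b b).
  by rewrite rmorphD mulrDr mulrA mulrN -expr2 sqr_i opprK mul1r mulNr addrA addrNK.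
rewrite ltcR.
have g0 v : 0 <= g v v.
  have [->|v0] := eqVneq v 0; last exact/ltW/gpos.
  by rewrite mul0mx mul0mx mxE.
have [a0|a0] := eqVneq a 0; last by rewrite ltr_pwDl// gpos.
rewrite ltr_wpDl// gpos//; apply: contraNneq u0 => b0.
by rewrite (vec_reim u) -/a -/b a0 b0 !raddf0 ?scaler0 addr0.
Qed.

Let brE x z : x \in T10 -> z \in T10 -> br x z = - TC x z.
Proof.
move=> xT zT; rewrite brJ.
have A y w : y \in T10 -> w \in T10 -> jpart JC TC y w = TC y w.
  move=> yT wT; rewrite /jpart.
  have /eqP -> : JC w == 'i%C *: w by rewrite -mem_T10.
  rewrite (linfZ (TCr y)) (linfZ (@JC_lin R n)).
  have /eqP -> : JC (TC y w) == 'i%C *: TC y w.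
    by rewrite -mem_T10; exact: (TC_T10 TCl TCr TCJJ).
  rewrite scalerA -expr2 sqr_i scaleN1r opprK.
  have half (t : EC) : 2^-1 *: (t + t) = t.
    by rewrite -mulr2n -[t *+ 2]scaler_nat scalerA mulVf ?scale1r// pnatr_eq0.
  exact: half.
by rewrite !A// subrr add0r TCN.
Qed.

Lemma chern_bracket_T10 x z : x \in T10 -> z \in T10 -> br x z \in T10.
Proof. by move=> xT yT; rewrite brE// memvN; exact: (TC_T10 TCl TCr TCJJ). Qed.

Let conjK (z : EC) : conjv (conjv z) = z. Proof. exact: conjvK. Qed.

Let Ropconj x y z w : (h (RC x (conjv y) z) w)^* = h (RC y (conjv x) w) z.
Proof.
rewrite /hprod gC_conj conjK.
have -> : conjv (RC x (conjv y) z) = RC (conjv x) y (conjv z).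
  by rewrite -[y in RHS]conjK; exact: RCconj.
apply: etrans (RCskew (conjv x) y (conjv z) w) _.
apply: etrans (congr1 (fun t => - gC (conjv z) t) (RCN (conjv x) y w)) _.
have N := linfN (gC_linr G (conjv z)) (RC y (conjv x) w).
by apply: etrans (congr1 -%R N) _; rewrite opprK; exact: gCsym.
Qed.

Let Ropder x y z w : x \in T10 -> y \in T10 -> z \in T10 -> w \in T10 ->
  RC x (conjv y) (br z w) = br (RC x (conjv y) z) w + br z (RC x (conjv y) w).
Proof.
move=> xT yT zT wT; have RV u : u \in T10 -> RC x (conjv y) u \in T10.
  exact: (RC_T10 RC3 RCJ).
rewrite (brE zT wT) (brE (RV _ zT) wT) (brE zT (RV _ wT)) (linfN (RC3 x (conjv y))).
by rewrite (RCT x (conjv y) z w) opprD.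
Qed.

(** The curvature operators R (x, conj y) act on T^{1,0} as derivations of
    the bracket - T, and the frame formulas are those required by
    [ideal_split]. *)
Lemma pointwise_split (I : {vspace EC}) : (I <= T10)%VS ->
  (forall u a, u \in T10 -> a \in I -> br u a \in I) ->
  forall u, u \in T10 -> (forall a, a \in I -> h u a = 0) ->
  (forall a, a \in I -> br u a = 0) /\
  (forall v, v \in T10 -> (forall a, a \in I -> h v a = 0) ->
   forall a, a \in I -> h (br u v) a = 0).
Proof.
apply: (@ideal_split _ _ T10 n h br (fun x y z => RC x (conjv y) z)).
- exact: dim_T10.
- exact: (hprod_herm gCsym gC_conj).
- by move=> u _; exact: hprod_gt0.
- exact: brl.
- exact: brr.
- exact: (TC_anti TdN brl brr bre).
- exact: chern_bracket_T10.
- by move=> x y; exact: RC3.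
- by move=> y z; exact: RC1.
- by move=> x y z _ _; exact: (RC_T10 RC3 RCJ).
- exact: Ropconj.
- exact: Ropder.
- move=> e eF k; rewrite -[RHS](trace0 eF k); apply: eq_bigr => i _.
  by rewrite (torsion_11 TCskew eF brE).
- move=> e eF i j k l.
  exact: (rarr_formula gCsym gCJ gC_conj TCl TCr RC3 TCconj RCconj TCN TCskew TCJJ RCN RCJ
    RCskew RCbianchi eF brE Rc1 Rc2 Rc3 RcJ Hc0).
Qed.

End PointwiseSplit.

Section ChartSplit.
Variables (R : realType) (k : nat).
Local Notation n := k.+2.
Local Notation E := 'rV[R]_(n + n).
Local Notation EC := 'rV[R[i]]_(n + n).
Local Notation J := (mulmxr (@Jmx R n) : E -> E).
Variables (D : set E) (G : E -> 'M[R]_(n + n)) (Gb Gc : christoffel R n).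
Hypothesis oD : open D.
Hypothesis smG : smooth_on D G.
Hypothesis smGb : forall a b, smooth_on D (fun x => Gb x a b).
Hypothesis smGc : forall a b, smooth_on D (fun x => Gc x a b).
Hypothesis Gsym : forall x, D x -> (G x)^T = G x.
Hypothesis Gpos : forall x u, D x -> u != 0 -> 0 < metric_val G x u u.
Hypothesis GJ : forall x u v, D x ->
  metric_val G x (u *m Jmx) (v *m Jmx) = metric_val G x u v.
Hypothesis parGb : metric_parallel D G Gb.
Hypothesis parGc : metric_parallel D G Gc.
Hypothesis parJb : complex_parallel D Gb.
Hypothesis parJc : complex_parallel D Gc.
Hypothesis bskew : forall x u v w, D x ->
  metric_val G x (torsion_at Gb x u v) w = - metric_val G x (torsion_at Gb x u w) v.
Hypothesis cchern : forall x u v, D x -> u \in T10 -> v \in T10 ->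
  torsionC Gc x u (conj_vec v) = 0.
Hypothesis Tpar : torsion_parallel_on D Gb.
Variable x : E.
Hypothesis Dx : D x.
Hypothesis bal : forall v, ext_d (wedge_pow (hermitian_form G) k.+1) x v = 0.
Hypothesis Hc0 : forall u, u \in T10 ->
  metricC G x (curvatureC Gc x u (conj_vec u) u) (conj_vec u) = 0.

Let T := torsion_at Gb x.
Let Rm := curvature_at Gb x.

Let TN (Gam : christoffel R n) u v : torsion_at Gam x u v = - torsion_at Gam x v u.
Proof. by rewrite !torsion_atE /tor opprB. Qed.

Let gsym u v : metric_val G x u v = metric_val G x v u.
Proof. exact: (metric_val_sym Gsym u v Dx). Qed.

Let Tfun : T = tor (Gb x).
Proof. by apply/funext => u; apply/funext => v; exact: torsion_atE. Qed.

Let Rfun u v w : Rm u v w = curv Gb x u v w.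
Proof. exact: (curvature_atE smGb u v w Dx). Qed.

Let Rskew u v w z : metric_val G x (Rm u v w) z + metric_val G x w (Rm u v z) = 0.
Proof. by rewrite !Rfun; exact: (curv_skew oD smG smGb parGb u v w z Dx). Qed.

Let Rbianchi u v w : Rm u v w + Rm v w u + Rm w u v =
  T (T u v) w + T (T v w) u + T (T w u) v.
Proof. by rewrite !Rfun Tfun; exact: (curv_bianchi smGb Tpar u v w Dx). Qed.

Let RT u v w z : Rm u v (T w z) = T (Rm u v w) z + T w (Rm u v z).
Proof. by rewrite !Rfun Tfun; exact: (curv_tor oD smGb Tpar u v w z Dx). Qed.

Let trace0 (e : 'I_n -> EC) : orthoframe (hprod (G x)) T10 e ->
  forall i, \sum_j gC (G x) (bil_ext T (e j) (conj_vec (e j))) (e i) = 0.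
Proof.
move=> eF; have gJ u v : (J u *m G x *m (J v)^T) 0 0 = (u *m G x *m v^T) 0 0.
  exact: (GJ u v Dx).
have Tl : forall v, linear (T^~ v) by exact: torsion_at_linl.
have Tr : forall u, linear (T u) by exact: torsion_at_linr.
apply: (balanced_trace gJ eF (bil_extl Tl) (bil_extr Tr) (bil_ext_emb Tl Tr) (TN Gb)).
apply: (balanced_real_trace smG Gsym GJ parGb parJb bskew Dx bal) => i j.
  by have [] := re_frame gJ eF i j.
by have [] := re_frame gJ eF i j.
Qed.

Lemma chart_bracket_T10 u v : u \in T10 -> v \in T10 -> torsionC Gc x u v \in T10.
Proof.
apply: (@chern_bracket_T10 _ _ T (torsion_at Gc x)).
- exact: torsion_at_linl.
- exact: torsion_at_linr.
- exact: TN.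
- exact: (torJJ Dx parJb).
- exact: torsion_at_linl.
- exact: torsion_at_linr.
- move=> a b.
  exact: (chern_torsion smG Gsym Gpos GJ parGb parGc parJb parJc bskew cchern a b Dx).
Qed.

Lemma chart_split (I : {vspace EC}) : (I <= T10)%VS ->
  (forall u a, u \in T10 -> a \in I -> torsionC Gc x u a \in I) ->
  forall u, u \in T10 -> (forall a, a \in I -> herm_prod G x u a = 0) ->
  (forall a, a \in I -> torsionC Gc x u a = 0) /\
  (forall v, v \in T10 -> (forall a, a \in I -> herm_prod G x v a = 0) ->
   forall a, a \in I -> herm_prod G x (torsionC Gc x u v) a = 0).
Proof.
apply: (@pointwise_split _ _ (G x) T (torsion_at Gc x) Rm (curvature_at Gc x)).
- exact: torsion_at_linl.
- exact: torsion_at_linr.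
- by move=> v w; exact: (curvature_lin1 smGb Dx).
- by move=> v w; exact: (curvature_lin2 smGb Dx).
- by move=> v w; exact: (curvature_lin3 smGb Dx).
- exact: gsym.
- by move=> u v; exact: (GJ u v Dx).
- by move=> u; exact: (Gpos Dx).
- exact: TN.
- exact: (torJJ Dx parJb).
- by move=> u v w; exact: (bskew u v w Dx).
- by move=> u v w; exact: (curvature_antisym smGb Dx).
- exact: (curvature_J oD smGb Dx parJb).
- exact: Rskew.
- exact: RT.
- exact: Rbianchi.
- exact: torsion_at_linl.
- exact: torsion_at_linr.
- exact: TN.
- by move=> v w; exact: (curvature_lin1 smGc Dx).
- by move=> v w; exact: (curvature_lin2 smGc Dx).
- by move=> v w; exact: (curvature_lin3 smGc Dx).
- move=> u v.
  exact: (chern_torsion smG Gsym Gpos GJ parGb parGc parJb parJc bskew cchern u v Dx).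
- move=> u v w.
  exact: (chern_curvature oD smG smGb smGc Gsym Gpos GJ parGb parGc parJb parJc bskew cchern
    Tpar u v w Dx).
- exact: trace0.
- exact: Hc0.
Qed.

End ChartSplit.

Lemma memv_bigcapP (K : fieldType) (V : vectType K) (T : eqType) (s : seq T)
    (F : T -> {vspace V}) u :
  reflect (forall a, a \in s -> u \in F a) (u \in (\bigcap_(a <- s) F a)%VS).
Proof.
elim: s => [|b s IHs]; first by rewrite big_nil memvf; apply: ReflectT.
rewrite big_cons; apply: (iffP memv_capP) => [[ub /IHs us] a|H].
  by rewrite in_cons => /predU1P[->|/us].
by split; [|apply/IHs => a sa]; apply: H; rewrite in_cons ?eqxx ?sa ?orbT.
Qed.

Section Orth10.
Variables (R : realType) (n : nat).
Local Notation E := 'rV[R]_(n + n).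
Local Notation EC := 'rV[R[i]]_(n + n).

(** By sesquilinearity, orthogonality to a basis of I is orthogonality to I. *)
Lemma orth10P (G : E -> 'M[R]_(n + n)) (x : E) (I : {vspace EC}) (u : EC) :
  (forall v w, herm_prod G x w v = (herm_prod G x v w)^*) ->
  reflect (u \in T10 /\ forall a, a \in I -> herm_prod G x u a = 0) (u \in orth10 G x I).
Proof.
move=> hC; have hl a : linear (fun v : EC => herm_prod G x v a : R[i]^o).
  exact: (gC_linl (G x)).
have hE a v : linfun (fun v : EC => herm_prod G x v a : R[i]^o) v = herm_prod G x v a.
  pose L := GRing.isLinear.Build R[i] EC R[i]^o _ _ (hl a).
  pose f : {linear EC -> R[i]^o} := HB.pack (fun v : EC => herm_prod G x v a : R[i]^o) L.
  exact: (lfunE f).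
have kE a v : (v \in lker (linfun (fun v : EC => herm_prod G x v a : R[i]^o))) =
    (herm_prod G x v a == 0).
  by rewrite memv_ker; congr (_ == _); exact: hE.
have capP u' : reflect (forall b, b \in vbasis I -> herm_prod G x u' b = 0)
    (u' \in (\bigcap_(a <- vbasis I)
       lker (linfun (fun v : EC => herm_prod G x v a : R[i]^o)))%VS).
  by apply: (iffP (memv_bigcapP _ _ _)) => H b /H; rewrite kE => /eqP.
apply: (iffP memv_capP) => [[uT /capP ub]|[uT uI]]; split=> //; last first.
  by apply/capP => b /vbasis_mem; exact: uI.
move=> a aI; rewrite (coord_vbasis aI) hC.
rewrite (lin_sum (hl u)) big1 ?conjC0// => j _.
rewrite (hC u (vbasis I)`_j) ub ?conjC0 ?scaler0//.
by rewrite mem_nth// size_tuple.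
Qed.

End Orth10.

Theorem proposition7p3 (R : realType) (n : nat) (n_ge2 : (2 <= n)%N)
    (M : complexManifold R n) (g : hermitianMetric M)
    (g_balanced : is_balanced g) (g_BTP : is_BTP g)
    (Dc : connection M) (Dc_chern : is_chern g Dc)
    (Hc0 : zero_holo_sect_curv g Dc)
    (p : M) (i : chart_index M) (p_i : chart_dom (charts i) p) :
  let x := chart_coord (charts i) p in
  let h := herm_prod (gmx g i) x in
  let br := torsionC (symb Dc i) x in
  let r := lie_radical br T10 in
  let U := orth10 (gmx g i) x r in
  [/\ (* (1) *)
      (lie_span br U r = 0%VS /\ (lie_span br U U <= U)%VS) /\
      [/\ (r + U = T10)%VS, directv (r + U),
          (forall a u, a \in r -> u \in U -> h a u = 0),
          lie_ideal br T10 r /\ lie_ideal br T10 U &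
          lie_semisimple br U],
      (* (2) *)
      (forall z w, lie_center br T10 z -> w \in lie_span br T10 T10 ->
         h z w = 0) &
      (* (3) *)
      lie_nilpotent br T10 -> lie_abelian br T10].
Proof.
case: n n_ge2 M g g_balanced g_BTP Dc Dc_chern Hc0 p i p_i => [|[|k]]// _ M g g_bal.
move=> [Db [Db_herm Db_skew] Db_par] Dc [Dc_herm Dc_tor] Hc0 p i p_i x h br r U.
have [Db_g Db_J] := Db_herm i; have [Dc_g Dc_J] := Dc_herm i.
have Dx : chart_codom i x by exists p.
have oD : open (chart_codom i) by exact: chart_img_open.
have gsym u v : metric_val (gmx g i) x u v = metric_val (gmx g i) x v u.
  exact: (metric_val_sym (@gmx_sym _ _ _ g i) u v Dx).
have hh : hermitian_fun h by exact: (hprod_herm (gC_sym gsym) (gC_conj (gmx g i x))).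
have hpos u : u \in T10 -> u != 0 -> 0 < h u u.
  by move=> _ u0; apply: (hprod_gt0 gsym _ u0) => v v0; exact: gmx_pos.
have Hx u : u \in T10 ->
    metricC (gmx g i) x (curvatureC (symb Dc i) x u (conj_vec u) u) (conj_vec u) = 0.
  move=> uT; have [->|u0] := eqVneq u 0.
    rewrite [curvatureC _ _ _ _ _](_ : _ = 0); first by rewrite /metricC !mul0mx mxE.
    exact: (linf0 (tril_ext3 (curvature_lin3 (@symb_smooth _ _ _ Dc i) Dx) 0 (conj_vec 0))).
  have /eqP := Hc0 i x u Dx uT u0; rewrite /holo_sect_curv mulf_eq0 invr_eq0 expf_eq0 /=.
  by rewrite -/(h u u) (negPf (lt0r_neq0 (hpos u uT u0))) orbF => /eqP.
have split := chart_split oD (@gmx_smooth _ _ _ g i) (@symb_smooth _ _ _ Db i)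
  (@symb_smooth _ _ _ Dc i) (@gmx_sym _ _ _ g i) (@gmx_pos _ _ _ g i) (@gmx_J _ _ _ g i)
  Db_g Dc_g Db_J Dc_J (@Db_skew i) (@Dc_tor i) (Db_par i) Dx (fun v => g_bal i x v Dx) Hx.
have Tl : forall v, linear ((torsion_at (symb Dc i) x)^~ v) by exact: torsion_at_linl.
have Tr : forall u, linear (torsion_at (symb Dc i) x u) by exact: torsion_at_linr.
have brl : forall v, linear (br^~ v) by exact: (bil_extl Tl).
have brr : forall u, linear (br u) by exact: (bil_extr Tr).
have brN u v : br u v = - br v u.
  apply: (TC_anti _ brl brr (bil_ext_emb Tl Tr)) => a b.
  by rewrite !torsion_atE /tor opprB.
have brV u v : u \in T10 -> v \in T10 -> br u v \in T10.
  exact: (chart_bracket_T10 (@gmx_smooth _ _ _ g i) (@gmx_sym _ _ _ g i) (@gmx_pos _ _ _ g i)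
    (@gmx_J _ _ _ g i) Db_g Dc_g Db_J Dc_J (@Db_skew i) (@Dc_tor i) Dx).
have orthP (I : {vspace 'rV[R[i]]_(k.+2 + k.+2)}) u := orth10P I u (fun v w => hh.2 v w).
have dT := dim_T10 R k.+2.
have rid : lie_ideal br T10 r by have [] := radical_spec T10 brl brr brN.
have comm := orth_comm brl brr orthP split rid.
split.
- split.
    split.
      apply/eqP; rewrite -subv0; apply: lie_span_sub => // u a uU ar.
      by rewrite (comm _ _ ar uU) mem0v.
    by apply: lie_span_sub => // u v; exact: (orth_sub brl brr brV orthP split rid).
  split.
  + exact: (orth_add dT hh hpos orthP rid.1).
  + by apply/directv_addP; exact: (orth_cap hpos orthP rid.1).
  + by move=> a u ar /orthP[_ uh]; rewrite (hh.2 u a) (_ : h u a = 0) ?conjC0//; exact: uh.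
  + split=> //.
    exact: (orth_ideal dT hh hpos brl brr brN brV orthP split rid).
  exact: (orth_radical_semisimple dT hh hpos brl brr brN orthP split).
- move=> z w; exact: (center_orth dT hh hpos brl brr brN brV orthP split).
exact: (nilpotent_abelian dT hh hpos brl brr brN brV orthP split).
Qed.
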